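(* Let $\ell\ge1$ be an integer and $\lambda=\ell^2$. The assignment \[ \mathbf E_{\mathbf Q}\colon M_{\mathbf Q}\mapsto\bigl(\mathbf E_{\mathbf Q[\sqrt{-1}]}(M_{\mathbf Q[\sqrt{-1}]}),\varphi_\bullet\bigr) \] (defined in the context; on morphisms it is given by extension of scalars to $\mathbf Q[\sqrt{-1}]$ and restriction to the relevant weight spaces) from $\mathrm{HC}_\lambda(\mathfrak g,K)_{\mathbf Q}$ to the category $\operatorname{Rep}^{\rm nil}(\Gamma_{\mathbf Q})$ of $\mathbf Q$-rational finite-dimensional nilpotent representations of the $\mathbf Q$-rational Gelfand quiver is well-defined and an equivalence of categories.
   Context: Write $i=\sqrt{-1}$, $F=\mathbf Q[\sqrt{-1}]$, and let $c$ be the non-trivial element of $G=\operatorname{Gal}(F/\mathbf Q)$. **Harish-Chandra modules.** Let $\mathfrak g_{\mathbf Q}=\mathfrak{sl}_{2,\mathbf Q}$ and $K_{\mathbf Q}=\mathrm{SO}(2)_{\mathbf Q}=\operatorname{Spec}\mathbf Q[x,y]/(x^2+y^2-1)$, the point $(x,y)$ corresponding to $\begin{pmatrix} x & -y \\ y & x \end{pmatrix}$. A $(\mathfrak g,K)$-module over $\mathbf Q$ is a $\mathbf Q$-vector space $M_{\mathbf Q}$ which is a rational (algebraic, locally finite) representation of $K_{\mathbf Q}$ with a $\mathbf Q$-linear action of $\mathfrak g_{\mathbf Q}$ which is $K_{\mathbf Q}$-equivariant for the adjoint action and restricts on $\operatorname{Lie}K_{\mathbf Q}$ to the differential of the $K_{\mathbf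 Q}$-action. Put $M_F=F\otimes_{\mathbf Q}M_{\mathbf Q}$ with semi-linear involution $c(a\otimes m)=c(a)\otimes m$. Let \[ H=\begin{pmatrix} 0 & -i \\ i & 0 \end{pmatrix},\quad X=\tfrac12\begin{pmatrix} 1 & i \\ i & -1 \end{pmatrix},\quad Y=\tfrac12\begin{pmatrix} 1 & -i \\ -i & -1 \end{pmatrix} \] in $F\otimes\mathfrak g_{\mathbf Q}$, so $[H,X]=2X$, $[H,Y]=-2Y$, $[X,Y]=H$, and entrywise conjugation gives $cH=-H$, $cX=Y$, $cY=X$. Let $C=H^2-2H+4XY+1$ (this lies in $U(\mathfrak g_{\mathbf Q})$ and is central). For $n\in\mathbf Z$ let $M_n\subseteq M_F$ be the eigenspace of $H$ with eigenvalue $n$ (a $K$-isotypic component); $M_F=\bigoplus_nM_n$, $X M_n\subseteq M_{n+2}$, $YM_n\subseteq M_{n-2}$, $cM_n=M_{-n}$. $M_{\mathbf Q}$ is a Harish-Chandra module if it is finitely generated over $U(\mathfrak g_{\mathbf Q})$ and all $M_n$ are finite-dimensional. $\mathrm{HC}_\lambda(\mathfrak g,K)_{\mathbf Q}$ is the full subcategory of Harish-Chandra modules over $\mathbf Q$ with $(C-\lambda)^mM_{\mathbf Q}=0$ for some $m\ge0$ on which $-1_2\in\mathrm{SO}(2)$ acts as $(-1)^{\ell-1}$. **Quiver.** The Gelfand quiver has vertices $-,\star,+$, arrows $a_\pm\colon\pm\to\star$, $b_\pm\colon\star\to\pm$, and relation $a_-b_-=a_+b_+$. The $\mathbf Q$-rational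 Gelfand quiver $\Gamma_{\mathbf Q}$ is this quiver with the $G$-action $c\pm=\mp$, $c\star=\star$, $ca_\pm=a_\mp$, $cb_\pm=b_\mp$. A $\mathbf Q$-rational finite-dimensional representation consists of finite-dimensional $F$-vector spaces $M(-),M(\star),M(+)$, $F$-linear maps $\phi_{a_\pm}\colon M(\pm)\to M(\star)$, $\phi_{b_\pm}\colon M(\star)\to M(\pm)$ with $\phi_{a_-}\phi_{b_-}=\phi_{a_+}\phi_{b_+}$, and $c$-semi-linear isomorphisms $\varphi_\pm\colon M(\pm)\to M(\mp)$, $\varphi_\star\colon M(\star)\to M(\star)$ with $\varphi_\mp\varphi_\pm=\mathbf 1$, $\varphi_\star^2=\mathbf 1$, $\phi_{a_\mp}\varphi_\pm=\varphi_\star\phi_{a_\pm}$, $\phi_{b_\mp}\varphi_\star=\varphi_\pm\phi_{b_\pm}$. It is nilpotent if the composition of the maps along every sufficiently long path is zero. Morphisms are families of $F$-linear maps commuting with all $\phi$'s and $\varphi$'s. **The assignment.** Let $\gamma_\star=(\ell-1)!$, $X_\star=\gamma_\star^{-1}X^{\ell-1}|_{M_{-(\ell-1)}}\colon M_{-(\ell-1)}\to M_{\ell-1}$ and $Y_\star=\gamma_\star^{-1}Y^{\ell-1}|_{M_{\ell-1}}\colon M_{\ell-1}\to M_{-(\ell-1)}$ (both are invertible), and \[ T_-=4^{-(\ell-1)}\gamma_\star^{-2}\prod_{j=0}^{\ell-2}\bigl(C|_{M_{-(\ell+1)}}-(\ell-2-2j)^2\mathbf 1\bigr)\in\operatorname{Aut}(M_{-(\ell+1)}).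 \] $\mathbf E_F(M_F)$ is the representation $M(-)=M_{-(\ell+1)}$, $M(\star)=M_{-(\ell-1)}$, $M(+)=M_{\ell+1}$, $\phi_{a_+}=X_\star^{-1}Y$, $\phi_{a_-}=X$, $\phi_{b_+}=XX_\star$, $\phi_{b_-}=Y$. Unipotent stabilization: define recursively $\varphi_+^{(0)}=\mathbf 1_{M_{\ell+1}}$, $\varphi_-^{(0)}=T_-$, $\varphi_\star^{(0)}=X_\star$, and \[ \varphi_\pm^{(k+1)}=\tfrac12\bigl(\varphi_\pm^{(k)}+(c\,\varphi_\mp^{(k)}c)^{-1}\bigr),\qquad \varphi_\star^{(k+1)}=\tfrac12\bigl(\varphi_\star^{(k)}+(c\,\varphi_\star^{(k)}c)^{-1}\bigr); \] these sequences are eventually constant, with eventual values $\varphi_\pm^{(\infty)}\colon M_{\pm(\ell+1)}\to M_{\pm(\ell+1)}$ and $\varphi_\star^{(\infty)}\colon M_{-(\ell-1)}\to M_{\ell-1}$. Then $\varphi_\bullet$ is given by $\varphi_\pm=c\circ\varphi_\pm^{(\infty)}\colon M(\pm)\to M(\mp)$ and $\varphi_\star=c\circ\varphi_\star^{(\infty)}\colon M(\star)\to M(\star)$. *)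

(* Defs.v *)
From HB Require Import structures.
From mathcomp Require Import all_boot all_order all_algebra.
From mathcomp Require Import boolp classical_sets complex.
From mathcomp Require Import ring.

Set Implicit Arguments.
Unset Strict Implicit.
Unset Printing Implicit Defensive.

Import Order.TTheory GRing.Theory Num.Theory.
Local Open Scope ring_scope.
Local Open Scope classical_set_scope.
Local Open Scope quotient_scope.

Record category := Category {
  obj :> Type;
  hom : obj -> obj -> Type;
  idm : forall x, hom x x;
  compm : forall x y z, hom y z -> hom x y -> hom x z;
  comp1m : forall x y (f : hom x y), compm (idm y) f = f;
  compm1 : forall x y (f : hom x y), compm f (idm x) = f;
  compmA : forall x y z t (h : hom z t) (g : hom y z) (f : hom x y),
    compm h (compm g f) = compm (compm h g) f }.

Record functor (C D : category) := Functor {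
  fob :> C -> D;
  fmor : forall x y, hom x y -> hom (fob x) (fob y);
  fmor1 : forall x, fmor (idm x) = idm (fob x);
  fmorM : forall x y z (g : hom y z) (f : hom x y),
    fmor (compm g f) = compm (fmor g) (fmor f) }.

Definition functor_id (C : category) : functor C C :=
  @Functor C C id (fun _ _ f => f) (fun _ => erefl) (fun _ _ _ _ _ => erefl).

Definition functor_comp (C D E : category) (G : functor D E) (F : functor C D) :
  functor C E.
Proof.
apply: (@Functor C E (fun x => G (F x)) (fun x y f => fmor G (fmor F f))).
- by move=> x; rewrite !fmor1.
- by move=> x y z g f; rewrite !fmorM.
Defined.

Definition naturally_isomorphic (C D : category) (F G : functor C D) : Prop :=
  exists (t : forall x, hom (F x) (G x)) (s : forall x, hom (G x) (F x)),
    [/\ forall x y (f : hom x y), compm (t y) (fmor F f) = compm (fmor G f) (t x),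
        forall x, compm (s x) (t x) = idm (F x)
      & forall x, compm (t x) (s x) = idm (G x)].

Definition is_equivalence (C D : category) (F : functor C D) : Prop :=
  exists G : functor D C,
    naturally_isomorphic (functor_comp G F) (functor_id C) /\
    naturally_isomorphic (functor_comp F G) (functor_id D).

Definition finite_dim (K : fieldType) (V : lmodType K) : Prop :=
  exists (n : nat) (e : 'I_n -> V),
    forall v, exists a : 'I_n -> K, v = \sum_i a i *: e i.

(* A (x)_Q M is the quotient of the formal sums of pairs (a, m) identifying two
   sums when every Q-bilinear map out of A x M takes the same value on them. *)
Section Tensor.
Variables (A : comAlgType rat) (M : lmodType rat).

Definition qbilinear (W : lmodType rat) (b : A -> M -> W) : Prop :=
  (forall m, linear (b^~ m)) /\ (forall a, linear (b a)).

Definition formal_eval (W : lmodType rat) (b : A -> M -> W) (s : seq (A * M)) :=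
  \sum_(p <- s) b p.1 p.2.

Definition tens_eq (s t : seq (A * M)) : bool :=
  `[< forall (W : lmodType rat) (b : A -> M -> W),
        qbilinear b -> formal_eval b s = formal_eval b t >].

Lemma tens_eq_refl : reflexive tens_eq.
Proof. by move=> s; apply/asboolP. Qed.

Lemma tens_eq_sym : symmetric tens_eq.
Proof. by move=> s t; apply/asboolP/asboolP => h W b /h ->. Qed.

Lemma tens_eq_trans : transitive tens_eq.
Proof.
move=> t s u /asboolP h1 /asboolP h2; apply/asboolP => W b hb.
by rewrite (h1 _ _ hb) (h2 _ _ hb).
Qed.

Canonical tens_equiv := EquivRel tens_eq tens_eq_refl tens_eq_sym tens_eq_trans.

Definition tens : Type := {eq_quot tens_equiv}.
HB.instance Definition _ := Choice.on tens.

Definition tens_of (s : seq (A * M)) : tens := \pi_({eq_quot tens_equiv}) s.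
Definition tens_repr (u : tens) : seq (A * M) :=
  repr (u : {eq_quot tens_equiv}).

Lemma tens_reprK : cancel tens_repr tens_of.
Proof. by move=> u; rewrite /tens_of reprK. Qed.

Lemma tens_ofP (s t : seq (A * M)) : tens_of s = tens_of t <->
  forall (W : lmodType rat) (b : A -> M -> W),
    qbilinear b -> formal_eval b s = formal_eval b t.
Proof.
split=> [/eqP|h]; last by apply/eqP; rewrite /tens_of eqmodE; apply/asboolP.
by rewrite /tens_of eqmodE => /asboolP.
Qed.

Lemma formal_eval_repr (W : lmodType rat) (b : A -> M -> W) s :
  qbilinear b -> formal_eval b (tens_repr (tens_of s)) = formal_eval b s.
Proof. by move=> hb; apply: (tens_ofP _ _).1 => //; rewrite tens_reprK. Qed.

Lemma formal_eval_cat (W : lmodType rat) (b : A -> M -> W) s t :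
  formal_eval b (s ++ t) = formal_eval b s + formal_eval b t.
Proof. by rewrite /formal_eval big_cat. Qed.

Definition formal_scale (a : A) (s : seq (A * M)) :=
  [seq (a * p.1, p.2) | p <- s].

Lemma bilinear_scale (W : lmodType rat) (b : A -> M -> W) a :
  qbilinear b -> qbilinear (fun x => b (a * x)).
Proof.
move=> [h1 h2]; split=> [m k x y|x]; last exact: h2.
by rewrite mulrDr -scalerAr (h1 m).
Qed.

Lemma formal_eval_scale (W : lmodType rat) (b : A -> M -> W) a s :
  formal_eval b (formal_scale a s) = formal_eval (fun x => b (a * x)) s.
Proof. by rewrite /formal_eval big_map. Qed.

Definition tens_add (u v : tens) : tens := tens_of (tens_repr u ++ tens_repr v).
Definition tens_scale (a : A) (u : tens) : tens :=
  tens_of (formal_scale a (tens_repr u)).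

Lemma tens_addA : associative tens_add.
Proof.
move=> u v w; apply/tens_ofP => W b hb.
by rewrite !(formal_eval_cat, formal_eval_repr) // addrA.
Qed.

Lemma tens_addC : commutative tens_add.
Proof.
by move=> u v; apply/tens_ofP => W b hb; rewrite !formal_eval_cat addrC.
Qed.

Lemma tens_add0 : left_id (tens_of [::]) tens_add.
Proof.
move=> u; rewrite -[RHS]tens_reprK; apply/tens_ofP => W b hb.
by rewrite formal_eval_cat formal_eval_repr // /formal_eval big_nil add0r.
Qed.

Lemma tens_addN : left_inverse (tens_of [::]) (tens_scale (-1)) tens_add.
Proof.
move=> u; apply/tens_ofP => W b hb.
rewrite formal_eval_cat formal_eval_repr // formal_eval_scale.
rewrite {3}/formal_eval big_nil -big_split big1 // => p _ /=.
have h := hb.1 p.2 (-1); have e : b 0 p.2 = 0.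
  by have := h 0 0; rewrite scaler0 addr0 scaleN1r addNr.
by have := h p.1 0; rewrite addr0 e addr0 !scaleN1r mulN1r => ->; rewrite addNr.
Qed.

HB.instance Definition _ := GRing.isZmodule.Build tens
  tens_addA tens_addC tens_add0 tens_addN.

Lemma tens_scaleA a b (u : tens) :
  tens_scale a (tens_scale b u) = tens_scale (a * b) u.
Proof.
apply/tens_ofP => W f hf; rewrite !formal_eval_scale formal_eval_repr.
  by rewrite formal_eval_scale; apply: eq_bigr => p _; rewrite mulrA.
exact: bilinear_scale.
Qed.

Lemma tens_scale1 : left_id 1 tens_scale.
Proof.
move=> u; rewrite -[RHS]tens_reprK; apply/tens_ofP => W b hb.
by rewrite formal_eval_scale; apply: eq_bigr => p _; rewrite mul1r.
Qed.

Lemma tens_scaleDr : right_distributive tens_scale +%R.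
Proof.
move=> a u v; apply/tens_ofP => W b hb; have hb' := bilinear_scale a hb.
by rewrite !(formal_eval_scale, formal_eval_repr, formal_eval_cat).
Qed.

Lemma tens_scaleDl (u : tens) : {morph tens_scale^~ u : a b / a + b}.
Proof.
move=> x y /=; apply/tens_ofP => W b hb.
rewrite !(formal_eval_cat, formal_eval_repr, formal_eval_scale) //.
rewrite -big_split; apply: eq_bigr => p _ /=.
by have := hb.1 p.2 1 (x * p.1) (y * p.1); rewrite !scale1r mulrDl => ->.
Qed.

HB.instance Definition _ := GRing.Zmodule_isLmodule.Build A tens
  tens_scaleA tens_scale1 tens_scaleDr tens_scaleDl.

Definition pure (a : A) (m : M) : tens := tens_of [:: (a, m)].

End Tensor.

(* phi (x) f; only meaningful when phi and f are Q-linear. *)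
Definition tens_map (A B : comAlgType rat) (M N : lmodType rat)
    (phi : A -> B) (f : M -> N) (u : tens A M) : tens B N :=
  tens_of [seq (phi p.1, f p.2) | p <- tens_repr u].

Lemma bilinear_comp (A : comAlgType rat) (M N W : lmodType rat) (f : M -> N)
  (b : A -> N -> W) : linear f -> qbilinear b -> qbilinear (fun a m => b a (f m)).
Proof.
move=> hf [h1 h2]; split=> [m|a k m n]; first exact: h1.
by rewrite hf h2.
Qed.

Lemma formal_eval_map (A : comAlgType rat) (M N W : lmodType rat) (f : M -> N)
    (b : A -> N -> W) (s : seq (A * M)) :
  formal_eval b [seq (id p.1, f p.2) | p <- s] =
  formal_eval (fun a m => b a (f m)) s.
Proof. by rewrite /formal_eval big_map. Qed.

Lemma tens_map_linear (A : comAlgType rat) (M N : lmodType rat) (f : M -> N) :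
  linear f -> linear (@tens_map A A M N id f).
Proof.
move=> hf a u v; apply/tens_ofP => W b hb.
have hbf := bilinear_comp hf hb.
have hs := bilinear_scale a hb.
rewrite formal_eval_map formal_eval_cat formal_eval_repr //.
rewrite formal_eval_cat formal_eval_repr // formal_eval_scale.
rewrite formal_eval_repr // formal_eval_scale formal_eval_repr //.
by rewrite formal_eval_repr // !formal_eval_map.
Qed.

Lemma tens_map_id (A : comAlgType rat) (M : lmodType rat) :
  @tens_map A A M M id id =1 id.
Proof.
move=> u; rewrite -[RHS]tens_reprK; apply/tens_ofP => W b hb.
by rewrite /formal_eval big_map.
Qed.

Lemma tens_map_comp (A : comAlgType rat) (M N P : lmodType rat)
    (g : N -> P) (f : M -> N) : linear g -> linear f ->
  @tens_map A A M P id (g \o f) =1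
  @tens_map A A N P id g \o @tens_map A A M N id f.
Proof.
move=> hg hf u; apply/tens_ofP => W b hb.
rewrite !formal_eval_map formal_eval_repr; last exact: (bilinear_comp hg hb).
by rewrite formal_eval_map.
Qed.

(* [Rcomplex rat] is the field of the a + b i with a, b rational, seen as a
   Q-algebra; no real closedness is involved. *)
Definition Qi : Type := Rcomplex rat.
HB.instance Definition _ := GRing.Field.on Qi.
HB.instance Definition _ := GRing.Lalgebra.on Qi.
HB.instance Definition _ := GRing.Lalgebra_isComAlgebra.Build rat Qi.

Definition imQ : Qi := Complex 0 1.
Definition conjQ (z : Qi) : Qi := conjc (z : complex rat).

Section SO2.
Variable A : comPzRingType.

Record so2 := So2 { so2x : A; so2y : A; so2P : so2x ^+ 2 + so2y ^+ 2 = 1 }.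

Definition mx2 (a b c d : A) : 'M[A]_2 :=
  \matrix_(i, j) nth 0 (nth [::] [:: [:: a; b]; [:: c; d]] i) j.

Definition rot (g : so2) : 'M[A]_2 := mx2 (so2x g) (- so2y g) (so2y g) (so2x g).

Lemma so2_one_subproof : (1 : A) ^+ 2 + 0 ^+ 2 = 1.
Proof. by rewrite expr1n expr0n addr0. Qed.
Definition so2_one : so2 := So2 so2_one_subproof.

Lemma so2_neg_subproof : (- 1 : A) ^+ 2 + 0 ^+ 2 = 1.
Proof. by rewrite sqrrN so2_one_subproof. Qed.
Definition so2_neg : so2 := So2 so2_neg_subproof.

Lemma so2_inv_subproof (g : so2) : so2x g ^+ 2 + (- so2y g) ^+ 2 = 1.
Proof. by rewrite sqrrN so2P. Qed.
Definition so2_inv (g : so2) : so2 := So2 (so2_inv_subproof g).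

Lemma so2_mul_subproof (g h : so2) :
  (so2x g * so2x h - so2y g * so2y h) ^+ 2 +
  (so2x g * so2y h + so2y g * so2x h) ^+ 2 = 1.
Proof. by rewrite -[RHS]mulr1 -{1}(so2P g) -(so2P h); ring. Qed.
Definition so2_mul (g h : so2) : so2 := So2 (so2_mul_subproof g h).

End SO2.

Lemma so2_map_subproof (A B : comPzRingType) (phi : {rmorphism A -> B})
  (g : so2 A) : phi (so2x g) ^+ 2 + phi (so2y g) ^+ 2 = 1.
Proof. by rewrite -!rmorphXn -rmorphD so2P rmorph1. Qed.
Definition so2_map (A B : comPzRingType) (phi : {rmorphism A -> B})
  (g : so2 A) : so2 B := So2 (so2_map_subproof phi g).

Section Sl2.
Variable A : comPzRingType.

Definition traceless : {pred 'M[A]_2} := fun Z => \tr Z == 0.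

Record sl2 := Sl2 { sl2_mx :> 'M[A]_2; sl2P : sl2_mx \in traceless }.

HB.instance Definition _ := [isSub for sl2_mx].
HB.instance Definition _ := [Choice of sl2 by <:].

Lemma traceless_submod : submod_closed traceless.
Proof.
split=> [|a Z W /eqP hZ /eqP hW]; first by rewrite unfold_in mxtrace0.
by rewrite unfold_in mxtraceD mxtraceZ hZ hW mulr0 addr0.
Qed.
HB.instance Definition _ :=
  GRing.isSubmodClosed.Build A 'M[A]_2 traceless traceless_submod.
HB.instance Definition _ := [SubChoice_isSubLmodule of sl2 by <:].

Lemma bracket_subproof (Z W : sl2) :
  sl2_mx Z *m sl2_mx W - sl2_mx W *m sl2_mx Z \in traceless.
Proof. by rewrite unfold_in linearB /= mxtrace_mulC subrr. Qed.
Definition bracket (Z W : sl2) : sl2 := Sl2 (bracket_subproof Z W).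

Lemma mx2_traceless (a b c : A) : mx2 a b c (- a) \in traceless.
Proof. by rewrite unfold_in /mxtrace big_ord_recl big_ord1 !mxE /= subrr. Qed.
Definition sl2_of (a b c : A) : sl2 := Sl2 (mx2_traceless a b c).

End Sl2.

(* A representation of the group scheme SO(2)_Q on M: an A-linear action of
   SO(2)(A) on A (x) M for every commutative Q-algebra A, functorial in A. By
   Yoneda this amounts to a coaction M -> M (x) Q[x,y]/(x^2+y^2-1), so that M
   is automatically locally finite. *)
Record so2_rep (M : lmodType rat)
    (k : forall A : comAlgType rat, so2 A -> tens A M -> tens A M) : Prop := {
  so2_rep_linear : forall (A : comAlgType rat) (g : so2 A), linear (k A g);
  so2_rep1 : forall (A : comAlgType rat) u, k A (so2_one A) u = u;
  so2_repM : forall (A : comAlgType rat) (g h : so2 A) u,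
    k A (so2_mul g h) u = k A g (k A h u);
  so2_rep_nat : forall (A B : comAlgType rat) (phi : {lrmorphism A -> B})
    (g : so2 A) u,
    tens_map phi id (k A g u) = k B (so2_map phi g) (tens_map phi id u) }.

(* The action on A (x) M of Z in A (x) g, Z a traceless matrix over A:
   Z = Z_00 h + Z_01 e + Z_10 f with h, e, f the standard basis of g. *)
Definition lie_ext (M : lmodType rat) (act : sl2 rat -> M -> M)
    (A : comAlgType rat) (Z : 'M[A]_2) (u : tens A M) : tens A M :=
  Z 0 0 *: tens_map id (act (sl2_of 1 0 0)) u
  + Z 0 1 *: tens_map id (act (sl2_of 0 1 0)) u
  + Z 1 0 *: tens_map id (act (sl2_of 0 0 1)) u.

(* Lie K is spanned by J = (0, -1; 1, 0), and the points (1, y) of SO(2), for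
   which y^2 = 0, are the 1 + y J. *)
Record gk_axioms (M : lmodType rat)
    (k : forall A : comAlgType rat, so2 A -> tens A M -> tens A M)
    (act : sl2 rat -> M -> M) : Prop := {
  gk_rep : so2_rep k;
  gk_linl : forall m, linear (act^~ m);
  gk_linr : forall Z, linear (act Z);
  gk_bracket : forall Z W m,
    act (bracket Z W) m = act Z (act W m) - act W (act Z m);
  gk_equivariant : forall (A : comAlgType rat) (g : so2 A) (Z : sl2 A) u,
    k A g (lie_ext act Z u) =
    lie_ext act (rot g *m Z *m rot (so2_inv g)) (k A g u);
  gk_differential : forall (A : comAlgType rat) (g : so2 A) m,
    so2x g = 1 ->
    k A g (pure 1 m) = pure 1 m + pure (so2y g) (act (sl2_of 0 (-1) 1) m) }.

Record gkmod := GKMod {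
  gk_sort :> lmodType rat;
  gk_k : forall A : comAlgType rat, so2 A -> tens A gk_sort -> tens A gk_sort;
  gk_g : sl2 rat -> gk_sort -> gk_sort;
  gkP : gk_axioms gk_k gk_g }.

Record is_gkhom (M N : gkmod) (f : M -> N) : Prop := {
  gkhom_linear : linear f;
  gkhom_g : forall Z m, f (gk_g Z m) = gk_g Z (f m);
  gkhom_k : forall (A : comAlgType rat) (g : so2 A) u,
    tens_map id f (gk_k g u) = gk_k g (tens_map id f u) }.

Record gkhom (M N : gkmod) := GKHom {
  gkhom_fun :> M -> N;
  gkhomP : is_gkhom gkhom_fun }.

Lemma gkhom_eq (M N : gkmod) (f g : gkhom M N) :
  gkhom_fun f = gkhom_fun g -> f = g.
Proof.
case: f g => f hf [g hg] /= e; case: _ / e in hg *.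
by rewrite (Prop_irrelevance hf hg).
Qed.

Lemma gkhom_id_subproof (M : gkmod) : is_gkhom (@id M).
Proof. by split=> // A g u; rewrite !tens_map_id. Qed.
Definition gkhom_id (M : gkmod) : gkhom M M := GKHom (gkhom_id_subproof M).

Lemma gkhom_comp_subproof (M N P : gkmod) (g : gkhom N P) (f : gkhom M N) :
  is_gkhom (g \o f).
Proof.
case: g f => g [g1 g2 g3] [f [f1 f2 f3]] /=; split=> [a u v|Z m|A x u] /=.
- by rewrite f1 g1.
- by rewrite f2 g2.
- by rewrite !tens_map_comp //= f3 g3.
Qed.
Definition gkhom_comp (M N P : gkmod) (g : gkhom N P) (f : gkhom M N) :
  gkhom M P := GKHom (gkhom_comp_subproof g f).

Definition ext (M : gkmod) := tens Qi M.
HB.instance Definition _ M := GRing.Lmodule.on (ext M).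

Definition opF (M : gkmod) (Z : 'M[Qi]_2) : ext M -> ext M :=
  lie_ext (@gk_g M) Z.
Arguments opF : clear implicits.

Definition opH (M : gkmod) := opF M (mx2 0 (- imQ) imQ 0).
Definition opX (M : gkmod) := opF M (2^-1 *: mx2 1 imQ imQ (- 1)).
Definition opY (M : gkmod) := opF M (2^-1 *: mx2 1 (- imQ) (- imQ) (- 1)).
Definition opC (M : gkmod) (u : ext M) : ext M :=
  opH (opH u) - 2 *: opH u + 4 *: opX (opY u) + u.
Definition opc (M : gkmod) : ext M -> ext M := tens_map conjQ id.

Definition in_weight (M : gkmod) (n : int) : {pred ext M} :=
  fun u => opH u == n%:~R *: u.
Arguments in_weight : clear implicits.

Record weight (M : gkmod) (n : int) := Weight {
  weight_val :> ext M;
  weightP : weight_val \in in_weight M n }.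

Lemma opF_linear (M : gkmod) (Z : 'M[Qi]_2) : linear (opF M Z).
Proof.
move=> a u v; rewrite /opF /lie_ext.
have h W := tens_map_linear (A := Qi) (gk_linr (gkP M) W) a u v.
rewrite !h !scalerDr !scalerA ![a * _]mulrC.
by rewrite [X in X + _ = _]addrACA [LHS]addrACA.
Qed.

Lemma in_weight_submod (M : gkmod) (n : int) : submod_closed (in_weight M n).
Proof.
have h := @opF_linear M (mx2 0 (- imQ) imQ 0).
split=> [|a u v /eqP hu /eqP hv]; apply/eqP.
  have := h (-1) 0 0; rewrite scaler0 addr0 scaleN1r addNr => e.
  by rewrite scaler0; apply: e.
by rewrite /opH h -/(opH u) -/(opH v) hu hv scalerDr !scalerA mulrC.
Qed.

HB.instance Definition _ M n :=
  GRing.isSubmodClosed.Build Qi (ext M) (in_weight M n) (in_weight_submod M n).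
HB.instance Definition _ M n := [isSub for @weight_val M n].
HB.instance Definition _ M n := [Choice of weight M n by <:].
HB.instance Definition _ M n := [SubChoice_isSubLmodule of weight M n by <:].

(* An element of U(g_Q), a quotient of the tensor algebra of g_Q, is represented
   by a linear combination of words in g_Q. *)
Definition env_act (M : gkmod) (w : seq (rat * seq (sl2 rat))) (m : M) : M :=
  \sum_(p <- w) p.1 *: foldr (@gk_g M) m p.2.

(* The condition on C is the one on M_Q, which sits in M_F as 1 (x) M_Q. *)
Record is_HC (l : nat) (lam : rat) (M : gkmod) : Prop := {
  HC_fg : exists (n : nat) (e : 'I_n -> M), forall m,
    exists w : 'I_n -> seq (rat * seq (sl2 rat)),
      m = \sum_i env_act (w i) (e i);
  HC_finite : forall n : int, finite_dim (weight M n);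
  HC_character : exists k : nat, forall m : M,
    iter k (fun u : ext M => opC u - ratr lam *: u) (pure 1 m) = 0;
  HC_parity : forall m : M, gk_k (so2_neg _) (pure (1 : rat^o) m) =
    pure (1 : rat^o) ((-1) ^+ l.-1 *: m) }.

Record HC_obj (l : nat) (lam : rat) := HCObj {
  HC_mod :> gkmod;
  HCP : is_HC l lam HC_mod }.

Definition HC (l : nat) (lam : rat) : category.
Proof.
apply: (@Category (HC_obj l lam) (fun M N => gkhom M N)
  (fun M => gkhom_id M) (fun M N P g f => gkhom_comp g f));
  by move=> *; apply: gkhom_eq.
Defined.

Inductive vertex := vminus | vstar | vplus.

Inductive arrow : vertex -> vertex -> Type :=
| a_plus : arrow vplus vstar
| a_minus : arrow vminus vstar
| b_plus : arrow vstar vplus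
| b_minus : arrow vstar vminus.

Definition cvertex (v : vertex) : vertex :=
  match v with vminus => vplus | vstar => vstar | vplus => vminus end.

Definition carrow (v w : vertex) (a : arrow v w) :
    arrow (cvertex v) (cvertex w) :=
  match a with
  | a_plus => a_minus | a_minus => a_plus
  | b_plus => b_minus | b_minus => b_plus
  end.

Inductive qpath : vertex -> vertex -> Type :=
| path_nil v : qpath v v
| path_cons u v w : arrow v w -> qpath u v -> qpath u w.

Fixpoint path_length v w (p : qpath v w) : nat :=
  match p with path_nil _ => 0 | path_cons _ _ _ _ q => (path_length q).+1 end.

Record rep_data := RepData {
  rV :> vertex -> lmodType Qi;
  rphi : forall v w, arrow v w -> rV v -> rV w;
  rvar : forall v, rV v -> rV (cvertex v) }.
Arguments rvar : clear implicits.

Fixpoint path_act (R : rep_data) v w (p : qpath v w) : R v -> R w :=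
  match p in qpath v w return R v -> R w with
  | path_nil _ => id
  | path_cons _ _ _ a q => fun x => rphi a (path_act q x)
  end.

Record is_nil_rep (R : rep_data) : Prop := {
  rep_finite : forall v, finite_dim (R v);
  rep_linear : forall v w (a : arrow v w), linear (@rphi R v w a);
  rep_relation : forall x : R vstar,
    rphi a_minus (rphi b_minus x) = rphi a_plus (rphi b_plus x);
  rep_semilinear : forall v (a : Qi) (x y : R v),
    rvar R v (a *: x + y) = conjQ a *: rvar R v x + rvar R v y;
  rep_invol_plus : forall x : R vplus, rvar R vminus (rvar R vplus x) = x;
  rep_invol_minus : forall x : R vminus, rvar R vplus (rvar R vminus x) = x;
  rep_invol_star : forall x : R vstar, rvar R vstar (rvar R vstar x) = x;
  rep_equivariant : forall v w (a : arrow v w) (x : R v),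
    rphi (carrow a) (rvar R v x) = rvar R w (rphi a x);
  rep_nilpotent : exists n : nat, forall v w (p : qpath v w),
    (n <= path_length p)%N -> forall x : R v, path_act p x = 0 }.

Record rep_obj := RepObj {
  rep_of :> rep_data;
  repP : is_nil_rep rep_of }.

Record is_rephom (R S : rep_data) (f : forall v, R v -> S v) : Prop := {
  rephom_linear : forall v, linear (f v);
  rephom_phi : forall v w (a : arrow v w) x, f w (rphi a x) = rphi a (f v x);
  rephom_var : forall v x, f (cvertex v) (rvar R v x) = rvar S v (f v x) }.

Record rephom (R S : rep_data) := RepHom {
  rephom_fun :> forall v, R v -> S v;
  rephomP : is_rephom rephom_fun }.

Lemma rephom_eq (R S : rep_data) (f g : rephom R S) :
  rephom_fun f = rephom_fun g -> f = g.
Proof.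
case: f g => f hf [g hg] /= e; case: _ / e in hg *.
by rewrite (Prop_irrelevance hf hg).
Qed.

Lemma rephom_id_subproof (R : rep_data) : is_rephom (fun v => @id (R v)).
Proof. by []. Qed.
Definition rephom_id (R : rep_data) : rephom R R :=
  RepHom (rephom_id_subproof R).

Lemma rephom_comp_subproof (R S T : rep_data) (g : rephom S T)
  (f : rephom R S) : is_rephom (fun v => g v \o f v).
Proof.
case: g f => g [g1 g2 g3] [f [f1 f2 f3]] /=.
split=> [v a x y|v w a x|v x] /=.
- by rewrite f1 g1.
- by rewrite f2 g2.
- by rewrite f3 g3.
Qed.
Definition rephom_comp (R S T : rep_data) (g : rephom S T) (f : rephom R S) :
  rephom R T := RepHom (rephom_comp_subproof g f).

Definition RepNil : category.
Proof.
apply: (@Category rep_obj (fun R S => rephom R S)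
  (fun R => rephom_id R) (fun R S T g f => rephom_comp g f));
  by move=> *; apply: rephom_eq.
Defined.

(* Only meaningful when f is bijective; u0 is a dummy value. *)
Definition minv (U V : choiceType) (u0 : U) (f : U -> V) (v : V) : U :=
  xget u0 [set u | f u = v].

(* Only meaningful when s is eventually constant. *)
Definition eventual_value (U : Type) (V : lmodType Qi) (s : nat -> U -> V)
    (u : U) : V :=
  xget 0 [set v | exists n : nat, forall k, (n <= k)%N -> s k u = v].

Definition eventually_constant (U V : Type) (s : nat -> U -> V) : Prop :=
  exists n : nat, forall k, (n <= k)%N -> s k =1 s n.

(* The map M_m -> N_n induced by f; it is only meaningful when f maps M_m into
   N_n, which is a part of [E_object_wd] and [E_wd] below. *)
Definition wmap (M N : gkmod) (m n : int) (f : ext M -> ext N)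
    (u : weight M m) : weight N n :=
  insubd 0 (f (weight_val u)).
Arguments wmap [M N m n] f u.

Section Assignment.
Variables (l : nat) (M : gkmod).

Local Notation p := (l%:Z + 1).
Local Notation q := (l%:Z - 1).
Local Notation Mw := (weight M).

Definition conjw (m n : int) : Mw m -> Mw n := wmap (@opc M).

Definition gamma_star : Qi := (l.-1)`!%:R.

Definition X_star : Mw (- q) -> Mw q :=
  wmap (fun u => gamma_star^-1 *: iter l.-1 (@opX M) u).

Definition T_minus : Mw (- p) -> Mw (- p) :=
  wmap (fun u => ((4 ^+ l.-1)^-1 * gamma_star ^- 2) *:
    foldr (fun j v => opC v - ((l%:Z - 2 - 2 * j%:Z) ^+ 2)%:~R *: v)
          u (iota 0 l.-1)).

Definition average (U : Type) (V : lmodType Qi) (f g : U -> V) : U -> V :=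
  fun u => 2^-1 *: (f u + g u).

Definition stab_pm (k : nat) : (Mw p -> Mw p) * (Mw (- p) -> Mw (- p)) :=
  iter k (fun f =>
      (average f.1 (minv 0 (@conjw (- p) p \o f.2 \o @conjw p (- p))),
       average f.2 (minv 0 (@conjw p (- p) \o f.1 \o @conjw (- p) p))))
    (id, T_minus).

Definition stab_plus (k : nat) : Mw p -> Mw p := (stab_pm k).1.
Definition stab_minus (k : nat) : Mw (- p) -> Mw (- p) := (stab_pm k).2.

Definition stab_star (k : nat) : Mw (- q) -> Mw q :=
  iter k (fun f =>
      average f (minv 0 (@conjw q (- q) \o f \o @conjw q (- q))))
    X_star.

Definition vweight (v : vertex) : int :=
  match v with vminus => - p | vstar => - q | vplus => p end.

Definition E_phi (v w : vertex) (a : arrow v w) :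
    Mw (vweight v) -> Mw (vweight w) :=
  match a in arrow v w return Mw (vweight v) -> Mw (vweight w) with
  | a_plus => minv 0 X_star \o (wmap (@opY M) : Mw p -> Mw q)
  | a_minus => wmap (@opX M)
  | b_plus => (wmap (@opX M) : Mw q -> Mw p) \o X_star
  | b_minus => wmap (@opY M)
  end.

Definition E_var (v : vertex) : Mw (vweight v) -> Mw (vweight (cvertex v)) :=
  match v return Mw (vweight v) -> Mw (vweight (cvertex v)) with
  | vminus => @conjw (- p) p \o eventual_value stab_minus
  | vstar => @conjw q (- q) \o eventual_value stab_star
  | vplus => @conjw p (- p) \o eventual_value stab_plus
  end.

Definition E_data : rep_data :=
  RepData (rV := fun v => Mw (vweight v)) E_phi E_var.

(* The restrictions, inverses and eventual values used in [E_data] exist; all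
   these properties are claims, none is assumed. *)
Record E_object_wd : Prop := {
  E_H_X : forall n (u : Mw n), opX (weight_val u) \in in_weight M (n + 2);
  E_H_Y : forall n (u : Mw n), opY (weight_val u) \in in_weight M (n - 2);
  E_H_C : forall n (u : Mw n), opC (weight_val u) \in in_weight M n;
  E_H_c : forall n (u : Mw n), opc (weight_val u) \in in_weight M (- n);
  E_X_star : bijective X_star;
  E_T_minus : bijective T_minus;
  E_stab_bij : forall k, [/\ bijective (stab_plus k), bijective (stab_minus k)
    & bijective (stab_star k)];
  E_stab_plus : eventually_constant stab_plus;
  E_stab_minus : eventually_constant stab_minus;
  E_stab_star : eventually_constant stab_star }.

End Assignment.

Definition E_mor (l : nat) (M N : gkmod) (f : gkhom M N) (v : vertex) :
    E_data l M v -> E_data l N v :=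
  wmap (tens_map id f).
Arguments E_mor l [M N] f v.

Record E_wd (l : nat) (lam : rat) : Prop := {
  E_objectP : forall M : HC l lam, E_object_wd l (HC_mod M);
  E_repP : forall M : HC l lam, is_nil_rep (E_data l (HC_mod M));
  E_weightP : forall (M N : HC l lam) (f : hom M N) n
    (u : weight (HC_mod M) n),
    tens_map id (gkhom_fun f) (weight_val u) \in in_weight (HC_mod N) n;
  E_morP : forall (M N : HC l lam) (f : hom M N), is_rephom (E_mor l f);
  E_mor1 : forall (M : HC l lam) v, E_mor l (@idm (HC l lam) M) v =1 id;
  E_morM : forall (M N P : HC l lam) (g : hom N P) (f : hom M N) v,
    E_mor l (compm g f) v =1 E_mor l g v \o E_mor l f v }.

Definition E_functor (l : nat) (lam : rat) (wd : E_wd l lam) :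
  functor (HC l lam) RepNil.
Proof.
apply: (@Functor (HC l lam) RepNil (fun M => RepObj (E_repP wd M))
  (fun M N f => RepHom (E_morP wd f))).
- move=> M; apply: rephom_eq.
  by apply: functional_extensionality_dep => v; apply/funext => u; apply: (E_mor1 wd).
- move=> M N P g f; apply: rephom_eq.
  by apply: functional_extensionality_dep => v; apply/funext => u; apply: (E_morM wd).
Defined.

(* Main.v *)
Require Import Defs.
From HB Require Import structures.
From mathcomp Require Import all_boot all_order all_algebra.
From mathcomp Require Import boolp classical_sets complex.
From mathcomp Require Import ring zify.

Set Implicit Arguments.
Unset Strict Implicit.
Unset Printing Implicit Defensive.

Import Order.TTheory GRing.Theory Num.Theory.
Local Open Scope ring_scope.

(** The idea is that of Gelfand's description of the category over F, refined by
    keeping track of the conjugation.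

    Put N = (C - l^2) / 4, which is nilpotent. On weight n one has 4 X Y =
    C - (n-1)^2 and 4 Y X = C - (n+1)^2. If the weights of the parity of l - 1 are
    numbered by n = 2 k - (l-1), this says that X Y is N + k (l - k) on the k-th
    weight space (XY_wk, YX_wk). Hence X and Y are bijective between neighbouring
    weight spaces except across k = 0 and k = l, where both composites are N, and
    the whole module over F is generated by the three weight spaces numbered -1,
    0 and l (hc_ind). Moreover maps given on these three spaces and compatible
    with the arrows of the quiver extend uniquely to the module (hc_extension,
    hc_ext). The extension theorem allows semi-linear maps, and it may be applied
    with X and Y exchanged and H negated; this is how conjugations are produced.

    The group enters through weights only. Over F the group SO(2) is the
    multiplicative group with coordinate z = x - i y. Expanding the action of its
    universal point in powers of z splits F (x) M into eigenspaces of H on which K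
    acts by z^n (gk_weights); conversely a g-module with integral weights
    integrates to K, first over algebras containing i and then over Q because z^n
    is compatible with conjugation (integrable).

    Conjugation exchanges X with Y and weight n with -n. To land again in the
    chosen three weight spaces one composes with X_star at the middle vertex, and
    the result fails to be an involution by the factor tau(N) = T, a polynomial in
    N with constant term 1. All the maps of the stabilization are polynomials in N,
    up to X_star, and the recursion is Newton's iteration for the inverse square
    root of tau in Q[N] (stab_poly). It stops once N^m = 0, with the values s(N),
    (tau s)(N) and X_star s(N), where s^2 tau = 1; this identity is what makes the
    resulting semi-linear maps involutive (var_plusK, var_minusK, var_starK).

    Faithfulness is generation by the vertices. For fullness, a morphism of quiver
    representations extends to an F-linear map commuting with X and Y, and this map
    commutes with conjugation since it does so at the vertices (E_extension,
    E_extension_conj); so it is defined over Q. For essential surjectivity, a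
    representation R is spread out on a ladder of copies of its spaces on which X
    is the identity or an arrow (quiver_model); the involution of R extends to a
    conjugation c of this module (conj_of_quiver), and the vectors fixed by c form
    the required module over Q (descent_algebra, descent_is_HC, realize_hom). *)
(** * Linear identities by comparison of coefficients *)

(** Formal linear combinations: an identity between explicit linear
    combinations of vectors reduces to one scalar identity per vector. *)
Inductive lexp (K : Type) :=
  | LAtom of nat
  | LZero
  | LAdd of lexp K & lexp K
  | LOpp of lexp K
  | LMuln of lexp K & nat
  | LScale of K & lexp K.
Arguments LAtom {K}.
Arguments LZero {K}.

Fixpoint leval (K : pzRingType) (V : lmodType K) (env : seq V) (e : lexp K) : V :=
  match e with
  | LAtom i => nth 0 env i
  | LZero => 0
  | LAdd e1 e2 => leval env e1 + leval env e2
  | LOpp e1 => - leval env e1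
  | LMuln e1 n => leval env e1 *+ n
  | LScale a e1 => a *: leval env e1
  end.

Fixpoint lcoef (K : pzRingType) (i : nat) (e : lexp K) : K :=
  match e with
  | LAtom j => if Nat.eqb i j then 1 else 0
  | LZero => 0
  | LAdd e1 e2 => lcoef i e1 + lcoef i e2
  | LOpp e1 => - lcoef i e1
  | LMuln e1 n => n%:R * lcoef i e1
  | LScale a e1 => a * lcoef i e1
  end.

Fixpoint lbounded (K : Type) (n : nat) (e : lexp K) : bool :=
  match e with
  | LAtom j => (j < n)%N
  | LZero => true
  | LAdd e1 e2 => lbounded n e1 && lbounded n e2
  | LOpp e1 => lbounded n e1
  | LMuln e1 _ => lbounded n e1
  | LScale _ e1 => lbounded n e1
  end.

Fixpoint lagree (K : pzRingType) (n : nat) (e1 e2 : lexp K) : Prop :=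
  match n with
  | 0 => True
  | n'.+1 => lcoef n' e1 = lcoef n' e2 /\ lagree n' e1 e2
  end.

Lemma leval_coef (K : pzRingType) (V : lmodType K) (env : seq V) (e : lexp K) :
  lbounded (size env) e ->
  leval env e = \sum_(i < size env) lcoef i e *: nth 0 env i.
Proof.
elim: e => [j|_|e1 h1 e2 h2 /= /andP[/h1-> /h2->]|e1 h1 /= /h1->|e1 h1 n /= /h1->|a e1 h1 /= /h1->] /=.
- move=> hj; rewrite (bigD1 (Ordinal hj)) //= PeanoNat.Nat.eqb_refl scale1r.
  rewrite big1 ?addr0 // => i /eqP hi; case: PeanoNat.Nat.eqb_spec => [e|]; last by rewrite scale0r.
  by case: hi; apply/val_inj.
- by rewrite big1 // => i _; rewrite scale0r.
- by rewrite -big_split; apply: eq_bigr => i _; rewrite scalerDl.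
- by rewrite -sumrN; apply: eq_bigr => i _; rewrite scaleNr.
- by rewrite -sumrMnl; apply: eq_bigr => i _; rewrite -scalerA scaler_nat.
- by rewrite scaler_sumr; apply: eq_bigr => i _; rewrite scalerA.
Qed.

Lemma leval_eq (K : pzRingType) (V : lmodType K) (env : seq V) (e1 e2 : lexp K) :
  lbounded (size env) e1 && lbounded (size env) e2 ->
  lagree (size env) e1 e2 -> leval env e1 = leval env e2.
Proof.
case/andP=> h1 h2 h; rewrite !leval_coef //.
suff {h1 h2} h' : forall n i, (i < n)%N -> lagree n e1 e2 -> lcoef i e1 = lcoef i e2.
  by apply: eq_bigr => i _; rewrite (h' (size env)).
elim=> // n IH i; rewrite ltnS leq_eqVlt => /orP[/eqP->[]//|hi [_]]; exact: IH.
Qed.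

Ltac lmem x l :=
  match l with
  | nil => constr:(false)
  | cons x _ => constr:(true)
  | cons _ ?l' => lmem x l'
  end.
Ltac ladd x l :=
  let b := lmem x l in
  match b with true => l | false => constr:(cons x l) end.
Ltac lindex x l :=
  match l with
  | cons x _ => constr:(0%N)
  | cons _ ?l' => let n := lindex x l' in constr:(S n)
  end.
Ltac latoms t l :=
  lazymatch t with
  | @GRing.add _ ?x ?y => let l1 := latoms x l in latoms y l1
  | @GRing.opp _ ?x => latoms x l
  | @GRing.scale _ _ _ ?x => latoms x l
  | @GRing.natmul _ ?x _ => latoms x l
  | @GRing.zero _ => l
  | _ => ladd t l
  end.
Ltac lreify K t l :=
  lazymatch t with
  | @GRing.add _ ?x ?y =>
      let a := lreify K x l in let b := lreify K y l in constr:(@LAdd K a b)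
  | @GRing.opp _ ?x => let a := lreify K x l in constr:(@LOpp K a)
  | @GRing.scale _ _ ?c ?x => let a := lreify K x l in constr:(@LScale K c a)
  | @GRing.natmul _ ?x ?n => let a := lreify K x l in constr:(@LMuln K a n)
  | @GRing.zero _ => constr:(@LZero K)
  | _ => let n := lindex t l in constr:(@LAtom K n)
  end.
(** [lmodule K] proves an equality of linear combinations over the commutative
    ring [K]; [lmodule_with] leaves the scalar identities to a tactic. *)
Ltac lmodule_with K tac :=
  lazymatch goal with
  | |- @eq ?V ?t1 ?t2 =>
    let l0 := latoms t1 (@nil V) in
    let l := latoms t2 l0 in
    let e1 := lreify K t1 l in
    let e2 := lreify K t2 l in
    refine (@leval_eq K _ l e1 e2 isT _);
    cbn [lagree lcoef size Nat.eqb];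
    repeat lazymatch goal with
    | |- _ /\ _ => refine (conj _ _); [tac|]
    | |- True => exact I
    end
  end.
Ltac lmodule K := lmodule_with K ltac:(ring).

Ltac labstract_in t :=
  lazymatch t with
  | @GRing.add _ ?x ?y => first [labstract_in x | labstract_in y]
  | @GRing.opp _ ?x => labstract_in x
  | @GRing.scale _ _ _ ?x => labstract_in x
  | @GRing.natmul _ ?x _ => labstract_in x
  | @GRing.zero _ => fail
  | _ => tryif is_var t then fail
         else (let z := fresh in set z := t; clearbody z)
  end.
(** Names the vectors of the goal first, so that occurrences that agree only
    up to the inference of their structures are identified. *)
Ltac labstract :=
  repeat match goal with
  | |- @eq _ ?a ?b => first [labstract_in a | labstract_in b]
  end.

(** * Tensor products over the rationals *)

Lemma linear_add (K : pzRingType) (U V : lmodType K) (f : U -> V) :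
  linear f -> {morph f : x y / x + y}.
Proof. by move=> h x y; have := h 1 x y; rewrite !scale1r. Qed.

Lemma linear_zero (K : pzRingType) (U V : lmodType K) (f : U -> V) :
  linear f -> f 0 = 0.
Proof. by move=> /linear_add h; apply: (addrI (f 0)); rewrite -h !addr0. Qed.

Lemma linear_scale (K : pzRingType) (U V : lmodType K) (f : U -> V) :
  linear f -> forall a x, f (a *: x) = a *: f x.
Proof. by move=> h a x; have := h a x 0; rewrite (linear_zero h) !addr0. Qed.

Lemma linear_opp (K : pzRingType) (U V : lmodType K) (f : U -> V) :
  linear f -> {morph f : x / - x}.
Proof. by move=> h x; rewrite -scaleN1r (linear_scale h) scaleN1r. Qed.

Section MorphAdd.
Variables (U V : zmodType) (f : U -> V).
Hypothesis fD : {morph f : x y / x + y}.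

Lemma morph_add0 : f 0 = 0.
Proof. by apply: (addrI (f 0)); rewrite -fD !addr0. Qed.

Lemma morph_addN : {morph f : x / - x}.
Proof. by move=> x; apply: (addIr (f x)); rewrite -fD !addNr morph_add0. Qed.

Lemma morph_sum (I : Type) (r : seq I) (P : pred I) (F : I -> U) :
  f (\sum_(i <- r | P i) F i) = \sum_(i <- r | P i) f (F i).
Proof. exact: (big_morph f fD morph_add0). Qed.
End MorphAdd.

(** Restriction of scalars to the rationals. *)
Definition rsc (A : comAlgType rat) (V : lmodType A) : Type := V.

Section Rsc.
Variables (A : comAlgType rat) (V : lmodType A).
HB.instance Definition _ := GRing.Zmodule.on (rsc V).
Definition rsc_scale (q : rat) (v : rsc V) : rsc V := (q%:A : A) *: (v : V).
Fact rsc_scaleA a b v : rsc_scale a (rsc_scale b v) = rsc_scale (a * b) v.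
Proof. by rewrite /rsc_scale scalerA -in_algE -rmorphM. Qed.
Fact rsc_scale1 : left_id 1 rsc_scale.
Proof. by move=> v; rewrite /rsc_scale !scale1r. Qed.
Fact rsc_scaleDr : right_distributive rsc_scale +%R.
Proof. by move=> a u v; rewrite /rsc_scale scalerDr. Qed.
Fact rsc_scaleDl v : {morph rsc_scale^~ v : a b / a + b}.
Proof. by move=> a b; rewrite /rsc_scale !scalerDl. Qed.
HB.instance Definition _ := GRing.Zmodule_isLmodule.Build rat (rsc V)
  rsc_scaleA rsc_scale1 rsc_scaleDr rsc_scaleDl.
Lemma rscE (q : rat) (v : rsc V) : q *: v = (q%:A : A) *: (v : V).
Proof. by []. Qed.
End Rsc.

Section TensTheory.
Variables (A : comAlgType rat) (M : lmodType rat).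
Implicit Types (u v : tens A M).

Lemma pure_linl m : linear ((@pure A M)^~ m : A -> rsc (tens A M)).
Proof.
move=> q a b; apply/tens_ofP => W f hf; have hs := bilinear_scale q%:A hf.
rewrite formal_eval_cat !formal_eval_repr // formal_eval_scale formal_eval_repr //.
by rewrite /formal_eval !big_seq1 /= mulr_algl hf.1 [f (q *: a) m](linear_scale (hf.1 m)).
Qed.

Lemma pure_linr a : linear (@pure A M a : M -> rsc (tens A M)).
Proof.
move=> q m n; apply/tens_ofP => W f hf; have hs := bilinear_scale q%:A hf.
rewrite formal_eval_cat !formal_eval_repr // formal_eval_scale formal_eval_repr //.
by rewrite /formal_eval !big_seq1 /= mulr_algl hf.2 [f (q *: a) m](linear_scale (hf.1 m)).
Qed.

Lemma pureDl m a b : pure (a + b) m = pure a m + pure b m :> tens A M.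
Proof. exact: (linear_add (@pure_linl m)). Qed.
Lemma pureDr a m n : pure a (m + n) = pure a m + pure a n :> tens A M.
Proof. exact: (linear_add (@pure_linr a)). Qed.
Lemma pureNr a m : pure a (- m) = - pure a m :> tens A M.
Proof. exact: (linear_opp (@pure_linr a)). Qed.
Lemma pure0r a : pure a 0 = 0 :> tens A M.
Proof. exact: (linear_zero (@pure_linr a)). Qed.
Lemma pureZr a q m : pure a (q *: m) = q%:A *: pure a m :> tens A M.
Proof. exact: (linear_scale (@pure_linr a)). Qed.

Lemma pureZl a b m : pure (a * b) m = a *: pure b m :> tens A M.
Proof.
apply/tens_ofP => W f hf.
by rewrite formal_eval_scale formal_eval_repr; [rewrite /formal_eval !big_seq1|exact: bilinear_scale].
Qed.

Lemma pureE a m : pure a m = a *: pure 1 m :> tens A M.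
Proof. by rewrite -pureZl mulr1. Qed.

Lemma tens_ofE s : tens_of s = \sum_(p <- s) pure p.1 p.2 :> tens A M.
Proof.
elim: s => [|p s IH]; first by rewrite big_nil.
rewrite big_cons -IH; apply/tens_ofP => W f hf.
by rewrite formal_eval_cat !formal_eval_repr // /formal_eval big_cons big_seq1.
Qed.

Lemma tensE u : u = \sum_(p <- tens_repr u) pure p.1 p.2.
Proof. by rewrite -tens_ofE tens_reprK. Qed.

Lemma tens_ind (P : tens A M -> Prop) :
  P 0 -> (forall u v, P u -> P v -> P (u + v)) ->
  (forall a m, P (pure a m)) -> forall u, P u.
Proof. by move=> h0 hD hp u; rewrite [u]tensE; elim/big_rec: _ => // p v _; apply: hD. Qed.

Lemma tens_ext (V : zmodType) (f g : tens A M -> V) :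
  {morph f : u v / u + v} -> {morph g : u v / u + v} ->
  (forall a m, f (pure a m) = g (pure a m)) -> f =1 g.
Proof.
move=> hf hg h; elim/tens_ind=> [|u v hu hv|//]; last by rewrite hf hg hu hv.
by rewrite !morph_add0.
Qed.

Definition tens_lift (W : lmodType rat) (b : A -> M -> W) u : W :=
  formal_eval b (tens_repr u).

Lemma tens_lift_pure (W : lmodType rat) (b : A -> M -> W) a m :
  qbilinear b -> tens_lift b (pure a m) = b a m.
Proof. by move=> hb; rewrite /tens_lift formal_eval_repr // /formal_eval big_seq1. Qed.

Lemma tens_liftD (W : lmodType rat) (b : A -> M -> W) :
  qbilinear b -> {morph tens_lift b : u v / u + v}.
Proof. by move=> hb u v; rewrite /tens_lift formal_eval_repr // formal_eval_cat. Qed.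

Lemma tens_extend (V : lmodType A) (phi : M -> V) :
  (forall q m n, phi (q *: m + n) = q%:A *: phi m + phi n) ->
  exists f : tens A M -> V, linear f /\ forall m, f (pure 1 m) = phi m.
Proof.
move=> hphi; pose b (a : A) m : rsc V := a *: phi m.
have hb : qbilinear b.
  split=> [m q x y|a q m n]; rewrite /b rscE ?hphi.
    by rewrite scalerDl scalerA mulr_algl.
  by rewrite scalerDr !scalerA mulrC.
exists (tens_lift b); split=> [a|m]; last by rewrite tens_lift_pure // /b scale1r.
have hD : {morph (tens_lift b : _ -> V) : u v / u + v} by exact: tens_liftD hb.
suff h u : (tens_lift b (a *: u) : V) = a *: (tens_lift b u : V) by move=> u v; rewrite hD h.
elim/tens_ind: u => [|u v hu hv|x m]; last by rewrite -pureZl !tens_lift_pure // /b scalerA.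
  by rewrite scaler0 (morph_add0 hD) scaler0.
by rewrite scalerDr !hD hu hv scalerDr.
Qed.
End TensTheory.

Section TensMap.
Variables (A B : comAlgType rat) (M N : lmodType rat).
Variables (phi : A -> B) (f : M -> N).
Hypotheses (hphi : linear phi) (hf : linear f).

Lemma tens_map_pure a m : tens_map phi f (pure a m) = pure (phi a) (f m).
Proof.
apply/tens_ofP => W b hb.
have hb' : qbilinear (fun a m => b (phi a) (f m)).
  by split=> [n q x y|x q n n']; rewrite ?hphi ?hf ?(hb.1 (f n)) ?(hb.2 (phi x)).
rewrite {1}/formal_eval big_map -[LHS]/(formal_eval (fun a m => b (phi a) (f m)) _).
by rewrite (formal_eval_repr _ hb') /formal_eval !big_seq1.
Qed.

Lemma tens_mapD : {morph tens_map phi f : u v / u + v}.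
Proof.
move=> u v; apply/tens_ofP => W b hb.
have hb' : qbilinear (fun a m => b (phi a) (f m)).
  by split=> [n q x y|x q n n']; rewrite ?hphi ?hf ?(hb.1 (f n)) ?(hb.2 (phi x)).
rewrite formal_eval_cat !formal_eval_repr // /formal_eval !big_map.
rewrite -[LHS]/(formal_eval (fun a m => b (phi a) (f m)) _).
by rewrite (formal_eval_repr _ hb') formal_eval_cat.
Qed.

Lemma tens_map0 : tens_map phi f 0 = 0.
Proof. exact: morph_add0 tens_mapD. Qed.

Lemma tens_mapZ : {morph phi : a b / a * b} ->
  forall a u, tens_map phi f (a *: u) = phi a *: tens_map phi f u.
Proof.
move=> hM a; elim/tens_ind=> [|u v hu hv|x m].
- by rewrite scaler0 tens_map0 scaler0.
- by rewrite scalerDr !tens_mapD hu hv scalerDr.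
- by rewrite -pureZl !tens_map_pure hM pureZl.
Qed.
End TensMap.

Lemma tens_map_compose (A B C : comAlgType rat) (M N P : lmodType rat)
    (phi : A -> B) (psi : B -> C) (f : M -> N) (g : N -> P) (rho : A -> C) (h : M -> P) :
  linear phi -> linear psi -> linear f -> linear g ->
  rho =1 psi \o phi -> h =1 g \o f ->
  tens_map psi g \o tens_map phi f =1 tens_map rho h.
Proof.
move=> h1 h2 h3 h4 e1 e2.
have h5 : linear rho by move=> q a b; rewrite !e1 /= h1 h2.
have h6 : linear h by move=> q a b; rewrite !e2 /= h3 h4.
apply: tens_ext => [u v|u v|a m] /=; rewrite ?tens_mapD //.
by rewrite !tens_map_pure // e1 e2.
Qed.

Lemma linear_id (K : pzRingType) (U : lmodType K) : linear (@id U).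
Proof. by []. Qed.

(** * Quadratic extensions of algebras *)

(** The algebra A[s]/(s ^ 2 - d), with (p, q) standing for p + q s. The
    coordinate ring of SO(2), the dual numbers and A (x) Q[i] are of this form. *)
Definition quad (A : comAlgType rat) (d : A) : Type := (A * A)%type.

Section Quad.
Variables (A : comAlgType rat) (d : A).
Local Notation B := (quad d).
HB.instance Definition _ := GRing.Lmodule.on B.

Definition quad_mul (u v : B) : B :=
  (u.1 * v.1 + d * u.2 * v.2, u.1 * v.2 + u.2 * v.1).
Definition quad_one : B := (1, 0).

Fact quad_mulA : associative quad_mul.
Proof. by move=> u v w; rewrite /quad_mul; congr (_, _) => /=; ring. Qed.
Fact quad_mulC : commutative quad_mul.
Proof. by move=> u v; rewrite /quad_mul; congr (_, _) => /=; ring. Qed.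
Fact quad_mul1 : left_id quad_one quad_mul.
Proof. by move=> [a b]; rewrite /quad_mul /quad_one; congr (_, _) => /=; ring. Qed.
Fact quad_mulD : left_distributive quad_mul +%R.
Proof. by move=> u v w; rewrite /quad_mul; congr (_, _) => /=; ring. Qed.
Fact quad_one_neq0 : quad_one != 0.
Proof. by apply/eqP => -[/eqP]; rewrite oner_eq0. Qed.

HB.instance Definition _ := GRing.Zmodule_isComNzRing.Build B
  quad_mulA quad_mulC quad_mul1 quad_mulD quad_one_neq0.

Fact quad_scaleAl (q : rat) (u v : B) : q *: (u * v) = (q *: u : B) * v.
Proof.
case: u v => [a b] [a' b']; congr (_, _) => /=.
- by rewrite scalerDr -scalerAl -scalerAr -!scalerAl.
- by rewrite scalerDr -!scalerAl.
Qed.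
HB.instance Definition _ := GRing.Lmodule_isLalgebra.Build rat B quad_scaleAl.
HB.instance Definition _ := GRing.Lalgebra_isComAlgebra.Build rat B.

Definition quad_in (a : A) : B := (a, 0).
Definition quad_gen : B := (0, 1).
Definition quad_fst (u : B) : A := u.1.
Definition quad_snd (u : B) : A := u.2.

Lemma quad_in_is_linear : linear quad_in.
Proof. by move=> q a b; congr (_, _); rewrite /= scaler0 addr0. Qed.
Lemma quad_in_is_monoid_morphism : monoid_morphism quad_in.
Proof. by split=> [//|a b]; congr (_, _) => /=; ring. Qed.
HB.instance Definition _ := GRing.isLinear.Build rat A B _ quad_in quad_in_is_linear.
HB.instance Definition _ := GRing.isMonoidMorphism.Build A B quad_in quad_in_is_monoid_morphism.

Lemma quadE (u : B) : u = quad_in u.1 + quad_in u.2 * quad_gen.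
Proof. by case: u => a b; congr (_, _) => /=; ring. Qed.

Lemma quad_gen_sqr : quad_gen * quad_gen = quad_in d.
Proof. by congr (_, _) => /=; ring. Qed.
End Quad.

Section QuadHom.
Variables (A C : comAlgType rat) (d : A) (phi : {lrmorphism A -> C}) (s : C).
Hypothesis hs : s * s = phi d.

Definition quad_hom (u : quad d) : C := phi u.1 + phi u.2 * s.

Lemma quad_hom_is_linear : linear quad_hom.
Proof.
by move=> q u v; rewrite /quad_hom /= !linearP mulrDl -scalerAl scalerDr addrACA.
Qed.
Lemma quad_hom_is_monoid_morphism : monoid_morphism quad_hom.
Proof.
split=> [|u v]; rewrite /quad_hom /= ?rmorph1 ?rmorph0 ?mul0r ?addr0 //.
rewrite !rmorphD !rmorphM.
by rewrite (_ : phi d * _ * _ = s * s * phi u.2 * phi v.2); [ring|rewrite hs].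
Qed.
End QuadHom.

Lemma lrmorphism_of (A B : comAlgType rat) (f : A -> B) :
  linear f -> monoid_morphism f -> exists g : {lrmorphism A -> B}, f =1 g.
Proof.
move=> hl hm.
pose lm := GRing.isLinear.Build rat A B _ f hl.
pose mm := GRing.isMonoidMorphism.Build A B f hm.
pose F := HB.pack_for {lrmorphism A -> B} f lm mm.
by exists F.
Qed.

Section QuadTens.
Variables (A : comAlgType rat) (d : A) (M : lmodType rat).
Let B : comAlgType rat := quad d.
Let incl : tens A M -> tens B M := tens_map (@quad_in A d) id.

Lemma quad_tensE (u : tens B M) :
  u = incl (tens_map (@quad_fst A d) id u) +
      quad_gen d *: incl (tens_map (@quad_snd A d) id u).
Proof.
have hl : linear (@quad_in A d) by exact: linearP.
elim/tens_ind: u => [|u v hu hv|b m].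
- by rewrite !tens_map0 // /incl tens_map0 // scaler0 addr0.
- rewrite {1}hu {1}hv !tens_mapD // /incl !tens_mapD // scalerDr addrACA //.
- by rewrite !tens_map_pure // /incl !tens_map_pure // {1}[b](quadE b) pureDl -pureZl mulrC.
Qed.

Lemma quad_tens_fst (u v : tens A M) :
  tens_map (@quad_fst A d) id (incl u + quad_gen d *: incl v) = u.
Proof.
have hl : linear (@quad_in A d) by exact: linearP.
rewrite tens_mapD //.
have -> : tens_map (@quad_fst A d) id (incl u) = u.
  have := @tens_map_compose _ _ _ _ _ _ (@quad_in A d) (@quad_fst A d) id id id id.
  by move=> /(_ M) h; rewrite [LHS]h // tens_map_id.
suff -> : tens_map (@quad_fst A d) id (quad_gen d *: incl v) = 0 by rewrite addr0.
elim/tens_ind: v => [|x y hx hy|a m].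
- by rewrite /incl tens_map0 // scaler0 tens_map0.
- by rewrite /incl tens_mapD // scalerDr tens_mapD // hx hy addr0.
- rewrite /incl tens_map_pure // -pureZl tens_map_pure //.
  rewrite (_ : quad_fst _ = 0); last by rewrite /quad_fst /=; ring.
  by rewrite pureE scale0r.
Qed.

Lemma quad_tens_snd (u v : tens A M) :
  tens_map (@quad_snd A d) id (incl u + quad_gen d *: incl v) = v.
Proof.
have hl : linear (@quad_in A d) by exact: linearP.
rewrite tens_mapD //.
have -> : tens_map (@quad_snd A d) id (incl u) = 0.
  elim/tens_ind: u => [|x y hx hy|a m].
  - by rewrite /incl tens_map0 // tens_map0.
  - by rewrite /incl tens_mapD // tens_mapD // hx hy addr0.
  - by rewrite /incl tens_map_pure // tens_map_pure // pureE scale0r.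
rewrite add0r; elim/tens_ind: v => [|x y hx hy|a m].
- by rewrite /incl tens_map0 // scaler0 tens_map0.
- by rewrite /incl tens_mapD // scalerDr tens_mapD // hx hy.
- rewrite /incl tens_map_pure // -pureZl tens_map_pure //.
  by congr pure; rewrite /quad_snd /=; ring.
Qed.

Lemma quad_incl_inj : injective incl.
Proof.
have h u : tens_map (@quad_fst A d) id (incl u) = u.
  have {2}<- := quad_tens_fst u 0.
  by rewrite /incl tens_map0; [rewrite scaler0 addr0|exact: linearP|].
by move=> u v e; rewrite -[u]h e h.
Qed.
End QuadTens.

(** * The field of Gaussian numbers *)

Lemma algQ_eq0 (q : rat) : ((q%:A : Qi) == 0) = (q == 0).
Proof. by rewrite -in_algE fmorph_eq0. Qed.

Lemma intQ_eq0 (n : int) : ((n%:~R : Qi) == 0) = (n == 0).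
Proof.
have -> : (n%:~R : Qi) = (n%:~R : rat)%:A by rewrite -in_algE rmorph_int.
by rewrite algQ_eq0 intr_eq0.
Qed.

Lemma natQ_eq0 (n : nat) : ((n%:R : Qi) == 0) = (n == 0%N).
Proof. by rewrite -[n%:R]/((Posz n)%:~R) intQ_eq0. Qed.

Ltac qfield := field; rewrite ?natQ_eq0 ?intQ_eq0 //.

Lemma imQ_sqr : imQ * imQ = -1.
Proof. by congr Complex; rewrite /=; ring. Qed.

Definition reQ (z : Qi) : rat := let: Complex a _ := (z : complex rat) in a.
Definition imagQ (z : Qi) : rat := let: Complex _ b := (z : complex rat) in b.

Lemma QiE (z : Qi) : z = (reQ z)%:A + (imagQ z)%:A * imQ.
Proof. by case: z => a b; congr Complex; rewrite /=; ring. Qed.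

Lemma reQ_linear : linear (reQ : Qi -> rat^o).
Proof. by move=> q [a b] [a' b']. Qed.
Lemma imagQ_linear : linear (imagQ : Qi -> rat^o).
Proof. by move=> q [a b] [a' b']. Qed.

Lemma conjQ_is_linear : linear conjQ.
Proof. by move=> q [a b] [a' b']; congr Complex; rewrite /=; ring. Qed.
Lemma conjQ_is_monoid_morphism : monoid_morphism conjQ.
Proof. by split=> [|[a b] [a' b']]; congr Complex; rewrite /=; ring. Qed.
HB.instance Definition _ := GRing.isLinear.Build rat Qi Qi _ conjQ conjQ_is_linear.
HB.instance Definition _ := GRing.isMonoidMorphism.Build Qi Qi conjQ conjQ_is_monoid_morphism.

Lemma conjQK : involutive conjQ.
Proof. by move=> [a b]; congr Complex; rewrite opprK. Qed.
Lemma conjQ_im : conjQ imQ = - imQ.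
Proof. by congr Complex; rewrite oppr0. Qed.

(** * Decomposition into weight vectors *)

Section Weights.
Variables (P : lmodType Qi) (H : P -> P).
Hypothesis H_lin : linear H.

Definition wt (n : int) (u : P) : Prop := H u = n%:~R *: u.

Lemma wt0 n : wt n 0.
Proof. by rewrite /wt scaler0 linear_zero. Qed.
Lemma wtD n u v : wt n u -> wt n v -> wt n (u + v).
Proof. by rewrite /wt linear_add // => -> ->; rewrite scalerDr. Qed.
Lemma wtZ n a u : wt n u -> wt n (a *: u).
Proof. by rewrite /wt linear_scale // => ->; rewrite !scalerA mulrC. Qed.
Lemma wtN n u : wt n u -> wt n (- u).
Proof. by rewrite -scaleN1r; apply: wtZ. Qed.

(** The components form a total function and the support a separate list, so
    that decompositions can be added without matching up their supports. *)
Definition wdec (u : P) (s : seq int) (v : int -> P) : Prop :=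
  [/\ uniq s, forall n, wt n (v n), forall n, n \notin s -> v n = 0
    & u = \sum_(n <- s) v n].

Lemma sum_supp (V : zmodType) (s s' : seq int) (v : int -> V) :
  uniq s -> uniq s' -> {subset s <= s'} -> (forall n, n \notin s -> v n = 0) ->
  \sum_(n <- s') v n = \sum_(n <- s) v n.
Proof.
move=> us us' hs hv; rewrite (bigID (mem s)) /= addrC big1 ?add0r => [|n /hv//].
rewrite -big_filter; apply: perm_big; apply: uniq_perm; rewrite ?filter_uniq //.
by move=> n; rewrite mem_filter; case: (boolP (n \in s)) => // /hs ->.
Qed.

(** Eigenvectors for distinct eigenvalues are independent: apply H - n for
    the first n of the list, and induct. *)
Lemma wt_indep (s : seq int) (v : int -> P) :
  uniq s -> (forall n, wt n (v n)) -> \sum_(n <- s) v n = 0 ->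
  forall n, n \in s -> v n = 0.
Proof.
elim: s v => [|m s IH] v //= /andP[ms us] hv.
rewrite big_cons => e n.
have hs k : k \in s -> v k = 0.
  move=> ks.
  have := congr1 (fun x => H x - m%:~R *: x) e.
  rewrite linear_zero // scaler0 subr0 linear_add // (morph_sum (linear_add H_lin)).
  rewrite hv scalerDr scaler_sumr opprD addrACA subrr add0r -sumrN -big_split /=.
  rewrite (eq_bigr (fun k => (k - m)%:~R *: v k)) => [/IH h|j _]; last first.
    by rewrite hv rmorphB scalerBl.
  have /h : uniq s by [].
  move=> /(_ (fun j => wtZ _ (hv j)) k ks) /eqP.
  by rewrite scaler_eq0 intQ_eq0 subr_eq0 => /orP[/eqP ekm|/eqP//]; rewrite -ekm ks in ms.
rewrite inE => /orP[/eqP ->|/hs//].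
by move: e; rewrite big_seq big1 ?addr0.
Qed.

Lemma wdec_uniq u s v s' v' : wdec u s v -> wdec u s' v' -> v =1 v'.
Proof.
case=> us hv v0 e [us' hv' v0' e'] n.
pose t := undup (s ++ s').
have ut : uniq t by exact: undup_uniq.
have st : {subset s <= t} by move=> k; rewrite mem_undup mem_cat => ->.
have st' : {subset s' <= t} by move=> k; rewrite mem_undup mem_cat => ->; rewrite orbT.
rewrite -(sum_supp us ut st v0) in e; rewrite -(sum_supp us' ut st' v0') in e'.
have := @wt_indep t (fun k => v k - v' k) ut.
rewrite sumrB -e -e' subrr => /(_ _ erefl n) h.
case: (boolP (n \in t)) => [nt|].
  apply/eqP; rewrite -subr_eq0; apply/eqP/h => // k.
  by apply: wtD => //; apply: wtN.
by rewrite mem_undup mem_cat negb_or => /andP[/v0-> /v0'->].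
Qed.

Lemma wdecD u s v u' s' v' : wdec u s v -> wdec u' s' v' ->
  wdec (u + u') (undup (s ++ s')) (fun n => v n + v' n).
Proof.
case=> us hv v0 e [us' hv' v0' e']; split.
- exact: undup_uniq.
- by move=> n; apply: wtD.
- by move=> n; rewrite mem_undup mem_cat negb_or => /andP[/v0-> /v0'->]; rewrite addr0.
rewrite big_split e e'; congr (_ + _); apply/esym/sum_supp => //; rewrite ?undup_uniq //.
- by move=> k; rewrite mem_undup mem_cat => ->.
- by move=> k; rewrite mem_undup mem_cat => ->; rewrite orbT.
Qed.

Lemma wdec_wt n u : wt n u -> wdec u [:: n] (fun m => if m == n then u else 0).
Proof.
move=> hu; split=> [//|m|m|]; first by case: eqP => [->//|_]; exact: wt0.
- by rewrite inE => /negbTE ->.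
- by rewrite big_seq1 eqxx.
Qed.

Definition weighted : Prop := forall u, exists s v, wdec u s v.

Lemma weighted_gen :
  (forall u, exists r : seq P, (forall x, x \in r -> exists n, wt n x) /\
    u = \sum_(x <- r) x) -> weighted.
Proof.
move=> h u; have [r [hr ->]] := h u; elim: r hr => [|x r IH] hr.
  exists [::], (fun _ => 0); split=> //; first by move=> n; apply: wt0.
  by rewrite !big_nil.
have [|s [v h1]] := IH; first by move=> y yr; apply: hr; rewrite inE yr orbT.
have [n hn] := hr x (mem_head _ _).
rewrite big_cons; exists (undup ([:: n] ++ s)), (fun m => (if m == n then x else 0) + v m).
by apply: wdecD => //; apply: wdec_wt.
Qed.

(* The default value is only reached when u is no sum of weight vectors. *)
Definition wdecomp (u : P) : seq int * (int -> P) :=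
  xget ([::], fun _ => 0) [set p | wdec u p.1 p.2]%classic.
Definition wsupp u := (wdecomp u).1.
Definition wcomp n u := (wdecomp u).2 n.

Section Weighted.
Hypothesis hw : weighted.

Lemma wdecompP u : wdec u (wsupp u) (wcomp^~ u).
Proof.
rewrite /wsupp /wcomp /wdecomp; case: xgetP => [p _ //|hp].
by case: (hw u) => s [v hv]; case: (hp (s, v)).
Qed.

Lemma wcompE u s v : wdec u s v -> forall n, wcomp n u = v n.
Proof. by move=> h n; apply: (wdec_uniq (wdecompP u) h). Qed.

Lemma wt_wcomp n u : wt n (wcomp n u).
Proof. by case: (wdecompP u). Qed.

Lemma wsum_id u : u = \sum_(n <- wsupp u) wcomp n u.
Proof. by case: (wdecompP u). Qed.

Lemma wcomp_out n u : n \notin wsupp u -> wcomp n u = 0.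
Proof. by case: (wdecompP u) => _ _ + _; apply. Qed.

Lemma wsupp_uniq u : uniq (wsupp u).
Proof. by case: (wdecompP u). Qed.

Lemma wcompD n : {morph wcomp n : u v / u + v}.
Proof. by move=> u v; rewrite (wcompE (wdecD (wdecompP u) (wdecompP v))). Qed.

Lemma wcomp0 n : wcomp n 0 = 0.
Proof. exact: morph_add0 (@wcompD n). Qed.

Lemma wcomp_wt m n u : wt n u -> wcomp m u = if m == n then u else 0.
Proof. by move=> /wdec_wt/wcompE ->. Qed.

Lemma wt_ind (Q : P -> Prop) :
  Q 0 -> (forall u v, Q u -> Q v -> Q (u + v)) ->
  (forall n u, wt n u -> Q u) -> forall u, Q u.
Proof.
move=> h0 hD h u; rewrite [u]wsum_id; elim/big_rec: _ => // n v _; apply: hD.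
exact: h (wt_wcomp n u).
Qed.

Lemma wt_ext (V : zmodType) (f g : P -> V) :
  {morph f : u v / u + v} -> {morph g : u v / u + v} ->
  (forall n u, wt n u -> f u = g u) -> f =1 g.
Proof.
move=> hf hg h; elim/wt_ind=> [|u v hu hv|//]; last by rewrite hf hg hu hv.
by rewrite !morph_add0.
Qed.

(** By wt_ext, this is the only additive map agreeing with F n on weight n. *)
Definition wsum (V : zmodType) (F : int -> P -> V) (u : P) : V :=
  \sum_(n <- wsupp u) F n (wcomp n u).

Section WSum.
Variables (V : zmodType) (F : int -> P -> V).
Hypothesis FD : forall n, {morph F n : u v / u + v}.

Lemma wsumE u s : uniq s -> (forall n, n \notin s -> wcomp n u = 0) ->
  wsum F u = \sum_(n <- s) F n (wcomp n u).
Proof.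
move=> us h.
have h0 r : (forall n, n \notin r -> wcomp n u = 0) ->
    forall n, n \notin r -> F n (wcomp n u) = 0.
  by move=> hr n /hr ->; exact: morph_add0.
pose t := undup (wsupp u ++ s).
transitivity (\sum_(n <- t) F n (wcomp n u)).
  apply/esym/sum_supp; rewrite ?undup_uniq ?wsupp_uniq //.
    by move=> k; rewrite mem_undup mem_cat => ->.
  by apply: h0 => k; exact: wcomp_out.
apply: sum_supp; rewrite ?undup_uniq //; last exact: h0.
by move=> k; rewrite mem_undup mem_cat => ->; rewrite orbT.
Qed.

Lemma wsumD : {morph wsum F : u v / u + v}.
Proof.
move=> u v; pose t := undup (wsupp u ++ wsupp v).
have hu n : n \notin t -> wcomp n u = 0 /\ wcomp n v = 0.
  by rewrite mem_undup mem_cat negb_or => /andP[/wcomp_out-> /wcomp_out->].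
have e w := @wsumE w t (undup_uniq _).
rewrite (e u) => [|n /hu[]//]; rewrite (e v) => [|n /hu[]//].
rewrite e => [|n /hu[h1 h2]]; last by rewrite wcompD h1 h2 addr0.
by rewrite -big_split; apply: eq_bigr => n _; rewrite wcompD FD.
Qed.

Lemma wsum_wt n u : wt n u -> wsum F u = F n u.
Proof.
move=> hu; rewrite (@wsumE _ [:: n]) ?big_seq1 //; first by rewrite (wcomp_wt _ hu) eqxx.
by move=> m; rewrite inE (wcomp_wt _ hu) => /negbTE ->.
Qed.
End WSum.
End Weighted.
End Weights.

Lemma wcomp_shift (P Q : lmodType Qi) (HP : P -> P) (HQ : Q -> Q) (T : P -> Q) (e : int -> int) :
  linear HP -> linear HQ -> weighted HP -> weighted HQ ->
  {morph T : u v / u + v} -> injective e ->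
  (forall n u, wt HP n u -> wt HQ (e n) (T u)) ->
  forall n u, wcomp HQ (e n) (T u) = T (wcomp HP n u).
Proof.
move=> lP lQ wP wQ TD ei hT n u; move: u.
apply: (wt_ext wP) => [u v|u v|m u hu] /=; rewrite ?TD ?wcompD ?TD //.
rewrite (wcomp_wt lQ wQ _ (hT _ _ hu)) (wcomp_wt lP wP _ hu) (inj_eq ei).
by case: eqP => // _; rewrite morph_add0.
Qed.

(** * The action of SO(2) in terms of weights *)

Section IntPow.
Variables (B : comPzRingType) (z z' : B).
Hypothesis hz : z * z' = 1.

(** Integer powers of a unit whose inverse is part of the data. *)
Definition zpow (n : int) : B :=
  match n with Posz m => z ^+ m | Negz m => z' ^+ m.+1 end.

Lemma zpow_sub a b : zpow (a%:Z - b%:Z) = z ^+ a * z' ^+ b.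
Proof.
have h c : z ^+ c * z' ^+ c = 1 by rewrite -exprMn hz expr1n.
case: (leqP b a) => hab.
  by rewrite subzn //= -{2}(subnK hab) exprD -mulrA h mulr1 //.
rewrite -(subnK (ltnW hab)) exprD mulrC -mulrA [z' ^+ a * _]mulrC h mulr1.
rewrite PoszD opprD addrC -addrA addNr addr0.
by case: (b - a)%N (subn_gt0 a b) => [|c _]; rewrite ?hab //= -NegzE.
Qed.

Lemma zpowE n : exists a b : nat, n = a%:Z - b%:Z.
Proof. by case: n => m; [exists m, 0%N; rewrite subr0|exists 0%N, m.+1; rewrite NegzE sub0r]. Qed.

Lemma zpowD m n : zpow (m + n) = zpow m * zpow n.
Proof.
have [a [b ->]] := zpowE m; have [c [d ->]] := zpowE n.
have -> : a%:Z - b%:Z + (c%:Z - d%:Z) = (a + c)%N%:Z - (b + d)%N%:Z by rewrite !PoszD; ring.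
by rewrite !zpow_sub !exprD; ring.
Qed.

Lemma zpow1 : zpow 1 = z. Proof. by rewrite /= expr1. Qed.
Lemma zpowN1 : zpow (-1) = z'. Proof. by rewrite /= expr1. Qed.
End IntPow.

Lemma zpow_morph (B C : comPzRingType) (f : {rmorphism B -> C}) (z z' : B) n :
  f (zpow z z' n) = zpow (f z) (f z') n.
Proof. by case: n => m; rewrite /zpow rmorphXn. Qed.

Lemma zpow_mul (B : comPzRingType) (y y' z z' : B) n :
  zpow (y * z) (y' * z') n = zpow y y' n * zpow z z' n.
Proof. by case: n => m; rewrite /zpow exprMn. Qed.

Lemma zpow_one (B : comPzRingType) n : zpow (1 : B) 1 n = 1.
Proof. by case: n => m; rewrite /zpow expr1n. Qed.

Lemma expr2Q_eq1 m : (2 : Qi) ^+ m = 1 -> m = 0%N.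
Proof.
case: m => [//|m] /eqP; rewrite -natrX -subr_eq0 -[X in _ - X]/(1%:R).
rewrite -(natrB _ (expn_gt0 2 _)) natQ_eq0 subn_eq0 => h.
by have := leq_trans (ltn_expl m.+1 (ltnSn 1)) h; rewrite ltnS ltn0.
Qed.

Lemma zpow2_eq1 n : zpow (2 : Qi) 2^-1 n = 1 -> n = 0.
Proof.
have two : (2 : Qi) * 2^-1 = 1 by rewrite mulfV // natQ_eq0.
case: n => m; first by move=> h; rewrite [m]expr2Q_eq1.
rewrite -[zpow _ _ _]/(2^-1 ^+ m.+1) => h.
have := congr1 ( *%R (2 ^+ m.+1)) h.
by rewrite -exprMn two expr1n mulr1 => /esym/expr2Q_eq1.
Qed.

(** The characters z |-> z ^ n are independent: rescale z by 2 and argue as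
    for eigenvectors. *)
Lemma zpow_indep (V : lmodType Qi) (s : seq int) (w : int -> V) :
  uniq s ->
  (forall z z' : Qi, z * z' = 1 -> \sum_(n <- s) zpow z z' n *: w n = 0) ->
  forall n, n \in s -> w n = 0.
Proof.
elim: s w => [|m s IH] w //= /andP[ms us] h n.
have two : (2 : Qi) * 2^-1 = 1 by rewrite mulfV // natQ_eq0.
pose t k : Qi := zpow 2 2^-1 k.
have tinj k : t k = t m -> k = m.
  move=> e; have e1 : t (k - m) = 1.
    by rewrite /t (zpowD two) -/(t k) e /t -(zpowD two) subrr.
  by apply/eqP; rewrite -subr_eq0; apply/eqP; exact: zpow2_eq1 e1.
have hs k : k \in s -> w k = 0.
  move=> ks; have h2 := IH (fun k => (t k - t m) *: w k) us _ k ks.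
  have : (t k - t m) *: w k = 0.
    apply: h2 => z z' hz.
    have := h (2 * z) (2^-1 * z'); rewrite mulrACA two hz mulr1 => /(_ erefl).
    have := h z z' hz; rewrite !big_cons zpow_mul => e1 e2.
    transitivity ((\sum_(j <- s) zpow (2 * z) (2^-1 * z') j *: w j)
        - t m *: \sum_(j <- s) zpow z z' j *: w j).
      rewrite scaler_sumr -sumrN -big_split; apply: eq_bigr => j _.
      by rewrite /= zpow_mul -/(t j); lmodule Qi.
    move/eqP: e1; rewrite addrC addr_eq0 => /eqP ->.
    by move/eqP: e2; rewrite addrC addr_eq0 => /eqP ->; rewrite -/(t m); lmodule Qi.
  by move=> /eqP; rewrite scaler_eq0 subr_eq0 => /orP[/eqP/tinj e|/eqP//]; rewrite -e ks in ms.
rewrite inE => /orP[/eqP->|/hs//].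
have := h 1 1 (mulr1 1); rewrite big_cons zpow_one scale1r big_seq big1 => [|k /hs ->].
  by rewrite addr0.
by rewrite scaler0.
Qed.

Lemma so2_eq (A : comNzRingType) (g h : so2 A) :
  so2x g = so2x h -> so2y g = so2y h -> g = h.
Proof.
case: g h => [x y p] [x' y' p'] /= e1 e2.
by case: _ / e1 in p' *; case: _ / e2 in p' *; rewrite (eq_irrelevance p p').
Qed.

(** Over an algebra containing a square root of -1, SO(2) becomes the
    multiplicative group, with coordinate z = x - i y: this is the character
    of K on the eigenspace of H with eigenvalue 1. *)
Section Coordinate.
Variables (B : comAlgType rat) (iF : {lrmorphism Qi -> B}).

Definition kz (g : so2 B) : B := so2x g - iF imQ * so2y g.
Definition kz' (g : so2 B) : B := so2x g + iF imQ * so2y g.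
Definition kpow (g : so2 B) (n : int) : B := zpow (kz g) (kz' g) n.

Lemma iF_sqr : iF imQ * iF imQ = -1.
Proof. by rewrite -rmorphM imQ_sqr rmorphN1. Qed.

Lemma kzK g : kz g * kz' g = 1.
Proof. by rewrite /kz /kz' -(so2P g); ring: iF_sqr. Qed.

Lemma iF_half : iF 2^-1 * 2 = 1.
Proof. by rewrite -(rmorph_nat iF) -rmorphM mulVf ?rmorph1 // natQ_eq0. Qed.

Lemma kz_x g : so2x g = iF 2^-1 * (kz g + kz' g).
Proof. by rewrite /kz /kz' -[LHS]mul1r -iF_half; ring. Qed.

Lemma kz_y g : so2y g = iF (2^-1 * imQ) * (kz g - kz' g).
Proof. by rewrite rmorphM /kz /kz' -[LHS]mul1r -iF_half; ring: iF_sqr. Qed.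

Lemma kpow_mul g h n : kpow (so2_mul g h) n = kpow g n * kpow h n.
Proof.
rewrite /kpow -zpow_mul; congr zpow; rewrite /kz /kz' /=; ring: iF_sqr.
Qed.

Lemma kpow1 n : kpow (so2_one B) n = 1.
Proof. by rewrite /kpow /kz /kz' /= mulr0 subr0 addr0 zpow_one. Qed.

Lemma kpowD g m n : kpow g (m + n) = kpow g m * kpow g n.
Proof. exact: zpowD (kzK g) _ _. Qed.

(** On the tangent space of K at 1, where x = 1 and y ^ 2 = 0. *)
Lemma kpow_inf g n : so2x g = 1 -> kpow g n = 1 - iF (n%:~R * imQ) * so2y g.
Proof.
move=> gx; set y := so2y g.
have yy : y * y = 0.
  by have := so2P g; rewrite gx expr1n -[RHS]addr0 => /addrI; rewrite expr2.
have pw (a : B) m : (1 + a * y) ^+ m = 1 + m%:R * a * y.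
  elim: m => [|m IH]; first by rewrite expr0 !mul0r addr0.
  by rewrite exprS IH -[m.+1]addn1 natrD; ring: yy.
rewrite /kpow /kz /kz' gx -/y rmorphM /= rmorph_int; case: n => m; rewrite /zpow.
  by rewrite -mulNr pw -pmulrn; ring.
by rewrite pw NegzE mulrNz -pmulrn; ring.
Qed.
End Coordinate.

Lemma kpow_map (B C : comAlgType rat) (iF : {lrmorphism Qi -> B}) (iG : {lrmorphism Qi -> C})
    (phi : {lrmorphism B -> C}) (g : so2 B) n : phi (iF imQ) = iG imQ ->
  phi (kpow iF g n) = kpow iG (so2_map phi g) n.
Proof.
move=> e; rewrite zpow_morph /kpow /kz /kz' /=.
by congr zpow; rewrite -e ?rmorphB ?rmorphD rmorphM.
Qed.

Definition so2_alg : comAlgType rat := quad (1 - 'X^2 : {poly rat}).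
Lemma so2_gen_subproof :
  (quad_in _ 'X : so2_alg) ^+ 2 + (quad_gen _ : so2_alg) ^+ 2 = 1.
Proof. by rewrite !expr2 quad_gen_sqr -rmorphM -rmorphD /= -(rmorph1 (quad_in _)); congr quad_in; ring. Qed.
(** The universal point of SO(2). *)
Definition so2_gen : so2 so2_alg := So2 so2_gen_subproof.

Lemma so2_eval (B : comAlgType rat) (g : so2 B) :
  exists ev : {lrmorphism so2_alg -> B}, so2_map ev so2_gen = g.
Proof.
pose f (p : {poly rat}) := (map_poly (in_alg B) p).[so2x g].
have fX : f 'X = so2x g by rewrite /f map_polyX hornerX.
have [phi hphi] : exists phi : {lrmorphism {poly rat} -> B}, f =1 phi.
  apply: lrmorphism_of; rewrite /f.
    by move=> q x y; rewrite rmorphD /= hornerD map_polyZ hornerZ /= mulr_algl.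
  by split=> [|x y]; rewrite ?rmorph1 ?hornerC // rmorphM hornerM.
have hs : so2y g * so2y g = phi (1 - 'X^2).
  by rewrite -hphi /f rmorphB rmorph1 rmorphXn /= map_polyX !hornerE -(so2P g); ring.
have [ev hev] := lrmorphism_of (@quad_hom_is_linear _ _ (1 - 'X^2) phi (so2y g))
  (quad_hom_is_monoid_morphism hs).
exists ev; apply: so2_eq; rewrite /= -hev /quad_hom /=.
  by rewrite rmorph0 mul0r addr0 -hphi fX.
by rewrite rmorph0 rmorph1 mul1r add0r.
Qed.

(** x and y are linear combinations of z and its inverse, so every function on
    SO(2) is over F a Laurent polynomial in z. *)
Lemma so2_laurent (a : so2_alg) : exists r : seq (Qi * int),
  forall (B : comAlgType rat) (iF : {lrmorphism Qi -> B}) (ev : {lrmorphism so2_alg -> B}),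
    ev a = \sum_(p <- r) iF p.1 * kpow iF (so2_map ev so2_gen) p.2.
Proof.
pose Lau (a : so2_alg) := exists r : seq (Qi * int),
  forall (B : comAlgType rat) (iF : {lrmorphism Qi -> B}) (ev : {lrmorphism so2_alg -> B}),
    ev a = \sum_(p <- r) iF p.1 * kpow iF (so2_map ev so2_gen) p.2.
have LD x y : Lau x -> Lau y -> Lau (x + y).
  case=> r hr [r' hr']; exists (r ++ r') => B iF ev.
  by rewrite rmorphD /= big_cat (hr _ iF) (hr' _ iF).
have LM x y : Lau x -> Lau y -> Lau (x * y).
  case=> r hr [r' hr']; exists [seq (p.1 * q.1, p.2 + q.2) | p <- r, q <- r'] => B iF ev.
  rewrite rmorphM /= (hr _ iF) (hr' _ iF) big_allpairs_dep mulr_suml; apply: eq_bigr => p _.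
  by rewrite mulr_sumr; apply: eq_bigr => q _ /=; rewrite rmorphM kpowD; ring.
have LC (c : rat) : Lau (c%:A).
  exists [:: (c%:A, 0)] => B iF ev.
  by rewrite big_seq1 !linearZ /= !rmorph1 mulr1.
have LX : Lau (so2x so2_gen).
  exists [:: (2^-1, 1); (2^-1, -1)] => B iF ev.
  rewrite big_cons big_seq1 -mulrDr /kpow zpow1 zpowN1 -kz_x //.
have LY : Lau (so2y so2_gen).
  exists [:: (2^-1 * imQ, 1); (- (2^-1 * imQ), -1)] => B iF ev.
  rewrite big_cons big_seq1 /kpow zpow1 zpowN1 [in RHS]/fst.
  by rewrite rmorphN mulNr -mulrBr -kz_y.
have LP (p : {poly rat}) : Lau (quad_in _ p).
  elim/poly_ind: p => [|p c hp].
    by rewrite rmorph0; have := LC 0; rewrite scale0r.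
  rewrite rmorphD rmorphM; apply: LD; first exact: LM.
  by have := LC c; rewrite -(rmorph1 (quad_in _)) -linearZ /= -mul_polyC mulr1.
by rewrite [a]quadE; apply: LD => //; apply: LM.
Qed.

Definition baseQ (B : comAlgType rat) (iF : {lrmorphism Qi -> B}) (M : lmodType rat) :
  tens Qi M -> tens B M := tens_map iF id.

Section BaseQ.
Variables (B : comAlgType rat) (iF : {lrmorphism Qi -> B}) (M : lmodType rat).
Local Notation J := (@baseQ B iF M).

Let iF_lin : linear iF. Proof. exact: linearP. Qed.

Lemma baseQ_pure a m : J (pure a m) = iF a *: pure 1 m.
Proof. by rewrite /baseQ tens_map_pure // pureE. Qed.
Lemma baseQD : {morph J : u v / u + v}.
Proof. exact: tens_mapD. Qed.
Lemma baseQZ a u : J (a *: u) = iF a *: J u.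
Proof. by rewrite /baseQ tens_mapZ //; exact: rmorphM. Qed.
Lemma baseQ_sum (I : Type) (r : seq I) (P : pred I) (F : I -> tens Qi M) :
  J (\sum_(i <- r | P i) F i) = \sum_(i <- r | P i) J (F i).
Proof. exact: (morph_sum baseQD). Qed.

(** Over B, the tensor product is spanned by the image of the one over F; maps
    on it are compared on weight vectors through this. *)
Lemma baseQ_ind (Q : tens B M -> Prop) :
  Q 0 -> (forall u v, Q u -> Q v -> Q (u + v)) ->
  (forall b u, Q (b *: J u)) -> forall u, Q u.
Proof.
move=> h0 hD h; elim/tens_ind=> // b m.
by have := h b (pure 1 m); rewrite baseQ_pure rmorph1 scale1r -pureE.
Qed.
End BaseQ.

Lemma regroup (U V : zmodType) (S : seq (U * int)) (F : int -> U -> V) :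
  (forall n, {morph F n : u v / u + v}) ->
  \sum_(p <- S) F p.2 p.1 =
  \sum_(n <- undup [seq p.2 | p <- S]) F n (\sum_(p <- S | p.2 == n) p.1).
Proof.
move=> FD; under [RHS]eq_bigr => n _ do rewrite (morph_sum (FD n)).
rewrite (exchange_big_dep predT) //= big_seq [RHS]big_seq; apply: eq_bigr => p pS.
rewrite big_mkcond (bigD1_seq p.2) ?undup_uniq ?mem_undup ?map_f //= eqxx.
by rewrite big1 ?addr0 // => n /negbTE; rewrite eq_sym => ->.
Qed.

Section Expansion.
Variable M : gkmod.

Lemma gk_kD (A : comAlgType rat) (g : so2 A) : {morph gk_k (g := M) g : u v / u + v}.
Proof. exact: linear_add (so2_rep_linear (gk_rep (gkP M)) g). Qed.
Lemma gk_kZ (A : comAlgType rat) (g : so2 A) a (u : tens A M) : gk_k g (a *: u) = a *: gk_k g u.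
Proof. exact: linear_scale (so2_rep_linear (gk_rep (gkP M)) g) a u. Qed.

(** By naturality it is enough to expand the action of the universal point. *)
Lemma gk_laurent (u : ext M) : exists S : seq (ext M * int),
  forall (B : comAlgType rat) (iF : {lrmorphism Qi -> B}) (g : so2 B),
    gk_k g (baseQ iF u) = \sum_(p <- S) kpow iF g p.2 *: baseQ iF p.1.
Proof.
elim/tens_ind: u => [|u v [S hS] [S' hS']|a m].
- exists [::] => B iF g.
  by rewrite big_nil (morph_add0 (@baseQD B iF M)) (morph_add0 (@gk_kD B g)).
- by exists (S ++ S') => B iF g; rewrite baseQD gk_kD big_cat hS hS'.
have [S hS] : exists S : seq (ext M * int), forall (B : comAlgType rat)
    (iF : {lrmorphism Qi -> B}) (ev : {lrmorphism so2_alg -> B}),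
    tens_map ev id (gk_k so2_gen (pure 1 m)) =
    \sum_(p <- S) kpow iF (so2_map ev so2_gen) p.2 *: baseQ iF p.1.
  elim/tens_ind: (gk_k _ _) => [|u v [S hS] [S' hS']|b n].
  - by exists [::] => B iF ev; rewrite big_nil tens_map0 //; exact: linearP.
  - exists (S ++ S') => B iF ev; rewrite tens_mapD //; last exact: linearP.
    by rewrite big_cat (hS _ iF) (hS' _ iF).
  have [r hr] := so2_laurent b.
  exists [seq (pure p.1 n, p.2) | p <- r] => B iF ev.
  rewrite tens_map_pure //; last exact: linearP.
  rewrite (hr _ iF) big_map pureE scaler_suml; apply: eq_bigr => p _ /=.
  by rewrite baseQ_pure scalerA mulrC.
exists [seq (a *: p.1, p.2) | p <- S] => B iF g.
have [ev <-] := so2_eval g.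
rewrite baseQ_pure gk_kZ.
have -> : pure 1 m = tens_map ev id (pure 1 m) :> tens B M.
  by rewrite tens_map_pure ?rmorph1 //; exact: linearP.
rewrite -(so2_rep_nat (gk_rep (gkP M))) (hS _ iF) big_map scaler_sumr.
by apply: eq_bigr => p _ /=; rewrite baseQZ !scalerA mulrC.
Qed.

End Expansion.

Lemma sl2_11 (A : comNzRingType) (Z : sl2 A) : Z 1 1 = - Z 0 0.
Proof.
have /eqP := sl2P Z; rewrite /mxtrace big_ord_recl big_ord1 => /eqP.
by rewrite addrC addr_eq0 (_ : lift ord0 ord0 = 1) => [/eqP|] //; apply/val_inj.
Qed.

Lemma mx2_eq (T : Type) (U V : 'M[T]_2) :
  U 0 0 = V 0 0 -> U 0 1 = V 0 1 -> U 1 0 = V 1 0 -> U 1 1 = V 1 1 -> U = V.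
Proof.
move=> h1 h2 h3 h4; apply/matrixP => i j.
have I2 (k : 'I_2) : k = 0 \/ k = 1.
  by case: k => -[|[|//]] hk; [left|right]; apply/val_inj.
by case: (I2 i) => ->; case: (I2 j) => ->.
Qed.

Lemma sl2_eq (A : comNzRingType) (Z W : sl2 A) :
  Z 0 0 = W 0 0 -> Z 0 1 = W 0 1 -> Z 1 0 = W 1 0 -> Z = W.
Proof. by move=> h1 h2 h3; apply/val_inj/mx2_eq; rewrite //= !sl2_11 h1. Qed.

Lemma sl2_ofE (A : comNzRingType) (a b c : A) :
  (sl2_of a b c 0 0 = a) * (sl2_of a b c 0 1 = b) * (sl2_of a b c 1 0 = c).
Proof. by rewrite !mxE. Qed.

Lemma mx2E (A : comPzRingType) (a b c d : A) :
  (mx2 a b c d 0 0 = a) * (mx2 a b c d 0 1 = b) * (mx2 a b c d 1 0 = c) *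
  (mx2 a b c d 1 1 = d).
Proof. by rewrite !mxE. Qed.

Lemma mulmx2E (A : comPzRingType) (U V : 'M[A]_2) i j :
  (U *m V) i j = U i 0 * V 0 j + U i 1 * V 1 j.
Proof. by rewrite mxE !big_ord_recl big_ord0 addr0 (_ : lift ord0 ord0 = 1) //; apply/val_inj. Qed.

Lemma scalemxE (A : comPzRingType) (a : A) (Z : 'M[A]_2) i j : (a *: Z) i j = a * Z i j.
Proof. exact: mxE. Qed.

(** * The standard basis of sl_2 and the basis H, X, Y *)

Section LieExt.
Variables (M : lmodType rat) (act : sl2 rat -> M -> M).
Hypotheses (act_l : forall m, linear (act^~ m)) (act_r : forall Z, linear (act Z))
  (act_b : forall Z W m, act (bracket Z W) m = act Z (act W m) - act W (act Z m)).

Definition exE : tens Qi M -> tens Qi M := tens_map id (act (sl2_of 0 1 0)).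
Definition exF : tens Qi M -> tens Qi M := tens_map id (act (sl2_of 0 0 1)).
Definition exD : tens Qi M -> tens Qi M := tens_map id (act (sl2_of 1 0 0)).
Definition exH : tens Qi M -> tens Qi M := lie_ext act (mx2 0 (- imQ) imQ 0).
Definition exX : tens Qi M -> tens Qi M := lie_ext act (2^-1 *: mx2 1 imQ imQ (- 1)).
Definition exY : tens Qi M -> tens Qi M := lie_ext act (2^-1 *: mx2 1 (- imQ) (- imQ) (- 1)).

Lemma exE_lin : linear exE. Proof. exact: tens_map_linear. Qed.
Lemma exF_lin : linear exF. Proof. exact: tens_map_linear. Qed.
Lemma exD_lin : linear exD. Proof. exact: tens_map_linear. Qed.

Lemma exHE u : exH u = imQ *: (exF u - exE u).
Proof. by rewrite /exH /lie_ext !mx2E -/(exD u) -/(exE u) -/(exF u); lmodule Qi. Qed.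
Lemma exXE u : exX u = 2^-1 *: (exD u + imQ *: (exE u + exF u)).
Proof. by rewrite /exX /lie_ext !scalemxE !mx2E -/(exD u) -/(exE u) -/(exF u); lmodule Qi. Qed.
Lemma exYE u : exY u = 2^-1 *: (exD u - imQ *: (exE u + exF u)).
Proof. by rewrite /exY /lie_ext !scalemxE !mx2E -/(exD u) -/(exE u) -/(exF u); lmodule Qi. Qed.

Lemma exD_comb u : exD u = 1 *: exX u + 1 *: exY u + 0 *: exH u.
Proof. by rewrite exXE exYE exHE; lmodule_with Qi ltac:(field; rewrite natQ_eq0 //). Qed.
Lemma exE_comb u :
  exE u = (- (2^-1 * imQ)) *: exX u + (2^-1 * imQ) *: exY u + (2^-1 * imQ) *: exH u.
Proof. by rewrite exXE exYE exHE; lmodule_with Qi ltac:(field: imQ_sqr; rewrite natQ_eq0 //). Qed.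
Lemma exF_comb u :
  exF u = (- (2^-1 * imQ)) *: exX u + (2^-1 * imQ) *: exY u + (- (2^-1 * imQ)) *: exH u.
Proof. by rewrite exXE exYE exHE; lmodule_with Qi ltac:(field: imQ_sqr; rewrite natQ_eq0 //). Qed.

Let comm_ext (Z W V : sl2 rat) (c : rat) : bracket Z W = c *: V ->
  forall u, tens_map id (act Z) (tens_map id (act W) u) =
    tens_map id (act W) (tens_map id (act Z) u) + c%:A *: tens_map id (act V) u :> tens Qi M.
Proof.
move=> h; have D Z' := linear_add (@tens_map_linear Qi M M _ (act_r Z')).
apply: tens_ext => [u v|u v|a m].
- by rewrite !D.
- by rewrite !D scalerDr addrACA.
rewrite !(tens_map_pure _ (act_r _)) // -pureZr -pureDr; congr pure.
have := act_b Z W m; rewrite h (linear_scale (act_l m)) => ->.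
by rewrite addrC subrK.
Qed.

Lemma exDE u : exD (exE u) = exE (exD u) + 2 *: exE u.
Proof.
have e : bracket (sl2_of 1 0 0) (sl2_of 0 1 0) = (2 : rat) *: sl2_of 0 1 0.
  apply: sl2_eq; rewrite /= !mxE /= !big_ord_recl !big_ord0 !mxE /=; ring.
by rewrite /exD /exE (comm_ext e) -in_algE rmorph_nat.
Qed.
Lemma exDF u : exD (exF u) = exF (exD u) - 2 *: exF u.
Proof.
have e : bracket (sl2_of 1 0 0) (sl2_of 0 0 1) = (- 2 : rat) *: sl2_of 0 0 1.
  apply: sl2_eq; rewrite /= !mxE /= !big_ord_recl !big_ord0 !mxE /=; ring.
by rewrite /exD /exF (comm_ext e) -in_algE rmorphN rmorph_nat scaleNr.
Qed.
Lemma exEF u : exE (exF u) = exF (exE u) + exD u.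
Proof.
have e : bracket (sl2_of 0 1 0) (sl2_of 0 0 1) = (1 : rat) *: sl2_of 1 0 0.
  apply: sl2_eq; rewrite /= !mxE /= !big_ord_recl !big_ord0 !mxE /=; ring.
by rewrite /exE /exF (comm_ext e) scale1r scale1r.
Qed.

Let L := (linear_add exE_lin, linear_add exF_lin, linear_add exD_lin, linear_scale exE_lin,
  linear_scale exF_lin, linear_scale exD_lin, linear_opp exE_lin, linear_opp exF_lin,
  linear_opp exD_lin).
Let R := (exDE, exDF, exEF).
Ltac sl2 := rewrite !(exHE, exXE, exYE) !L !R; lmodule_with Qi ltac:(field: imQ_sqr; rewrite natQ_eq0 //).

Lemma exHX u : exH (exX u) = exX (exH u) + 2 *: exX u.
Proof. sl2. Qed.
Lemma exHY u : exH (exY u) = exY (exH u) - 2 *: exY u.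
Proof. sl2. Qed.
Lemma exXY u : exX (exY u) - exY (exX u) = exH u.
Proof. sl2. Qed.

Lemma exH_lin : linear exH.
Proof. by move=> a u v; rewrite !exHE exF_lin exE_lin; lmodule Qi. Qed.
Lemma exX_lin : linear exX.
Proof. by move=> a u v; rewrite !exXE exF_lin exE_lin exD_lin; lmodule Qi. Qed.
Lemma exY_lin : linear exY.
Proof. by move=> a u v; rewrite !exYE exF_lin exE_lin exD_lin; lmodule Qi. Qed.

Lemma exH_J u : exH u = imQ *: tens_map id (act (sl2_of 0 (-1) 1)) u.
Proof.
have -> : tens_map id (act (sl2_of 0 (-1) 1)) u = exF u - exE u; last exact: exHE.
have D Z := linear_add (@tens_map_linear Qi M M _ (act_r Z)).
move: u; apply: tens_ext => [u v|u v|a m]; first exact: D.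
  by rewrite (linear_add exF_lin) (linear_add exE_lin) opprD addrACA.
rewrite /exF /exE !(tens_map_pure _ (act_r _)) //.
have -> : sl2_of 0 (-1) 1 = (-1) *: sl2_of 0 1 0 + sl2_of 0 0 1 :> sl2 rat.
  by apply: sl2_eq; rewrite !mxE /=; ring.
by rewrite act_l scaleN1r addrC pureDr pureNr.
Qed.
End LieExt.

(** * Weights of a (g, K)-module *)

Section GkWeights.
Variable M : gkmod.
Local Notation Lact := (@gk_g M).

Lemma act_linr Z : linear (Lact Z). Proof. exact: gk_linr (gkP M) Z. Qed.
Lemma act_linl m : linear (Lact^~ m). Proof. exact: gk_linl (gkP M) m. Qed.

Definition opJ : ext M -> ext M := tens_map id (Lact (sl2_of 0 (-1) 1)).

Lemma opJ_lin : linear opJ. Proof. exact: tens_map_linear (act_linr _). Qed.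
Lemma opH_lin : linear (@opH M). Proof. exact: opF_linear. Qed.
Lemma opX_lin : linear (@opX M). Proof. exact: opF_linear. Qed.
Lemma opY_lin : linear (@opY M). Proof. exact: opF_linear. Qed.

Lemma actE (Z : sl2 rat) m :
  Lact Z m = Z 0 0 *: Lact (sl2_of 1 0 0) m + Z 0 1 *: Lact (sl2_of 0 1 0) m
    + Z 1 0 *: Lact (sl2_of 0 0 1) m.
Proof.
have -> : Z = Z 0 0 *: sl2_of 1 0 0 + (Z 0 1 *: sl2_of 0 1 0 + Z 1 0 *: sl2_of 0 0 1).
  by apply: sl2_eq; rewrite !mxE /=; ring.
rewrite act_linl (linear_add (act_linl m)) !(linear_scale (act_linl m)) addrA.
by rewrite !mxE /= !(mulr0, mulr1, addr0, add0r).
Qed.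

Lemma opH_J u : opH u = imQ *: opJ u.
Proof. exact: exH_J act_linl act_linr u. Qed.

(** The tangent vector to SO(2) at 1, a point over the dual numbers of F. *)
Definition dual_alg : comAlgType rat := quad (0 : Qi).
Definition dual_in : {lrmorphism Qi -> dual_alg} := @quad_in Qi 0.

Lemma dual_point_subproof : (1 : dual_alg) ^+ 2 + (quad_gen (0 : Qi) : dual_alg) ^+ 2 = 1.
Proof. by rewrite !expr2 quad_gen_sqr mulr1 rmorph0 addr0. Qed.
Definition dual_point : so2 dual_alg := So2 dual_point_subproof.

Lemma k_dual_point (u : ext M) :
  gk_k dual_point (baseQ dual_in u) =
  baseQ dual_in u + (quad_gen (0 : Qi) : dual_alg) *: baseQ dual_in (opJ u).
Proof.
move: u; apply: tens_ext => [u v|u v|a m] /=.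
- by rewrite baseQD gk_kD.
- by rewrite (linear_add opJ_lin) !baseQD scalerDr addrACA.
rewrite baseQ_pure gk_kZ (gk_differential (gkP M)) //.
rewrite /opJ tens_map_pure //; last exact: act_linr.
by rewrite baseQ_pure scalerDr [pure (so2y _) _]pureE !scalerA mulrC.
Qed.

(** The action of a general point expands in powers of z; comparing with the
    infinitesimal action of Lie K at all F-points of the torus shows
    that the coefficient of z ^ n is an eigenvector of H. *)
Theorem gk_weights (u : ext M) : exists s v, wdec (@opH M) u s v /\
  forall (B : comAlgType rat) (iF : {lrmorphism Qi -> B}) (g : so2 B),
    gk_k g (baseQ iF u) = \sum_(n <- s) kpow iF g n *: baseQ iF (v n).
Proof.
have [S hS] := gk_laurent u.
pose s := undup [seq p.2 | p <- S]; pose v n := \sum_(p <- S | p.2 == n) p.1.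
have hk (B : comAlgType rat) (iF : {lrmorphism Qi -> B}) (g : so2 B) :
    gk_k g (baseQ iF u) = \sum_(n <- s) kpow iF g n *: baseQ iF (v n).
  rewrite hS (regroup S (F := fun n x => kpow iF g n *: baseQ iF x)) // => n x y.
  by rewrite baseQD scalerDr.
have us : uniq s by exact: undup_uniq.
have v0 n : n \notin s -> v n = 0.
  move=> ns; rewrite /v big_seq_cond big1 // => p /andP[pS /eqP e].
  by rewrite mem_undup -e map_f in ns.
pose iQ : {lrmorphism Qi -> Qi} := idfun.
have idQ (w : ext M) : baseQ iQ w = w by exact: tens_map_id.
have us1 : u = \sum_(n <- s) v n.
  rewrite -[LHS]idQ -[LHS](so2_rep1 (gk_rep (gkP M))) (hk _ iQ).
  by apply: eq_bigr => n _; rewrite kpow1 scale1r idQ.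
suff hJ n : n \in s -> opJ (v n) + (n%:~R * imQ) *: v n = 0.
  exists s, v; split=> //; split=> // n; rewrite /wt opH_J.
  case: (boolP (n \in s)) => [/hJ|/v0->]; last by rewrite (linear_zero opJ_lin) !scaler0.
  move/eqP; rewrite addr_eq0 => /eqP ->.
  by rewrite scalerN scalerA -scaleNr; congr (_ *: _); ring: imQ_sqr.
move: n; apply: (zpow_indep us) => z z' hz.
have hg : (2^-1 * (z + z')) ^+ 2 + (2^-1 * imQ * (z - z')) ^+ 2 = 1 :> Qi.
  rewrite !exprMn -[imQ ^+ 2]/(imQ * imQ) imQ_sqr mulrN1 mulNr -mulrBr.
  rewrite (_ : (z + z') ^+ 2 - (z - z') ^+ 2 = (2 * 2) * (z * z')); last by ring.
  by rewrite hz; qfield.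
pose gz : so2 Qi := So2 hg.
have kzz : kz iQ gz = z.
  by rewrite /kz /=; field: imQ_sqr; rewrite natQ_eq0.
have kzz' : kz' iQ gz = z'.
  by rewrite /kz' /=; field: imQ_sqr; rewrite natQ_eq0.
pose w := \sum_(n <- s) zpow z z' n *: v n.
have hw : gk_k gz u = w.
  by rewrite -[u in LHS]idQ (hk _ iQ); apply: eq_bigr => n _; rewrite idQ /kpow kzz kzz'.
(* Compute the action of the product of gz and the tangent vector in two ways. *)
pose w' := \sum_(n <- s) (n%:~R * imQ * zpow z z' n) *: v n.
have hw' : gk_k dual_point (baseQ dual_in w) =
    baseQ dual_in w - (quad_gen (0 : Qi) : dual_alg) *: baseQ dual_in w'.
  have -> : gk_k dual_point (baseQ dual_in w) =
      gk_k (so2_mul dual_point (so2_map dual_in gz)) (baseQ dual_in u).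
    by rewrite -hw /baseQ (so2_rep_nat (gk_rep (gkP M))) -(so2_repM (gk_rep (gkP M))).
  rewrite hk !baseQ_sum scaler_sumr -sumrB.
  apply: eq_bigr => n _; rewrite kpow_mul kpow_inf // !baseQZ.
  have -> : kpow dual_in (so2_map dual_in gz) n = dual_in (zpow z z' n).
    by rewrite -(@kpow_map _ _ iQ) // /kpow kzz kzz'.
  rewrite !scalerA -scalerBl; congr (_ *: _).
  by rewrite (rmorphM dual_in) /=; ring.
have : opJ w = - w'.
  move: hw'; rewrite k_dual_point -scalerN -(morph_addN (@baseQD _ dual_in M)).
  move/(congr1 (tens_map (@quad_snd _ (0 : Qi)) id)).
  by rewrite !quad_tens_snd.
rewrite (morph_sum (linear_add opJ_lin)) => /eqP; rewrite -addr_eq0 -big_split => /eqP e.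
rewrite -[RHS]e; apply: eq_bigr => n _; rewrite /= (linear_scale opJ_lin) scalerDr !scalerA.
by congr (_ + _ *: _); rewrite mulrC.
Qed.

Lemma gk_weighted : weighted (@opH M).
Proof. by move=> u; have [s [v [h _]]] := gk_weights u; exists s, v. Qed.

Lemma gk_k_wt (B : comAlgType rat) (iF : {lrmorphism Qi -> B}) (g : so2 B) n (u : ext M) :
  wt (@opH M) n u -> gk_k g (baseQ iF u) = kpow iF g n *: baseQ iF u.
Proof.
move=> hu; have [s [v [hv ->]]] := gk_weights u.
have e := wdec_uniq opH_lin hv (wdec_wt opH_lin hu).
have [us _ v0 eu] := hv.
case: (boolP (n \in s)) => ns.
  rewrite (bigD1_seq n) //= big1 ?addr0 ?e ?eqxx // => m /negbTE hm.
  by rewrite e hm (morph_add0 (@baseQD _ iF M)) scaler0.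
have u0 : u = 0 by rewrite -(v0 n ns) e eqxx.
rewrite u0 (morph_add0 (@baseQD _ iF M)) scaler0 big1 // => m _.
by rewrite e u0; case: eqP => _; rewrite (morph_add0 (@baseQD _ iF M)) scaler0.
Qed.
End GkWeights.

(** * Modules over F with the weights and the central character of HC_lambda *)

Definition casimir (P : lmodType Qi) (H X Y : P -> P) (u : P) : P :=
  H (H u) - 2 *: H u + 4 *: X (Y u) + u.
(** (C - l ^ 2) / 4, normalised so that it is phi_a phi_b on the quiver. *)
Definition nilop (l : nat) (P : lmodType Qi) (H X Y : P -> P) (u : P) : P :=
  4^-1 *: (casimir H X Y u - l%:R ^+ 2 *: u).

(** The weights of the parity of l - 1, numbered so that -1, 0 and l are the
    vertices of the quiver. *)
Definition widx (l : nat) (k : int) : int := 2 * k - (l%:Z - 1).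

(** What the representation theory needs of F (x) M_Q: the real structure is left
    out, so that X and Y may be exchanged. *)
Record hcmod (l : nat) (P : lmodType Qi) (H X Y : P -> P) : Prop := HCMod {
  hc_H : linear H;
  hc_X : linear X;
  hc_Y : linear Y;
  hc_HX : forall u, H (X u) = X (H u) + 2 *: X u;
  hc_HY : forall u, H (Y u) = Y (H u) - 2 *: Y u;
  hc_XY : forall u, X (Y u) - Y (X u) = H u;
  hc_weighted : weighted H;
  hc_parity : forall n u, wt H n u -> u <> 0 -> exists k, n = widx l k;
  hc_nil : exists m, forall u, iter m (nilop l H X Y) u = 0 }.

Lemma widx_inj l : injective (widx l).
Proof. by move=> i j /addIr /mulfI; apply. Qed.

Lemma iter_linear (K : pzRingType) (U : lmodType K) (f : U -> U) n :
  linear f -> linear (iter n f).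
Proof. by move=> h; elim: n => [|n IH] // a u v; rewrite !iterS IH h. Qed.

Lemma iter_comm (T : Type) (f g : T -> T) n x :
  (forall x, f (g x) = g (f x)) -> iter n f (g x) = g (iter n f x).
Proof. by move=> h; elim: n => [|n IH] //=; rewrite IH h. Qed.

Section HCTheory.
Variables (l : nat) (P : lmodType Qi) (H X Y : P -> P).
Hypotheses (l_gt0 : (0 < l)%N) (hP : hcmod l H X Y).
Let H_lin := hc_H hP.
Let X_lin := hc_X hP.
Let Y_lin := hc_Y hP.
Let weightedH := hc_weighted hP.
Local Notation N := (nilop l H X Y).
Local Notation wk k := (wt H (widx l k)).

Lemma wk_X k u : wk k u -> wk (k + 1) (X u).
Proof.
move=> hu; rewrite /wt (hc_HX hP) hu (linear_scale X_lin) -scalerDl; congr (_ *: _).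
by rewrite /widx; ring.
Qed.

Lemma wk_Y k u : wk k u -> wk (k - 1) (Y u).
Proof.
move=> hu; rewrite /wt (hc_HY hP) hu (linear_scale Y_lin) -scalerBl; congr (_ *: _).
by rewrite /widx; ring.
Qed.

Lemma wk_Xj j k u : wk k u -> wk (k + j%:Z) (iter j X u).
Proof.
move=> hu; elim: j => [|j IH]; first by rewrite addr0.
by rewrite iterS -[j.+1]addn1 PoszD addrA; apply: wk_X.
Qed.

Lemma wk_Yj j k u : wk k u -> wk (k - j%:Z) (iter j Y u).
Proof.
move=> hu; elim: j => [|j IH]; first by rewrite subr0.
by rewrite iterS -[j.+1]addn1 PoszD opprD addrA; apply: wk_Y.
Qed.

Lemma nilop_lin : linear N.
Proof.
move=> a u v; rewrite /nilop /casimir !(H_lin, X_lin, Y_lin).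
by lmodule_with Qi ltac:(ring).
Qed.

Let L := (linear_add X_lin, linear_add Y_lin, linear_add H_lin, linear_scale X_lin,
  linear_scale Y_lin, linear_scale H_lin, linear_opp X_lin, linear_opp Y_lin, linear_opp H_lin).

Lemma nilop_X u : N (X u) = X (N u).
Proof.
have hYX v : Y (X v) = X (Y v) - H v by rewrite -(hc_XY hP) opprB addrC subrK.
rewrite /nilop /casimir !L hYX !(hc_HX hP, L).
by lmodule_with Qi ltac:(ring).
Qed.

Lemma nilop_Y u : N (Y u) = Y (N u).
Proof.
have hXY v : X (Y v) = Y (X v) + H v by rewrite -(hc_XY hP) addrC subrK.
rewrite /nilop /casimir !L [X (Y (Y u))]hXY !(hc_HY hP, L).
by lmodule_with Qi ltac:(ring).
Qed.

Lemma nilop_H u : N (H u) = H (N u).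
Proof. by rewrite -!(hc_XY hP) (linear_add nilop_lin) (linear_opp nilop_lin) !(nilop_X, nilop_Y). Qed.

Lemma wt_N n u : wt H n u -> wt H n (N u).
Proof. by move=> hu; rewrite /wt -nilop_H hu (linear_scale nilop_lin). Qed.

Lemma XY_wk k u : wk k u -> X (Y u) = N u + (k * (l%:Z - k))%:~R *: u.
Proof.
move=> hu; rewrite /nilop /casimir hu L hu.
by lmodule_with Qi ltac:(rewrite /widx; qfield).
Qed.

Lemma YX_wk k u : wk k u -> Y (X u) = N u + ((k + 1) * (l%:Z - (k + 1)))%:~R *: u.
Proof.
move=> hu; have -> : Y (X u) = X (Y u) - H u by rewrite -(hc_XY hP) opprB addrC subrK.
rewrite (XY_wk hu) hu; by lmodule_with Qi ltac:(rewrite /widx; ring).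
Qed.

(** N is nilpotent, so that N + a is bijective for a nonzero scalar a: with XY_wk
    and YX_wk this inverts X and Y everywhere but at the two places where the
    scalar k (l - k) vanishes. *)
Lemma N_shift_inj a u : a != 0 -> N u + a *: u = 0 -> u = 0.
Proof.
move=> a0 /eqP; rewrite addr_eq0 -scaleNr => /eqP e.
have [m hm] := hc_nil hP.
have h j : iter j N u = (- a) ^+ j *: u.
  elim: j => [|j IH]; first by rewrite scale1r.
  by rewrite iterS IH (linear_scale nilop_lin) e scalerA -exprSr.
by have /eqP := hm u; rewrite h scaler_eq0 expf_eq0 oppr_eq0 (negbTE a0) andbF => /eqP.
Qed.

Lemma N_shift_surj a n u : a != 0 -> wt H n u ->
  exists w, wt H n w /\ N w + a *: w = u.
Proof.
move=> a0 hu; have [m hm] := hc_nil hP.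
move: (hm u) hu; elim: m u {hm} => [|m IH] u.
  by move=> /= -> _; exists 0; rewrite scaler0 addr0 (linear_zero nilop_lin); split=> //; apply: wt0.
rewrite iterSr => hm hu; have [w [hw e]] := IH _ hm (wt_N hu).
exists (a^-1 *: (u - w)); split; first by apply: wtZ => //; apply: wtD => //; apply: wtN.
rewrite (linear_scale nilop_lin) (linear_add nilop_lin) (linear_opp nilop_lin) -e.
by lmodule_with Qi ltac:(field).
Qed.

(** The indices from k + 1 to k + j avoid 0 and l, the two places where X
    and Y are not isomorphisms. *)
Definition interior (k : int) (j : nat) : Prop :=
  forall i, k < i <= k + j%:Z -> i != 0 /\ i != l%:Z.

Let interior_coef k j : interior k j.+1 ->
  ((k + j%:Z + 1) * (l%:Z - (k + j%:Z + 1)))%:~R != 0 :> Qi.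
Proof.
move=> /(_ (k + j%:Z + 1)) []; last first.
  by move=> h1 h2; rewrite intQ_eq0 mulf_neq0 // subr_eq0 eq_sym.
by rewrite -[j.+1]addn1 PoszD addrA lexx andbT -addrA ltrDl -PoszD addn1.
Qed.

Let interiorW k j : interior k j.+1 -> interior k j.
Proof.
move=> h i /andP[h1 h2]; apply: h; rewrite h1 (le_trans h2) //.
by rewrite lerD2l lez_nat.
Qed.

Let wk_Y' k u : wk (k + 1) u -> wk k (Y u).
Proof. by move=> /wk_Y; rewrite addrK. Qed.

Lemma Xj_inj k j u : interior k j -> wk k u -> iter j X u = 0 -> u = 0.
Proof.
move=> hk hu; elim: j hk => [//|j IH] hk e; apply: IH (interiorW hk) _.
have := YX_wk (wk_Xj j hu); rewrite -iterS e (linear_zero Y_lin) => /esym.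
exact/N_shift_inj/interior_coef.
Qed.

Lemma Yj_inj k j u : interior k j -> wk (k + j%:Z) u -> iter j Y u = 0 -> u = 0.
Proof.
elim: j u => [//|j IH] u hk; rewrite iterSr -[j.+1]addn1 PoszD addrA => hu e.
have e1 := IH _ (interiorW hk) (wk_Y' hu) e.
have := XY_wk hu; rewrite e1 (linear_zero X_lin) => /esym.
exact/N_shift_inj/interior_coef.
Qed.

Lemma Xj_surj k j u : interior k j -> wk (k + j%:Z) u ->
  exists2 w, wk k w & iter j X w = u.
Proof.
elim: j u => [|j IH] u hk; first by rewrite addr0 => hu; exists u.
rewrite -[j.+1]addn1 PoszD addrA => hu.
have [w [hw e]] := N_shift_surj (interior_coef hk) hu.
have [v hv ev] := IH _ (interiorW hk) (wk_Y' hw).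
by exists v => //; rewrite addn1 iterS ev (XY_wk hw).
Qed.

Lemma Yj_surj k j u : interior k j -> wk k u ->
  exists2 w, wk (k + j%:Z) w & iter j Y w = u.
Proof.
elim: j u => [|j IH] u hk hu; first by rewrite addr0; exists u.
have [v hv ev] := IH _ (interiorW hk) hu.
have [w [hw e]] := N_shift_surj (interior_coef hk) hv.
exists (X w); first by rewrite -[j.+1]addn1 PoszD addrA; apply: wk_X.
by rewrite iterSr (YX_wk hw) e.
Qed.

Lemma interior_plus j : interior l%:Z j.
Proof.
move=> i /andP[h _]; split; last by rewrite gt_eqF.
by rewrite gt_eqF // (le_lt_trans _ h).
Qed.
Lemma interior_star j : (j < l)%N -> interior 0 j.
Proof.
move=> hj i; rewrite add0r => /andP[h1 h2]; split; first by rewrite gt_eqF.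
by rewrite lt_eqF // (le_lt_trans h2).
Qed.
Lemma interior_minus j : interior (-1 - j%:Z) j.
Proof.
move=> i /andP[_]; rewrite subrK => h; have hi : i < 0 by apply: le_lt_trans h _.
by split; rewrite lt_eqF // (lt_trans hi).
Qed.

Lemma widx_case k : [\/ exists j : nat, k = l%:Z + j%:Z,
  exists2 j : nat, (j < l)%N & k = j%:Z | exists j : nat, k = -1 - j%:Z].
Proof.
case: k => j.
  case: (leqP l j) => h; first by apply: Or31; exists (j - l)%N; rewrite -PoszD subnKC.
  by apply: Or32; exists j.
by apply: Or33; exists j; rewrite NegzE -addn1 PoszD opprD addrC.
Qed.

(** The module is generated by the three weight spaces of the quiver. *)
Lemma hc_ind (Q : P -> Prop) :
  Q 0 -> (forall u v, Q u -> Q v -> Q (u + v)) ->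
  (forall j u, wk l%:Z u -> Q (iter j X u)) ->
  (forall j u, wk 0 u -> Q (iter j X u)) ->
  (forall j u, wk (-1) u -> Q (iter j Y u)) -> forall u, Q u.
Proof.
move=> h0 hD hp hs hm; apply: (wt_ind weightedH) => // n u hu.
have [->//|/eqP u0] := eqVneq u 0.
have [k ek] := hc_parity hP hu u0; move: hu; rewrite ek => hu.
case: (widx_case k) => [[j e]|[j hj e]|[j e]]; rewrite {}e in hu.
- by have [w hw <-] := Xj_surj (interior_plus (j := j)) hu; apply: hp.
- by rewrite -[j%:Z]add0r in hu; have [w hw <-] := Xj_surj (interior_star hj) hu; apply: hs.
- have [w] := Yj_surj (interior_minus (j := j)) hu.
  by rewrite subrK => hw <-; apply: hm.
Qed.

Lemma hc_ext (V : zmodType) (XV YV : V -> V) (f g : P -> V) :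
  {morph f : u v / u + v} -> {morph g : u v / u + v} ->
  (forall u, f (X u) = XV (f u)) -> (forall u, g (X u) = XV (g u)) ->
  (forall u, f (Y u) = YV (f u)) -> (forall u, g (Y u) = YV (g u)) ->
  (forall u, wk l%:Z u -> f u = g u) -> (forall u, wk 0 u -> f u = g u) ->
  (forall u, wk (-1) u -> f u = g u) -> f =1 g.
Proof.
move=> fD gD fX gX fY gY hp hs hm.
have eX j u : f u = g u -> f (iter j X u) = g (iter j X u).
  by move=> e; elim: j => [//|j IH]; rewrite iterS fX gX IH.
have eY j u : f u = g u -> f (iter j Y u) = g (iter j Y u).
  by move=> e; elim: j => [//|j IH]; rewrite iterS fY gY IH.
apply: hc_ind => [|u v hu hv|j u hu|j u hu|j u hu]; last exact/eY/hm.
- by rewrite !morph_add0.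
- by rewrite fD gD hu hv.
- exact/eX/hp.
- exact/eX/hs.
Qed.
End HCTheory.

(** Exchanging X and Y, and changing the sign of H: the twist by which
    complex conjugation becomes an intertwiner. *)
Lemma hcmod_swap l (P : lmodType Qi) (H X Y : P -> P) :
  hcmod l H X Y -> hcmod l (fun u => - H u) Y X.
Proof.
move=> hP; have H_lin := hc_H hP; have X_lin := hc_X hP; have Y_lin := hc_Y hP.
have wtE n u : wt (fun u => - H u) n u <-> wt H (- n) u.
  rewrite /wt rmorphN scaleNr; split=> [<-|->]; by rewrite opprK.
split=> //.
- by move=> a u v; rewrite H_lin opprD scalerN.
- by move=> u; rewrite (hc_HY hP) (linear_opp Y_lin); lmodule Qi.
- by move=> u; rewrite (hc_HX hP) (linear_opp X_lin); lmodule Qi.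
- by move=> u; rewrite -(hc_XY hP) opprB.
- move=> u; have [s [v [us hv v0 e]]] := hc_weighted hP u.
  exists [seq - n | n <- s], (fun n => v (- n)); split.
  + by rewrite map_inj_uniq //; apply: oppr_inj.
  + by move=> n; apply/wtE.
  + by move=> n hn; apply: v0; apply: contra hn => hn; rewrite -[n]opprK map_f.
  + by rewrite big_map e; apply: eq_bigr => n _; rewrite opprK.
- move=> n u /wtE hu u0; have [k ek] := hc_parity hP hu u0.
  by exists (l%:Z - 1 - k); apply: oppr_inj; rewrite ek /widx; ring.
- have [m hm] := hc_nil hP; exists m => u; rewrite -[RHS](hm u).
  apply: eq_iter => {}u; rewrite /nilop /casimir (linear_opp H_lin).
  have -> : X (Y u) = Y (X u) + H u by rewrite -(hc_XY hP) addrC subrK.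
  by lmodule Qi.
Qed.

(** * Extension of maps from the vertices of the quiver *)

Section Extension.
Variables (l : nat) (P Q : lmodType Qi).
Variables (HP XP YP : P -> P) (HQ XQ YQ : Q -> Q).
Hypotheses (l_gt0 : (0 < l)%N) (hP : hcmod l HP XP YP) (hQ : hcmod l HQ XQ YQ).
Variables (sigma : {lrmorphism Qi -> Qi}) (gm gs gp : P -> Q).
Local Notation NP := (nilop l HP XP YP).
Local Notation NQ := (nilop l HQ XQ YQ).
Local Notation wkP k := (wt HP (widx l k)).
Local Notation wkQ k := (wt HQ (widx l k)).

Definition semilinear_on (k : int) (g : P -> Q) : Prop :=
  (forall u, wkP k u -> wkQ k (g u)) /\
  (forall a u v, wkP k u -> wkP k v -> g (a *: u + v) = sigma a *: g u + g v).

Hypotheses (gmL : semilinear_on (-1) gm) (gsL : semilinear_on 0 gs)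
  (gpL : semilinear_on l%:Z gp).
Hypothesis gms : forall u, wkP (-1) u -> gs (XP u) = XQ (gm u).
Hypothesis gsm : forall u, wkP 0 u -> gm (YP u) = YQ (gs u).
Hypothesis gsp : forall u, wkP 0 u -> gp (iter l XP u) = iter l XQ (gs u).
Hypothesis gps : forall u w, wkP l%:Z u -> wkP 0 w ->
  iter l.-1 XP w = YP u -> iter l.-1 XQ (gs w) = YQ (gp u).

(** The extension is built as a relation: no preimages under powers of X and Y
    have to be chosen, at the price of proving that the relation is a function. *)
Inductive ext_graph : P -> Q -> Prop :=
  | graph0 : ext_graph 0 0
  | graphD u v u' v' : ext_graph u u' -> ext_graph v v' -> ext_graph (u + v) (u' + v')
  | graph_plus j u : wkP l%:Z u -> ext_graph (iter j XP u) (iter j XQ (gp u))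
  | graph_star j u : wkP 0 u -> ext_graph (iter j XP u) (iter j XQ (gs u))
  | graph_minus j u : wkP (-1) u -> ext_graph (iter j YP u) (iter j YQ (gm u)).

Let HP_lin := hc_H hP.
Let XP_lin := hc_X hP.
Let YP_lin := hc_Y hP.
Let HQ_lin := hc_H hQ.
Let XQ_lin := hc_X hQ.
Let YQ_lin := hc_Y hQ.
Let wP := hc_weighted hP.
Let wQ := hc_weighted hQ.

Let on0 k g : semilinear_on k g -> g 0 = 0.
Proof.
case=> _ h; have h0 : wkP k 0 by exact: wt0.
by have := h 1 0 0 h0 h0; rewrite scaler0 rmorph1 scale1r addr0 => /esym/eqP; rewrite -subr_eq0 addrK => /eqP.
Qed.

Let onZ k g a u : semilinear_on k g -> wkP k u -> g (a *: u) = sigma a *: g u.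
Proof.
move=> hg hu; have h0 : wkP k 0 by exact: wt0.
by have := hg.2 a u 0 hu h0; rewrite (on0 hg) !addr0.
Qed.

Let on_shift k g (n : int) u : semilinear_on k g -> wkP k u ->
  g (NP u) = NQ (g u) -> g (NP u + n%:~R *: u) = NQ (g u) + n%:~R *: g u.
Proof.
move=> hg hu e; rewrite addrC hg.2 //; last exact: wt_N.
by rewrite e rmorph_int addrC.
Qed.

Let gmN u : wkP (-1) u -> gm (NP u) = NQ (gm u).
Proof.
move=> hu; have eP : YP (XP u) = NP u by rewrite (YX_wk hP hu) addNr mul0r scale0r addr0.
have eQ : YQ (XQ (gm u)) = NQ (gm u).
  by rewrite (YX_wk hQ (gmL.1 _ hu)) addNr mul0r scale0r addr0.
by rewrite -eP gsm ?gms //; have := wk_X hP hu; rewrite addNr.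
Qed.

Let gsN u : wkP 0 u -> gs (NP u) = NQ (gs u).
Proof.
move=> hu; have eP : XP (YP u) = NP u by rewrite (XY_wk hP hu) mul0r scale0r addr0.
have eQ : XQ (YQ (gs u)) = NQ (gs u) by rewrite (XY_wk hQ (gsL.1 _ hu)) mul0r scale0r addr0.
by rewrite -eP gms ?gsm //; have := wk_Y hP hu; rewrite add0r.
Qed.

Let lift_star u : wkP l%:Z u -> exists2 w, wkP 0 w & iter l.-1 XP w = YP u.
Proof.
move=> hu; have hY := wk_Y hP hu; apply: (Xj_surj hP).
  by apply: interior_star => //; rewrite ltn_predL.
by rewrite add0r -subn1 -subzn.
Qed.

Let gpN u : wkP l%:Z u -> gp (NP u) = NQ (gp u).
Proof.
move=> hu; have eP : XP (YP u) = NP u by rewrite (XY_wk hP hu) subrr mulr0 scale0r addr0.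
have eQ : XQ (YQ (gp u)) = NQ (gp u).
  by rewrite (XY_wk hQ (gpL.1 _ hu)) subrr mulr0 scale0r addr0.
have [w hw ew] := lift_star hu.
by rewrite -eP -eQ -ew -iterS prednK // gsp // -{1}(prednK l_gt0) iterS (gps hu hw ew).
Qed.

Lemma graphZ a u w : ext_graph u w -> ext_graph (a *: u) (sigma a *: w).
Proof.
have itZ (U : lmodType Qi) (T : U -> U) j b x : linear T -> b *: iter j T x = iter j T (b *: x).
  by move=> hT; rewrite (linear_scale (iter_linear j hT)).
elim=> [|u1 v1 u2 v2 _ h1 _ h2|j v hv|j v hv|j v hv].
- by rewrite !scaler0; apply: graph0.
- by rewrite !scalerDr; apply: graphD.
- by rewrite !itZ // -(onZ _ gpL hv); apply: graph_plus; apply: wtZ.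
- by rewrite !itZ // -(onZ _ gsL hv); apply: graph_star; apply: wtZ.
- by rewrite !itZ // -(onZ _ gmL hv); apply: graph_minus; apply: wtZ.
Qed.

(* Applying Y to X^(j+1) u gives X^j of a vector of the same weight as u; this
   keeps the generators of the graph closed under Y, and pushY under X. *)
Let pushX (U : lmodType Qi) (HU XU YU : U -> U) (hU : hcmod l HU XU YU) k j u :
  wt HU (widx l k) u -> let c := (k + j%:Z + 1) * (l%:Z - (k + j%:Z + 1)) in
  YU (iter j.+1 XU u) = iter j XU (nilop l HU XU YU u + c%:~R *: u).
Proof.
move=> hu c; have li := iter_linear j (hc_X hU).
rewrite iterS (YX_wk hU (wk_Xj hU j hu)) (linear_add li) (linear_scale li).
by rewrite iter_comm // => v; rewrite (nilop_X hU).
Qed.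

Let pushY (U : lmodType Qi) (HU XU YU : U -> U) (hU : hcmod l HU XU YU) k j u :
  wt HU (widx l k) u -> let c := (k - j%:Z) * (l%:Z - (k - j%:Z)) in
  XU (iter j.+1 YU u) = iter j YU (nilop l HU XU YU u + c%:~R *: u).
Proof.
move=> hu c; have li := iter_linear j (hc_Y hU).
rewrite iterS (XY_wk hU (wk_Yj hU j hu)) (linear_add li) (linear_scale li).
by rewrite iter_comm // => v; rewrite (nilop_Y hU).
Qed.

Let wk_shift k n u : wkP k u -> wkP k (NP u + n%:~R *: u).
Proof. by move=> hu; apply: wtD => //; [exact: wt_N|exact: wtZ]. Qed.

Lemma graphX u w : ext_graph u w -> ext_graph (XP u) (XQ w).
Proof.
elim=> [|u1 v1 u2 v2 _ h1 _ h2|j v hv|j v hv|[|j] v hv].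
- by rewrite !linear_zero //; apply: graph0.
- by rewrite (linear_add XP_lin) (linear_add XQ_lin); apply: graphD.
- by rewrite -!iterS; apply: graph_plus.
- by rewrite -!iterS; apply: graph_star.
- by rewrite /= -gms //; apply: (graph_star 0); have := wk_X hP hv; rewrite addNr.
- rewrite (pushY hP _ hv) (pushY hQ _ (gmL.1 _ hv)) -(on_shift _ gmL hv (gmN hv)).
  exact/graph_minus/wk_shift.
Qed.

Lemma graphY u w : ext_graph u w -> ext_graph (YP u) (YQ w).
Proof.
elim=> [|u1 v1 u2 v2 _ h1 _ h2|[|j] v hv|[|j] v hv|j v hv].
- by rewrite !linear_zero //; apply: graph0.
- by rewrite (linear_add YP_lin) (linear_add YQ_lin); apply: graphD.
- have [v' hv' ev'] := lift_star hv.
  by rewrite /= -(gps hv hv' ev') -ev'; apply: graph_star.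
- rewrite (pushX hP _ hv) (pushX hQ _ (gpL.1 _ hv)) -(on_shift _ gpL hv (gpN hv)).
  exact/graph_plus/wk_shift.
- by rewrite /= -gsm //; apply: (graph_minus 0); have := wk_Y hP hv; rewrite add0r.
- rewrite (pushX hP _ hv) (pushX hQ _ (gsL.1 _ hv)) -(on_shift _ gsL hv (gsN hv)).
  exact/graph_star/wk_shift.
- by rewrite -!iterS; apply: graph_minus.
Qed.

Lemma graph_total u : exists w, ext_graph u w.
Proof.
move: u; apply: (hc_ind l_gt0 hP) => [|u v [w hw] [w' hw']|j u hu|j u hu|j u hu].
- by exists 0; apply: graph0.
- by exists (w + w'); apply: graphD.
- by eexists; apply: graph_plus.
- by eexists; apply: graph_star.
- by eexists; apply: graph_minus.
Qed.

Let comp_wk (U : lmodType Qi) (HU XU YU : U -> U) (hU : hcmod l HU XU YU) k k' u :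
  wt HU (widx l k) u -> wcomp HU (widx l k') u = if k' == k then u else 0.
Proof. by move=> hu; rewrite (wcomp_wt (hc_H hU) (hc_weighted hU) _ hu) (inj_eq (@widx_inj l)). Qed.

(** The generators above meet the three vertices only where the hypotheses
    determine their images. *)
Lemma graph_comp u w : ext_graph u w ->
  [/\ wcomp HQ (widx l (-1)) w = gm (wcomp HP (widx l (-1)) u),
      wcomp HQ (widx l 0) w = gs (wcomp HP (widx l 0) u)
    & wcomp HQ (widx l l%:Z) w = gp (wcomp HP (widx l l%:Z) u)].
Proof.
have onD k g x y : semilinear_on k g ->
    g (wcomp HP (widx l k) (x + y)) = g (wcomp HP (widx l k) x) + g (wcomp HP (widx l k) y).
  move=> hg; have wx z : wkP k (wcomp HP (widx l k) z) by exact: wt_wcomp.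
  have := hg.2 1 _ _ (wx x) (wx y).
  by rewrite !scale1r rmorph1 scale1r wcompD.
elim=> [|u1 v1 u2 v2 _ [h1 h2 h3] _ [h1' h2' h3']|j v hv|j v hv|j v hv].
- by rewrite !wcomp0 // (on0 gmL) (on0 gsL) (on0 gpL).
- by rewrite !onD // !(wcompD HQ_lin) // h1 h2 h3 h1' h2' h3'.
- have vP := wk_Xj hP j hv; have vQ := wk_Xj hQ j (gpL.1 _ hv).
  split; rewrite (comp_wk hP _ vP) (comp_wk hQ _ vQ).
  + by rewrite -PoszD /= (on0 gmL).
  + by rewrite lt_eqF ?(on0 gsL) // -PoszD ltz_nat addn_gt0 l_gt0.
  + case: j {vP vQ} => [|j]; first by rewrite addr0 eqxx.
    by rewrite lt_eqF ?(on0 gpL) // ltrDl.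
- have vP := wk_Xj hP j hv; have vQ := wk_Xj hQ j (gsL.1 _ hv); rewrite add0r in vP vQ.
  split; rewrite (comp_wk hP _ vP) (comp_wk hQ _ vQ).
  + by rewrite (on0 gmL).
  + by case: j {vP vQ} => [//|j] /=; rewrite (on0 gsL).
  + by rewrite eqz_nat; case: eqP => [<-|_]; rewrite ?gsp // (on0 gpL).
- have vP := wk_Yj hP j hv; have vQ := wk_Yj hQ j (gmL.1 _ hv).
  have e1 : -1 - j%:Z < 0 :> int by rewrite ltrBlDr (lt_le_trans (ltrN10 _)).
  split; rewrite (comp_wk hP _ vP) (comp_wk hQ _ vQ).
  + by case: j {vP vQ e1} => [|j]; rewrite ?subr0 //= ?(on0 gmL).
  + by rewrite gt_eqF // (on0 gsL).
  + by rewrite gt_eqF ?(on0 gpL) // (lt_le_trans e1).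
Qed.

(** A nonzero weight vector related to 0 could be moved to a vertex by an
    injective power of X or Y, and graph_comp forbids this. *)
Lemma graph_fun w : ext_graph 0 w -> w = 0.
Proof.
move=> hw; have hX j : ext_graph 0 (iter j XQ w).
  elim: j => [//|j IH]; rewrite iterS -(linear_zero XP_lin); exact: graphX.
have hY j : ext_graph 0 (iter j YQ w).
  elim: j => [//|j IH]; rewrite iterS -(linear_zero YP_lin); exact: graphY.
rewrite [w](wsum_id wQ) big1 // => n _.
have [//|/eqP w0] := eqVneq (wcomp HQ n w) 0.
have hn := wt_wcomp wQ n w.
have [k ek] := hc_parity hQ hn w0; rewrite ek in hn *; move=> {w0 ek n}.
have shY j i : wcomp HQ (widx l (i - j%:Z)) (iter j YQ w) = iter j YQ (wcomp HQ (widx l i) w).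
  have -> : widx l (i - j%:Z) = widx l i - 2 * j%:Z by rewrite /widx; ring.
  apply: (wcomp_shift HQ_lin HQ_lin wQ wQ (e := fun n => n - 2 * j%:Z)) => [||m u hu].
  - exact: linear_add (iter_linear j YQ_lin).
  - by move=> m m' /addIr.
  - elim: j => [|j IH]; first by rewrite mulr0 subr0.
    rewrite iterS -[j.+1]addn1 PoszD mulrDr opprD addrA /wt (hc_HY hQ) IH (linear_scale YQ_lin).
    by rewrite -scalerBl; congr (_ *: _); rewrite !rmorphB.
have shX j i : wcomp HQ (widx l (i + j%:Z)) (iter j XQ w) = iter j XQ (wcomp HQ (widx l i) w).
  have -> : widx l (i + j%:Z) = widx l i + 2 * j%:Z by rewrite /widx; ring.
  apply: (wcomp_shift HQ_lin HQ_lin wQ wQ (e := fun n => n + 2 * j%:Z)) => [||m u hu].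
  - exact: linear_add (iter_linear j XQ_lin).
  - by move=> m m' /addIr.
  - elim: j => [|j IH]; first by rewrite mulr0 addr0.
    rewrite iterS -[j.+1]addn1 PoszD mulrDr addrA /wt (hc_HX hQ) IH (linear_scale XQ_lin).
    by rewrite -scalerDl; congr (_ *: _); rewrite !rmorphD.
case: (widx_case l k) => [[j e]|[j hj e]|[j e]]; rewrite {}e in hn *.
- apply: (Yj_inj hQ (@interior_plus l j) hn).
  have [_ _] := graph_comp (hY j); rewrite wcomp0 // (on0 gpL) => e.
  by rewrite -shY addrK.
- apply: (Yj_inj hQ (interior_star hj)); first by rewrite add0r.
  have [_ e _] := graph_comp (hY j); rewrite wcomp0 // (on0 gsL) in e.
  by rewrite -shY subrr.
- apply: (Xj_inj hQ (@interior_minus l l_gt0 j) hn).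
  have [e _ _] := graph_comp (hX j); rewrite wcomp0 // (on0 gmL) in e.
  by rewrite -shX subrK.
Qed.

(** Maps on the weight spaces of the vertices that respect the arrows extend to
    the modules. Allowing a field automorphism sigma makes the statement apply to
    conjugations as well as to F-linear morphisms. *)
Theorem hc_extension : exists f : P -> Q,
  [/\ forall a u v, f (a *: u + v) = sigma a *: f u + f v,
      forall u, f (XP u) = XQ (f u), forall u, f (YP u) = YQ (f u)
    & [/\ forall u, wkP (-1) u -> f u = gm u, forall u, wkP 0 u -> f u = gs u
        & forall u, wkP l%:Z u -> f u = gp u]].
Proof.
have [f hf] := choice graph_total.
have uniq u w w' : ext_graph u w -> ext_graph u w' -> w = w'.
  move=> h h'; apply/eqP; rewrite -subr_eq0; apply/eqP/graph_fun.
  rewrite -(subrr u); apply: graphD => //.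
  by have := graphZ (-1) h'; rewrite rmorphN1 !scaleN1r.
exists f; split=> [a u v|u|u|]; first by apply: uniq (hf _) _; apply: graphD => //; apply: graphZ.
- exact: uniq (hf _) (graphX (hf u)).
- exact: uniq (hf _) (graphY (hf u)).
split=> u hu; apply: uniq (hf _) _.
- exact: (graph_minus 0).
- exact: (graph_star 0).
- exact: (graph_plus 0).
Qed.
End Extension.

(** * Polynomials in a nilpotent operator *)

Section Pact.
Variables (P : lmodType Qi) (N : P -> P).
Hypothesis N_lin : linear N.
Implicit Types (p q : {poly rat}).

(** Coefficients are taken in Q, so that these operators commute with conjugation. *)
Definition pact p (u : P) : P := \sum_(i < size p) (p`_i)%:A *: iter i N u.

Lemma pactE n p u : (size p <= n)%N -> pact p u = \sum_(i < n) (p`_i)%:A *: iter i N u.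
Proof.
move=> h; rewrite /pact (big_ord_widen n (fun i => (p`_i)%:A *: iter i N u) h) big_mkcond.
apply: eq_bigr => i _; case: ltnP => // hi.
by rewrite nth_default // !scale0r.
Qed.

Lemma pactD p q u : pact (p + q) u = pact p u + pact q u.
Proof.
pose n := maxn (size p) (size q).
rewrite !(@pactE n) ?leq_maxl ?leq_maxr ?(leq_trans (size_polyD _ _)) // -big_split.
by apply: eq_bigr => i _; rewrite coefD !scalerDl.
Qed.

Lemma pactZ c p u : pact (c *: p) u = c%:A *: pact p u.
Proof.
rewrite (@pactE (size p)) ?size_scale_leq // scaler_sumr; apply: eq_bigr => i _.
by rewrite coefZ scalerA -!in_algE rmorphM.
Qed.

Lemma pactN p u : pact (- p) u = - pact p u.
Proof. by rewrite -[- p]scaleN1r pactZ -in_algE rmorphN1 scaleN1r. Qed.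

Lemma pactC c u : pact c%:P u = c%:A *: u.
Proof. by rewrite (@pactE 1) ?size_polyC_leq1 // big_ord1 coefC. Qed.

Lemma pact1 u : pact 1 u = u.
Proof. by rewrite pactC -in_algE rmorph1 scale1r. Qed.

Lemma pactMX p u : pact (p * 'X) u = N (pact p u).
Proof.
rewrite (@pactE (size p).+1); last by rewrite (leq_trans (size_polyMleq _ _)) // size_polyX addn2.
rewrite big_ord_recl coefMX /= -in_algE rmorph0 scale0r add0r (morph_sum (linear_add N_lin)).
by apply: eq_bigr => i _; rewrite coefMX /= (linear_scale N_lin).
Qed.

Lemma pactX u : pact 'X u = N u.
Proof. by rewrite -['X]mul1r pactMX pact1. Qed.

Lemma pact_lin p : linear (pact p).
Proof.
move=> a u v; rewrite /pact scaler_sumr -big_split; apply: eq_bigr => i _ /=.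
by rewrite (iter_linear i N_lin) scalerDr !scalerA mulrC.
Qed.

Lemma pactM p q u : pact (p * q) u = pact p (pact q u).
Proof.
elim/poly_ind: p u => [|p c IH] u; first by rewrite mul0r -polyC0 !pactC -in_algE rmorph0 !scale0r.
have -> : (p * 'X + c%:P) * q = p * q * 'X + c *: q by rewrite -mul_polyC; ring.
by rewrite !pactD !pactMX IH pactZ pactC.
Qed.

Lemma pact_comm p q u : pact p (pact q u) = pact q (pact p u).
Proof. by rewrite -!pactM mulrC. Qed.

Lemma iter_pact n u : iter n N u = pact 'X^n u.
Proof. by elim: n => [|n IH]; rewrite ?pact1 // iterS IH exprSr pactMX. Qed.

Lemma pact_dvd m p u : (forall v, iter m N v = 0) -> 'X^m %| p -> pact p u = 0.
Proof. by move=> h /dvdpP[q ->]; rewrite mulrC pactM -iter_pact h. Qed.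

Lemma pact_mod m p q u : (forall v, iter m N v = 0) -> 'X^m %| p - q ->
  pact p u = pact q u.
Proof. by move=> h /(pact_dvd u h) /eqP; rewrite pactD pactN subr_eq0 => /eqP. Qed.
End Pact.

Lemma pact_morph (P Q : lmodType Qi) (NP : P -> P) (NQ : Q -> Q)
    (sigma : {lrmorphism Qi -> Qi}) (f : P -> Q) p u :
  (forall i, f (iter i NP u) = iter i NQ (f u)) ->
  {morph f : u v / u + v} -> (forall a v, f (a *: v) = sigma a *: f v) ->
  f (pact NP p u) = pact NQ p (f u).
Proof.
move=> h hD hZ; rewrite /pact (morph_sum hD); apply: eq_bigr => i _.
by rewrite hZ h linearZ /= rmorph1.
Qed.

(** * Inverse square roots modulo a power of X *)

Lemma dvdXn_root (n : nat) (p : {poly rat}) : (0 < n)%N -> 'X^n %| p -> p.[0] = 0.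
Proof. by case: n => // n _ /dvdpP[q ->]; rewrite hornerM hornerXn expr0n mulr0. Qed.

Lemma coprimeX m (p : {poly rat}) : p.[0] != 0 -> coprimep 'X^m p.
Proof. by move=> h; apply: coprimep_expl; rewrite coprimep_sym -['X]subr0 -polyC0 coprimep_XsubC. Qed.

Lemma inv_modX m (p : {poly rat}) : p.[0] != 0 -> exists q, 'X^m %| p * q - 1.
Proof.
move=> /(coprimeX m) /Bezout_eq1_coprimepP [[u v] /= e]; exists v.
by rewrite -e (_ : _ - _ = - u * 'X^m) ?dvdp_mull //; ring.
Qed.

Section InvSqrt.
Variables (m : nat) (tau : {poly rat}).
Hypotheses (m_gt0 : (0 < m)%N) (tau0 : tau.[0] = 1).
Implicit Types (a b s : {poly rat}).

Lemma inv_modX_at0 a b : 'X^m %| a * b - 1 -> a.[0] = 1 -> b.[0] = 1.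
Proof.
move=> /(dvdXn_root m_gt0); rewrite hornerD hornerN hornerM hornerC => /eqP.
by rewrite subr_eq0 => /eqP + e; rewrite e mul1r.
Qed.

Definition inv_sqrt s : Prop := s.[0] = 1 /\ 'X^m %| tau * s ^+ 2 - 1.

(** One step of the Newton iteration doubles the precision; a gain of one
    power of X is all that is needed. *)
Lemma newton_step k a b : a.[0] = 1 -> 'X^m %| tau * a * b - 1 ->
  'X^(minn m k.+1) %| tau * a ^+ 2 - 1 ->
  'X^(minn m k.+2) %| tau * (2^-1 *: (a + b)) ^+ 2 - 1.
Proof.
move=> ha hb hk.
set h := 2^-1 *: (a + b).
have eb : b = h + h - a.
  have : 1 = 2^-1 + 2^-1 :> rat by [].
  move=> e; have : h + h = a + b by rewrite /h -scalerDl -e scale1r.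
  by move=> ->; ring.
have e4 : (4 : rat) *: (tau * h ^+ 2 - 1) = tau * b ^+ 2 * (tau * a ^+ 2 - 1) ^+ 2
    + (tau * a * b - 1) * ((1 + tau * a * b) * (2 - tau * a ^+ 2) + 2).
  by rewrite scaler_nat eb; ring.
have four : (4 : rat) != 0 by [].
rewrite -(dvdpZr _ _ four) e4; apply: dvdp_add; last first.
  by apply: dvdp_mulr; apply: dvdp_trans hb; rewrite dvdp_exp2l // geq_minl.
apply: dvdp_mull; apply: dvdp_trans (dvdp_exp2r 2 hk); rewrite -exprM dvdp_exp2l // geq_min.
by case: (leqP m k.+1) => h1; rewrite ?muln2 -addnn ?leq_addr // addSn ltnS leq_addl orbT.
Qed.

Lemma inv_sqrt_exists : exists s, inv_sqrt s.
Proof.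
suff h k : exists s, s.[0] = 1 /\ 'X^(minn m k.+1) %| tau * s ^+ 2 - 1.
  by have [s [h1 h2]] := h m; exists s; split=> //; rewrite (minn_idPl _) in h2.
elim: k => [|k [s [h1 h2]]].
  exists 1; split; first by rewrite hornerC.
  rewrite (minn_idPr _) // expr1n mulr1 expr1 -['X]subr0 -polyC0 dvdp_XsubCl.
  by rewrite /root hornerD hornerN tau0 hornerC subrr.
have [b hb] : exists b, 'X^m %| tau * s * b - 1.
  by apply: inv_modX; rewrite hornerM tau0 h1 mulr1 oner_neq0.
exists (2^-1 *: (s + b)); split; last exact: newton_step.
have hb0 : b.[0] = 1 by apply: (inv_modX_at0 hb); rewrite hornerM tau0 h1 mulr1.
by rewrite hornerZ hornerD h1 hb0.
Qed.

Lemma inv_sqrt_uniq s s' : inv_sqrt s -> inv_sqrt s' -> 'X^m %| s - s'.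
Proof.
case=> h1 h2 [h1' h2']; have := dvdp_sub h2 h2'.
have -> : tau * s ^+ 2 - 1 - (tau * s' ^+ 2 - 1) = (s - s') * (tau * (s + s')) by ring.
rewrite Gauss_dvdpl // coprimeX // hornerM tau0 hornerD h1 h1'.
by [].
Qed.

End InvSqrt.

(** * Extensions of scalars of Harish-Chandra modules *)

Section Sl2Ext.
Variable M : gkmod.
Let ml := @act_linl M.
Let mr := @act_linr M.
Let mb := gk_bracket (gkP M).

Definition opE : ext M -> ext M := exE (@gk_g M).
Definition opFm : ext M -> ext M := exF (@gk_g M).
Definition opD : ext M -> ext M := exD (@gk_g M).

Lemma opHE u : opH u = imQ *: (opFm u - opE u).
Proof. exact: exHE. Qed.
Lemma opXE u : opX u = 2^-1 *: (opD u + imQ *: (opE u + opFm u)).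
Proof. exact: exXE. Qed.
Lemma opYE u : opY u = 2^-1 *: (opD u - imQ *: (opE u + opFm u)).
Proof. exact: exYE. Qed.
Lemma opD_comb u : opD u = 1 *: opX u + 1 *: opY u + 0 *: opH u.
Proof. exact: exD_comb. Qed.
Lemma opE_comb u :
  opE u = (- (2^-1 * imQ)) *: opX u + (2^-1 * imQ) *: opY u + (2^-1 * imQ) *: opH u.
Proof. exact: exE_comb. Qed.
Lemma opFm_comb u :
  opFm u = (- (2^-1 * imQ)) *: opX u + (2^-1 * imQ) *: opY u + (- (2^-1 * imQ)) *: opH u.
Proof. exact: exF_comb. Qed.
Lemma op_HX u : opH (opX u) = opX (opH u) + 2 *: opX u :> ext M.
Proof. exact: (exHX ml mr mb). Qed.
Lemma op_HY u : opH (opY u) = opY (opH u) - 2 *: opY u :> ext M.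
Proof. exact: (exHY ml mr mb). Qed.
Lemma op_XY u : opX (opY u) - opY (opX u) = opH u :> ext M.
Proof. exact: (exXY ml mr mb). Qed.
End Sl2Ext.

Lemma conjQ_linear : linear conjQ. Proof. exact: linearP. Qed.

Section Conj.
Variable M : gkmod.
Local Notation c := (@opc M).

Lemma opcD : {morph c : u v / u + v}.
Proof. exact: tens_mapD conjQ_linear (@linear_id _ M). Qed.
Lemma opcZ a u : c (a *: u) = conjQ a *: c u.
Proof. by apply: tens_mapZ; [exact: conjQ_linear|exact: linear_id|exact: rmorphM]. Qed.
Lemma opcK : involutive c.
Proof.
apply: tens_ext => [u v|//|a m]; first by rewrite !opcD.
have h := tens_map_pure conjQ_linear (@linear_id _ M).
by rewrite /opc !h conjQK.
Qed.

Lemma opc_act Z u : c (tens_map id (gk_g Z) u) = tens_map id (gk_g Z) (c u).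
Proof.
have D Z' := linear_add (@tens_map_linear Qi M M _ (act_linr Z')).
move: u; apply: tens_ext => [u v|u v|a m]; rewrite ?D ?opcD ?D //.
have P := tens_map_pure conjQ_linear (@linear_id _ M).
by rewrite (tens_map_pure _ (act_linr _)) // /opc !P (tens_map_pure _ (act_linr _)).
Qed.

Lemma opc_X u : c (opX u) = opY (c u).
Proof.
rewrite opXE opYE /opD /opE /opFm /exD /exE /exF -!opc_act !(opcD, opcZ) conjQ_im fmorphV rmorph_nat.
by labstract; lmodule Qi.
Qed.
Lemma opc_Y u : c (opY u) = opX (c u).
Proof. by rewrite -[u in LHS]opcK -opc_X opcK. Qed.
End Conj.

Section NilpOp.
Variables (l : nat) (M : gkmod).
Definition opN : ext M -> ext M := nilop l (@opH M) (@opX M) (@opY M).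

Lemma opN_lin : linear opN.
Proof.
move=> a u v; rewrite /opN /nilop /casimir !(opH_lin, opX_lin, opY_lin).
by lmodule_with Qi ltac:(ring).
Qed.

Lemma opCE u : opC u = 4 *: opN u + l%:R ^+ 2 *: u.
Proof.
rewrite /opN /nilop /opC /casimir; by lmodule_with Qi ltac:(qfield).
Qed.
End NilpOp.

Lemma parity_widx l n : (0 < l)%N -> odd l.-1 = odd `|n|%N -> exists k, n = widx l k.
Proof.
move=> l0 ho; have e1 := odd_double_half `|n|%N; have e2 := odd_double_half l.-1.
rewrite ho in e2; move: (odd _) (`|n|./2)%N (l.-1./2)%N e1 e2 => b c d e1 e2.
have -> : widx l = fun k => 2 * k - (b%:Z + 2 * d%:Z).
  by apply/funext => k; rewrite /widx -predn_int // -e2 -mul2n PoszD PoszM.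
case: n e1 {ho} => m /=.
  by move=> <-; exists (b%:Z + c%:Z + d%:Z); rewrite -mul2n PoszD PoszM; ring.
by rewrite NegzE => <-; exists (d%:Z - c%:Z); rewrite -mul2n PoszD PoszM; ring.
Qed.

(** The parity condition is stated over Q itself; -1 is a point over Q. *)
Lemma rat_incl : exists phi : {lrmorphism rat^o -> Qi},
  so2_map phi (so2_neg rat^o) = so2_neg Qi /\
  forall (M : lmodType rat) (m : M), tens_map phi id (pure 1 m) = pure 1 m :> tens Qi M.
Proof.
have [phi hphi] : exists phi : {lrmorphism rat^o -> Qi}, in_alg Qi =1 phi.
  apply: (@lrmorphism_of rat^o Qi); first by move=> q x y; rewrite /= scalerDl -scalerA.
  by split; [exact: rmorph1|exact: rmorphM].
exists phi; split; first by apply: so2_eq; rewrite /= ?rmorphN1 ?rmorph0.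
by move=> M m; rewrite tens_map_pure ?rmorph1 //; exact: linearP.
Qed.

Section HCModule.
Variables (l : nat) (M : gkmod).
Hypotheses (l_gt0 : (0 < l)%N) (hM : is_HC l (l%:R ^+ 2) M).

Lemma HC_nil : exists m, (0 < m)%N /\ forall u : ext M, iter m (opN l (M := M)) u = 0.
Proof.
have [m hm] := HC_character hM; exists m.+1; split=> // u; rewrite iterS.
suff -> : iter m (opN l (M := M)) u = 0 by rewrite (linear_zero (@opN_lin l M)).
pose T (u : ext M) := opC u - ratr (l%:R ^+ 2) *: u.
have lam : ratr (l%:R ^+ 2) = l%:R ^+ 2 :> Qi by rewrite -natrX ratr_nat natrX.
have TE v : T v = 4 *: opN l v by rewrite /T (opCE l) lam addrK.
have T_lin : linear T by move=> a v w; rewrite !TE opN_lin; lmodule Qi.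
have hT v : iter m T v = 0.
  elim/tens_ind: v => [|v w hv hw|a n].
  - by rewrite (linear_zero (iter_linear m T_lin)).
  - by rewrite (linear_add (iter_linear m T_lin)) hv hw addr0.
  - by rewrite pureE (linear_scale (iter_linear m T_lin)) hm scaler0.
have e j v : iter j T v = 4 ^+ j *: iter j (opN l (M := M)) v.
  elim: j => [|j IH]; first by rewrite scale1r.
  by rewrite !iterS IH TE (linear_scale (@opN_lin l M)) scalerA -exprS.
have /eqP := hT u; rewrite e scaler_eq0 expf_eq0 natQ_eq0 andbF => /eqP //.
Qed.

Lemma k_neg u : gk_k (so2_neg Qi) u = (-1) ^+ l.-1 *: u :> ext M.
Proof.
have [phi [phi_neg p1]] := rat_incl.
move: u; apply: tens_ext => [u v|u v|a m]; rewrite ?gk_kD ?scalerDr //.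
rewrite pureE gk_kZ scalerA mulrC -scalerA; congr (_ *: _).
rewrite -(p1 M) -phi_neg -(so2_rep_nat (gk_rep (gkP M))) (HC_parity hM) !p1 pureZr.
by rewrite -in_algE rmorphXn rmorphN1.
Qed.

Lemma exprN1_inj a b : (-1) ^+ a = (-1) ^+ b :> Qi -> odd a = odd b.
Proof.
rewrite -[LHS]signr_odd -[RHS]signr_odd.
have h : (1 : Qi) <> -1.
  by move/eqP; rewrite -subr_eq0 opprK -(natrD _ 1 1) natQ_eq0.
by case: (odd a); case: (odd b) => //; rewrite expr0 expr1 => // /esym.
Qed.

Lemma gk_hcmod : hcmod l (@opH M) (@opX M) (@opY M).
Proof.
split.
- exact: opH_lin.
- exact: opX_lin.
- exact: opY_lin.
- exact: op_HX.
- exact: op_HY.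
- exact: op_XY.
- exact: gk_weighted.
- move=> n u hu u0; pose iQ : {lrmorphism Qi -> Qi} := idfun.
  have idQ (w : ext M) : baseQ iQ w = w by exact: tens_map_id.
  have e : ((-1) ^+ l.-1 - kpow iQ (so2_neg Qi) n) *: (u : ext M) = 0.
    by rewrite scalerBl -k_neg -[u in gk_k _ u]idQ (gk_k_wt iQ _ hu) idQ subrr.
  have {e} : (-1) ^+ l.-1 = zpow (-1 : Qi) (-1) n.
    move/eqP: e; rewrite scaler_eq0 (introF eqP u0) orbF subr_eq0 => /eqP ->.
    by rewrite /kpow /kz /kz' [so2y _]/(0) mulr0 ?subr0 ?addr0.
  have -> : zpow (-1 : Qi) (-1) n = (-1) ^+ `|n|%N by case: n {hu} => m.
  move=> /exprN1_inj ho; exact: parity_widx.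
- by have [m [_ h]] := HC_nil; exists m.
Qed.
End HCModule.

(** * The quiver inside a module with conjugation *)

Section TauPoly.
Variable l : nat.

(** T = tau(N) on the whole module, by C = 4 N + l ^ 2. *)
Definition tau : {poly rat} :=
  ((l.-1)`!%:R ^- 2) *: \prod_(j < l.-1) ('X + (((j.+1 * (l.-1 - j))%N)%:R)%:P).

Lemma tau_at0 : tau.[0] = 1.
Proof.
rewrite /tau hornerZ horner_prod; under eq_bigr => j _ do rewrite hornerD hornerX hornerC add0r.
rewrite -natr_prod big_split /= (_ : \prod_(i < l.-1) i.+1 = (l.-1)`!)%N; last first.
  by rewrite fact_prod big_add1 big_mkord.
rewrite (_ : \prod_(i < l.-1) (l.-1 - i) = (l.-1)`!)%N; last first.
  rewrite fact_prod big_add1 big_mkord (reindex_inj rev_ord_inj).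
  by apply: eq_bigr => i _; rewrite /= subKn.
by rewrite natrM -expr2 mulVf // expf_neq0 // pnatr_eq0 -lt0n fact_gt0.
Qed.
End TauPoly.

Section QuiverIn.
Variables (l : nat) (P : lmodType Qi) (H X Y : P -> P).
Hypotheses (l_gt0 : (0 < l)%N) (hP : hcmod l H X Y).
Local Notation N := (nilop l H X Y).
Local Notation wk k := (wt H (widx l k)).
Local Notation act := (pact N).
Let H_lin := hc_H hP.
Let X_lin := hc_X hP.
Let Y_lin := hc_Y hP.
Let N_lin := nilop_lin hP.

Definition gam : Qi := (l.-1)`!%:R.
Definition Xs (u : P) : P := gam^-1 *: iter l.-1 X u.
Definition Ys (u : P) : P := gam^-1 *: iter l.-1 Y u.

Lemma gam_neq0 : gam != 0.
Proof. by rewrite natQ_eq0 -lt0n fact_gt0. Qed.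

Lemma Xs_lin : linear Xs.
Proof.
by move=> a u v; rewrite /Xs (iter_linear _ X_lin) scalerDr !scalerA mulrC.
Qed.

Lemma act_comm (T : P -> P) p u : linear T -> (forall v, T (N v) = N (T v)) ->
  T (act p u) = act p (T u).
Proof.
move=> hT h; apply: (@pact_morph _ _ _ _ idfun).
- by move=> i; rewrite iter_comm // => v; rewrite h.
- exact: linear_add hT.
- exact: linear_scale hT.
Qed.

Lemma act_X p u : X (act p u) = act p (X u).
Proof. by apply: act_comm => // v; rewrite (nilop_X hP). Qed.
Lemma act_Y p u : Y (act p u) = act p (Y u).
Proof. by apply: act_comm => // v; rewrite (nilop_Y hP). Qed.
Lemma act_H p u : H (act p u) = act p (H u).
Proof. by apply: act_comm => // v; rewrite (nilop_H hP). Qed.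

Lemma iter_act (T : P -> P) j p u : (forall p u, T (act p u) = act p (T u)) ->
  iter j T (act p u) = act p (iter j T u).
Proof. by move=> h; elim: j => [//|j IH]; rewrite !iterS IH h. Qed.

Lemma act_Xs p u : Xs (act p u) = act p (Xs u).
Proof. by rewrite /Xs iter_act ?(linear_scale (pact_lin N_lin p)) //; exact: act_X. Qed.

Lemma wt_act n p u : wt H n u -> wt H n (act p u).
Proof. by move=> hu; rewrite /wt act_H hu (linear_scale (pact_lin N_lin p)). Qed.

Lemma wk_Xs u : wk 0 u -> wk (l%:Z - 1) (Xs u).
Proof.
move=> /(wk_Xj hP l.-1); rewrite add0r -predn_int // => h; exact: wtZ.
Qed.

Lemma Xs_inj u : wk 0 u -> Xs u = 0 -> u = 0.
Proof.
move=> hu /eqP; rewrite scaler_eq0 invr_eq0 (negbTE gam_neq0) => /eqP.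
by apply: (Xj_inj hP) hu; apply: interior_star; rewrite ltn_predL.
Qed.
Lemma Xs_inj2 u v : wk 0 u -> wk 0 v -> Xs u = Xs v -> u = v.
Proof.
move=> hu hv e; apply/eqP; rewrite -subr_eq0; apply/eqP/Xs_inj.
  by apply: wtD => //; apply: wtN.
by rewrite (linear_add Xs_lin) (linear_opp Xs_lin) e subrr.
Qed.
Lemma Xs_surj u : wk (l%:Z - 1) u -> exists2 w, wk 0 w & Xs w = u.
Proof.
move=> hu; have [||w hw e] := Xj_surj hP (k := 0) (j := l.-1) (u := gam *: u).
- by apply: interior_star; rewrite ltn_predL.
- by rewrite add0r predn_int //; apply: wtZ.
by exists w => //; rewrite /Xs e scalerA mulVf ?gam_neq0 // scale1r.
Qed.

Lemma XjYj j u : wk 0 u ->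
  iter j Y (iter j X u) = act (\prod_(i < j) ('X + ((i.+1%:Z * (l%:Z - i.+1%:Z))%:~R)%:P)) u.
Proof.
move=> hu; elim: j => [|j IH]; first by rewrite big_ord0 pact1.
rewrite iterSr iterS (YX_wk hP (wk_Xj hP j hu)) (linear_add (iter_linear j Y_lin)).
rewrite (@iter_comm _ Y N) => [|v]; last by rewrite (nilop_Y hP).
rewrite (linear_scale (iter_linear j Y_lin)) IH big_ord_recr /= [in RHS]mulrC.
rewrite pactM // pactD pactX // pactC; congr (_ + _ *: _).
by rewrite -in_algE rmorph_int add0r -PoszD addn1.
Qed.

Lemma tauE : tau l = ((l.-1)`!%:R ^- 2) *:
  \prod_(i < l.-1) ('X + ((i.+1%:Z * (l%:Z - i.+1%:Z))%:~R)%:P).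
Proof.
rewrite /tau; congr (_ *: _); apply: eq_bigr => i _; congr (_ + _%:P).
have hi : (i < l)%N by apply: leq_trans (ltn_ord i) (leq_pred l).
by rewrite subzn // -PoszM -pmulrn -(subSS i) prednK.
Qed.

(** Moving from weight -(l-1) to l-1 and back picks up the factor N + i (l - i)
    at each step, and tau is the product of these factors. *)
Lemma YsXs u : wk 0 u -> Ys (Xs u) = act (tau l) u.
Proof.
move=> hu; rewrite /Ys /Xs (linear_scale (iter_linear _ Y_lin)) XjYj // scalerA tauE pactZ.
congr (_ *: _); rewrite -invfM -expr2 -in_algE fmorphV rmorphXn rmorph_nat //.
Qed.

Lemma XsYs u : wk (l%:Z - 1) u -> Xs (Ys u) = act (tau l) u.
Proof. by move=> /Xs_surj[w hw <-]; rewrite YsXs // act_Xs. Qed.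

Section WithConj.
Variable c : P -> P.
Hypotheses (cD : {morph c : u v / u + v}) (cZ : forall a u, c (a *: u) = conjQ a *: c u)
  (cX : forall u, c (X u) = Y (c u)) (cY : forall u, c (Y u) = X (c u))
  (cK : involutive c).

Lemma c_H u : c (H u) = - H (c u).
Proof. by rewrite -!(hc_XY hP) cD (morph_addN cD) !(cX, cY) opprB. Qed.

Lemma wt_c n u : wt H n u -> wt H (- n) (c u).
Proof.
move=> hu; have := c_H u; rewrite hu cZ rmorph_int => e.
by rewrite /wt -[LHS]opprK -e rmorphN scaleNr.
Qed.

Lemma c_N u : c (N u) = N (c u).
Proof.
rewrite /nilop /casimir !(cD, morph_addN cD, cZ, c_H, cX, cY) !rmorphXn !fmorphV !rmorph_nat.
rewrite (linear_opp H_lin) (_ : Y (X (c u)) = X (Y (c u)) - H (c u)); last first.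
  by rewrite -(hc_XY hP) opprB addrC subrK.
by lmodule Qi.
Qed.

Lemma c_act p u : c (act p u) = act p (c u).
Proof.
apply: (@pact_morph _ _ _ _ conjQ) => // i.
by elim: i => [//|i IH]; rewrite !iterS c_N IH.
Qed.

Lemma c_Xs u : c (Xs u) = Ys (c u).
Proof.
rewrite /Xs /Ys cZ fmorphV rmorph_nat; congr (_ *: _).
by elim: l.-1 => [//|j IH]; rewrite !iterS cX IH.
Qed.
Lemma c_Ys u : c (Ys u) = Xs (c u).
Proof. by rewrite -{1}[u]cK -c_Xs cK. Qed.

Variables (m : nat) (s : {poly rat}).
Hypotheses (Nm : forall u, iter m N u = 0) (hs : inv_sqrt m (tau l) s).

(** The involution of the quiver, with the eventual values of the stabilization
    already expressed by an inverse square root s of tau. *)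
Definition var_plus u := c (act s u).
Definition var_minus u := c (act (tau l * s) u).
Definition var_star u := c (Xs (act s u)).

Lemma act_inv u : act (tau l * s) (act s u) = u.
Proof.
rewrite -pactM // -[RHS](pact1 N u); apply: (pact_mod N_lin u Nm).
by rewrite -mulrA -expr2; exact: hs.2.
Qed.

(** The involution property is where s ^ 2 tau = 1 is used. *)
Lemma var_plusK u : var_minus (var_plus u) = u.
Proof. by rewrite /var_minus /var_plus -c_act cK act_inv. Qed.
Lemma var_minusK u : var_plus (var_minus u) = u.
Proof. by rewrite /var_minus /var_plus -c_act cK pact_comm // act_inv. Qed.
Lemma var_starK u : wk 0 u -> var_star (var_star u) = u.
Proof.
move=> hu; rewrite /var_star c_Xs c_act cK -act_Xs YsXs; last exact/wt_act/wt_act.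
by rewrite -pactM // act_inv.
Qed.

Lemma var_a_plus u w : wk 0 w -> Xs w = Y u -> X (var_plus u) = var_star w.
Proof. by move=> hw e; rewrite /var_star act_Xs e -act_Y cY. Qed.
Lemma var_a_minus u : wk (-1) u -> Xs (var_star (X u)) = Y (var_minus u).
Proof.
move=> hu; have hX : wk 0 (X u) by have := wk_X hP hu; rewrite addNr.
rewrite /var_star /var_minus -c_Ys YsXs; last exact: wt_act.
by rewrite -pactM // -act_X cX.
Qed.
Lemma var_b_minus u : Y (var_star u) = var_plus (X (Xs u)).
Proof. by rewrite /var_star /var_plus -cX act_Xs act_X. Qed.
Lemma var_b_plus u : wk 0 u -> X (Xs (var_star u)) = var_minus (Y u).
Proof.
move=> hu; rewrite /var_star /var_minus -c_Ys YsXs; last exact: wt_act.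
by rewrite -pactM // -cY act_Y.
Qed.
End WithConj.

(** Both loops at the middle vertex are N. *)
Lemma base_relation u w : wk 0 u -> wk 0 w -> Xs w = Y (X (Xs u)) -> X (Y u) = w.
Proof.
move=> hu hw e; have e1 : X (Y u) = N u by rewrite (XY_wk hP hu) mul0r scale0r addr0.
apply: Xs_inj2 => //; first by rewrite e1; apply: wt_N.
rewrite e (YX_wk hP (wk_Xs hu)) subrK subrr mulr0 scale0r addr0 e1.
by rewrite -(pactX N_lin u) -(pactX N_lin (Xs u)) act_Xs.
Qed.
End QuiverIn.

(** * The assignment on objects *)

Lemma weight_val_linear (M : gkmod) n : linear (@weight_val M n).
Proof. by move=> a u v; rewrite -[LHS]/(\val _) linearP. Qed.

Lemma weight_eq (M : gkmod) n (u v : weight M n) :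
  weight_val u = weight_val v -> u = v.
Proof. exact: val_inj. Qed.

Lemma weight_wt (M : gkmod) n (u : weight M n) : wt (@opH M) n (weight_val u).
Proof. exact/eqP/weightP. Qed.

Lemma wmap_val (M N : gkmod) m n (f : ext M -> ext N) (u : weight M m) :
  wt (@opH N) n (f (weight_val u)) ->
  weight_val (wmap f u : weight N n) = f (weight_val u).
Proof. by move=> h; apply: insubdK; apply/eqP. Qed.

Lemma weight_of (M : gkmod) n (u : ext M) : wt (@opH M) n u ->
  exists w : weight M n, weight_val w = u.
Proof. by move=> /eqP h; exists (Weight h). Qed.

Lemma minvE (U V : choiceType) (u0 : U) (f : U -> V) v w :
  f w = v -> (forall w', f w' = v -> w' = w) -> minv u0 f v = w.
Proof. by move=> h1 h2; rewrite /minv; case: xgetP => [w' _ /h2//|/(_ w)]. Qed.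

Lemma eventual_valueE (U : Type) (V : lmodType Qi) (s : nat -> U -> V) u v m :
  (forall k, (m <= k)%N -> s k u = v) -> eventual_value s u = v.
Proof.
move=> h; rewrite /eventual_value; case: xgetP => [w _ [n hn]|/(_ v)[]]; last by exists m.
by rewrite -(hn (maxn m n)) ?leq_maxr // h // leq_maxl.
Qed.

Lemma widx_plus l : l%:Z + 1 = widx l l%:Z. Proof. by rewrite /widx; ring. Qed.
Lemma widx_minus l : - (l%:Z + 1) = widx l (-1). Proof. by rewrite /widx; ring. Qed.
Lemma widx_star l : - (l%:Z - 1) = widx l 0. Proof. by rewrite /widx; ring. Qed.
Lemma widx_top l : l%:Z - 1 = widx l (l%:Z - 1). Proof. by rewrite /widx; ring. Qed.

Definition vidx (l : nat) (v : vertex) : int :=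
  match v with vminus => -1 | vstar => 0 | vplus => l%:Z end.
Lemma vweightE l v : vweight l v = widx l (vidx l v).
Proof. by case: v; [exact: widx_minus|exact: widx_star|exact: widx_plus]. Qed.

Section Object.
Variables (l : nat) (M : gkmod).
Hypotheses (l_gt0 : (0 < l)%N) (hM : is_HC l (l%:R ^+ 2) M).
Local Notation p := (l%:Z + 1).
Local Notation q := (l%:Z - 1).
Local Notation N := (nilop l (@opH M) (@opX M) (@opY M)).
Local Notation act := (pact N).
Local Notation XS := (Xs l (@opX M)).
Local Notation YS := (Ys l (@opY M)).
Local Notation wk k := (wt (@opH M) (widx l k)).
Local Notation c := (@opc M).
Let hP := gk_hcmod l_gt0 hM.
Let N_lin : linear N := nilop_lin hP.

Lemma wk_minus (u : weight M (- p)) : wk (-1) (weight_val u).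
Proof. by rewrite -widx_minus; exact: weight_wt. Qed.
Lemma wk_star (u : weight M (- q)) : wk 0 (weight_val u).
Proof. by rewrite -widx_star; exact: weight_wt. Qed.
Lemma wk_top (u : weight M q) : wk (l%:Z - 1) (weight_val u).
Proof. by rewrite -widx_top; exact: weight_wt. Qed.

Lemma X_star_val (u : weight M (- q)) : weight_val (X_star u) = XS (weight_val u).
Proof.
apply: (wmap_val (N := M) (n := q) (f := XS)).
by have := wk_Xs l_gt0 hP (wk_star u); rewrite -widx_top.
Qed.

Lemma wt_opc n u : wt (@opH M) n u -> wt (@opH M) (- n) (c u).
Proof. exact: (wt_c hP (@opcD M) (@opcZ M) (@opc_X M) (@opc_Y M)). Qed.

Lemma conjw_val m n (u : weight M m) : n = - m ->
  weight_val (conjw n u) = c (weight_val u).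
Proof. by move=> e; apply: wmap_val; rewrite e; apply: wt_opc; exact: weight_wt. Qed.

Lemma T_minus_val (u : weight M (- p)) :
  weight_val (T_minus u) = act (tau l) (weight_val u).
Proof.
pose F := fun (j : nat) (v : ext M) => opC v - ((l%:Z - 2 - 2 * j%:Z) ^+ 2)%:~R *: v.
pose G (j : nat) : {poly rat} := 'X + (((j.+1 * (l.-1 - j))%N)%:R)%:P.
have FE j v : (j < l.-1)%N -> F j v = act (4 *: G j) v.
  move=> hj; rewrite pactZ pactD (pactX N_lin) pactC /F (opCE l) -!in_algE !rmorph_nat.
  have -> : (l.-1 - j = l - j.+1)%N by rewrite -(subSS j) prednK.
  have hj' : (j.+1 <= l)%N by apply: leq_trans hj (leq_pred l).
  have -> : ((j.+1 * (l - j.+1))%N%:R : Qi) = j.+1%:R * (l%:R - j.+1%:R).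
    by rewrite natrM natrB.
  rewrite -[j.+1]addn1 natrD.
  by rewrite -[opN l v]/(N v); lmodule Qi.
have FK s v : all (fun j => j < l.-1)%N s ->
    foldr F v s = act (\prod_(j <- s) (4 *: G j)) v.
  elim: s => [|j s IH] /=; first by rewrite big_nil pact1.
  by case/andP=> hj /IH ->; rewrite FE // big_cons (pactM N_lin).
have hfold v : ((4 ^+ l.-1)^-1 * gamma_star l ^- 2) *: foldr F v (iota 0 l.-1) = act (tau l) v.
  rewrite FK; last by apply/allP => j; rewrite mem_iota.
  have -> : iota 0 l.-1 = index_iota 0 l.-1 by rewrite /index_iota subn0.
  rewrite big_mkord scaler_prod prodr_const card_ord pactZ /tau pactZ.
  rewrite scalerA -!in_algE fmorphV !rmorphXn !rmorph_nat /gamma_star.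
  by congr (_ *: _); rewrite mulrAC mulVf ?mul1r // expf_neq0 // natQ_eq0.
rewrite -hfold; apply: (wmap_val (N := M) (n := - p)
  (f := fun u => ((4 ^+ l.-1)^-1 * gamma_star l ^- 2) *: foldr F u (iota 0 l.-1))).
by rewrite hfold; apply: (wt_act hP); exact: weight_wt.
Qed.

Variables (m : nat).
Hypotheses (m_gt0 : (0 < m)%N) (Nm : forall u : ext M, iter m N u = 0).

Let actK a b : 'X^m %| a * b - 1 -> forall u, act a (act b u) = u.
Proof.
move=> h u; rewrite -(pactM N_lin) -[RHS](pact1 N u).
exact: (pact_mod N_lin u Nm).
Qed.

Let c_actM a u : c (act a u) = act a (c u).
Proof. exact: (c_act hP (@opcD M) (@opcZ M) (@opc_X M) (@opc_Y M)). Qed.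

Let YsXsM u : wk 0 u -> YS (XS u) = act (tau l) u.
Proof. exact: (YsXs l_gt0 hP). Qed.

Let act_XsM a u : XS (act a u) = act a (XS u).
Proof. exact: (act_Xs hP). Qed.

Let c_XsM u : c (XS u) = YS (c u).
Proof. exact: (c_Xs l (@opcZ M) (@opc_X M)). Qed.

Let XsYsM u : wk (l%:Z - 1) u -> XS (YS u) = act (tau l) u.
Proof. exact: (XsYs l_gt0 hP). Qed.

(** The whole stabilization takes place in the commutative ring of
    polynomials in N: its terms are a(N), tau(N) a(N) and X_star a(N) for the
    Newton iterates a of the inverse square root of tau. *)
Lemma stab_poly k : exists a : {poly rat},
  [/\ a.[0] = 1, 'X^(minn m k.+1) %| tau l * a ^+ 2 - 1,
   forall u : weight M p, weight_val (stab_plus k u) = act a (weight_val u),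
   forall u : weight M (- p), weight_val (stab_minus k u) = act (tau l * a) (weight_val u)
   & forall u : weight M (- q), weight_val (stab_star k u) = XS (act a (weight_val u))].
Proof.
elim: k => [|k [a [ha hk hp hm hs]]].
  exists 1; split.
  - by rewrite hornerC.
  - rewrite (minn_idPr _) // expr1n mulr1 expr1 -['X]subr0 -polyC0 dvdp_XsubCl.
    by rewrite /root hornerD hornerN tau_at0 hornerC subrr.
  - by move=> u; rewrite pact1.
  - by move=> u; rewrite mulr1; exact: T_minus_val.
  - by move=> u; rewrite pact1; exact: X_star_val.
have [b hb] : exists b, 'X^m %| tau l * a * b - 1.
  by apply: inv_modX; rewrite hornerM tau_at0 ha mulr1 oner_neq0.
have hb' : 'X^m %| b * (tau l * a) - 1 by rewrite mulrC.
have hb2 : 'X^m %| a * (tau l * b) - 1 by rewrite mulrCA mulrA.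
have hb2' : 'X^m %| tau l * b * a - 1 by rewrite -mulrA [b * a]mulrC mulrA.
have hb0 : b.[0] = 1 by apply: (inv_modX_at0 m_gt0 hb); rewrite hornerM tau_at0 ha mulr1.
have pE : p = - - p by rewrite opprK.
have valD n (u v : weight M n) : weight_val (2^-1 *: (u + v)) = 2^-1 *: (weight_val u + weight_val v).
  by rewrite (linear_scale (@weight_val_linear M n)) (linear_add (@weight_val_linear M n)).
have half x y u : 2^-1 *: (act x u + act y u) = act (2^-1 *: (x + y)) u.
  by rewrite pactZ pactD -in_algE fmorphV rmorph_nat.
exists (2^-1 *: (a + b)); split.
- by rewrite hornerZ hornerD ha hb0.
- exact: newton_step.
- move=> u; rewrite -half -hp valD; congr (_ *: (_ + _)).
  have [w hw] := weight_of (wt_act hP b (weight_wt u)).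
  have fE (v : weight M p) : weight_val (conjw p (stab_minus k (conjw (- p) v))) =
      act (tau l * a) (weight_val v).
    by rewrite (conjw_val _ pE) hm (conjw_val _ (erefl _)) c_actM opcK.
  rewrite (@minvE _ _ 0 _ u w) // => [|w' hw']; apply: weight_eq.
    by rewrite /= fE hw actK.
  by rewrite hw -hw' /= fE actK.
- move=> u; rewrite -scalerAr mulrDr -half -hm valD; congr (_ *: (_ + _)).
  have [w hw] := weight_of (wt_act hP (tau l * b) (weight_wt u)).
  have fE (v : weight M (- p)) : weight_val (conjw (- p) (stab_plus k (conjw p v))) =
      act a (weight_val v).
    by rewrite (conjw_val _ (erefl _)) hp (conjw_val _ pE) c_actM opcK.
  rewrite (@minvE _ _ 0 _ u w) // => [|w' hw']; apply: weight_eq.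
    by rewrite /= fE hw actK.
  by rewrite hw -hw' /= fE actK.
- move=> u; rewrite -half (linear_scale (Xs_lin hP)) (linear_add (Xs_lin hP)) -hs valD.
  congr (_ *: (_ + _)).
  have hXb : wt (@opH M) q (XS (act b (weight_val u))).
    by have := wk_Xs l_gt0 hP (wt_act hP b (wk_star u)); rewrite -widx_top.
  have [w hw] := weight_of hXb.
  have fE (v : weight M q) : weight_val (conjw (- q) (stab_star k (conjw (- q) v))) =
      YS (act a (weight_val v)).
    rewrite (conjw_val _ (erefl _)) hs (conjw_val _ (erefl _)).
    apply: etrans (c_XsM _) (congr1 YS _).
    exact: etrans (c_actM a _) (congr1 (act a) (opcK (weight_val v))).
  rewrite (@minvE _ _ 0 _ u w) // => [|w' hw']; apply: weight_eq.
    rewrite /= fE hw -act_XsM YsXsM; last by apply/(wt_act hP)/(wt_act hP)/wk_star.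
    by rewrite -(pactM N_lin) actK.
  rewrite hw -hw' /= fE act_XsM XsYsM; last by apply: (wt_act hP); exact: wk_top.
  by rewrite -(pactM N_lin (tau l)) actK.
Qed.

(** After m steps the iterate agrees with s modulo X^m, and N^m = 0. *)
Lemma stab_eventually s k : inv_sqrt m (tau l) s -> (m <= k)%N ->
  [/\ forall u : weight M p, weight_val (stab_plus k u) = act s (weight_val u),
   forall u : weight M (- p), weight_val (stab_minus k u) = act (tau l * s) (weight_val u)
   & forall u : weight M (- q), weight_val (stab_star k u) = XS (act s (weight_val u))].
Proof.
move=> hs hk; have [a [ha hd hp hm hq]] := stab_poly k.
rewrite (minn_idPl (leqW hk)) in hd.
have e u : act a u = act s u.
  exact: (pact_mod N_lin u Nm (inv_sqrt_uniq (tau_at0 l) (conj ha hd) hs)).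
split=> u; first by rewrite hp (e (weight_val u)).
- by rewrite hm !(pactM N_lin) e.
- exact: etrans (hq u) (congr1 XS (e (weight_val u))).
Qed.

Lemma wmap_opX n (u : weight M n) : weight_val (wmap (@opX M) u : weight M (n + 2)) = opX (weight_val u).
Proof.
apply: wmap_val; rewrite /wt (op_HX (weight_val u)) weight_wt (linear_scale (@opX_lin M)).
by rewrite -scalerDl rmorphD.
Qed.

Lemma wmap_opY n (u : weight M n) : weight_val (wmap (@opY M) u : weight M (n - 2)) = opY (weight_val u).
Proof.
apply: wmap_val; rewrite /wt (op_HY (weight_val u)) weight_wt (linear_scale (@opY_lin M)).
by rewrite -scalerBl rmorphB.
Qed.

Lemma wmap_opX' n n' (u : weight M n) : n' = n + 2 ->
  weight_val (wmap (@opX M) u : weight M n') = opX (weight_val u).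
Proof. by move=> ->; exact: wmap_opX. Qed.

Lemma wmap_opY' n n' (u : weight M n) : n' = n - 2 ->
  weight_val (wmap (@opY M) u : weight M n') = opY (weight_val u).
Proof. by move=> ->; exact: wmap_opY. Qed.

Lemma E_a_minus (u : weight M (- p)) :
  weight_val (E_phi a_minus u) = opX (weight_val u).
Proof. by apply: wmap_opX'; rewrite /=; ring. Qed.

Lemma E_b_minus (u : weight M (- q)) :
  weight_val (E_phi b_minus u) = opY (weight_val u).
Proof. by apply: wmap_opY'; rewrite /=; ring. Qed.

Lemma E_b_plus (u : weight M (- q)) :
  weight_val (E_phi b_plus u) = opX (XS (weight_val u)).
Proof. by rewrite -X_star_val; apply: wmap_opX'; rewrite /=; ring. Qed.

Lemma X_star_inj : injective (@X_star l M).
Proof.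
move=> u v /(congr1 (@weight_val M _)); rewrite !X_star_val => e.
by apply: weight_eq; apply: (Xs_inj2 l_gt0 hP) e; exact: wk_star.
Qed.

Lemma X_star_surj v : exists w, @X_star l M w = v.
Proof.
have [w hw e] := Xs_surj l_gt0 hP (wk_top v).
have hw' : wt (@opH M) (- q) w by rewrite widx_star.
have [w' ew] := weight_of hw'; exists w'.
by apply: weight_eq; rewrite X_star_val ew.
Qed.

Lemma E_a_plus (u : weight M p) :
  XS (weight_val (E_phi a_plus u)) = opY (weight_val u).
Proof.
rewrite -X_star_val.
have [w hw] := X_star_surj (wmap (@opY M) u).
have -> : E_phi a_plus u = w.
  by apply: minvE => // w' hw'; apply: X_star_inj; rewrite hw'.
by rewrite hw; apply: wmap_opY'; rewrite /=; ring.
Qed.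

Section Var.
Variable s : {poly rat}.
Hypothesis hs : inv_sqrt m (tau l) s.
Let ev k (hk : (m <= k)%N) := stab_eventually hs hk.

Lemma E_var_plus (u : weight M p) :
  weight_val (@E_var l M vplus u) = var_plus l (@opH M) (@opX M) (@opY M) c s (weight_val u).
Proof.
rewrite /= (conjw_val _ (erefl _)); congr (c _).
have [w hw] := weight_of (wt_act hP s (weight_wt u)).
rewrite (@eventual_valueE _ _ _ _ w m) // => k /ev[h _ _].
by apply: weight_eq; rewrite h hw.
Qed.

Lemma E_var_minus (u : weight M (- p)) :
  weight_val (@E_var l M vminus u) = var_minus l (@opH M) (@opX M) (@opY M) c s (weight_val u).
Proof.
rewrite /= (conjw_val _ (esym (opprK _))); congr (c _).
have [w hw] := weight_of (wt_act hP (tau l * s) (weight_wt u)).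
rewrite (@eventual_valueE _ _ _ _ w m) // => k /ev[_ h _].
by apply: weight_eq; rewrite h hw.
Qed.

Lemma E_var_star (u : weight M (- q)) :
  weight_val (@E_var l M vstar u) = var_star l (@opH M) (@opX M) (@opY M) c s (weight_val u).
Proof.
rewrite /= (conjw_val _ (erefl _)); congr (c _).
have hu : wt (@opH M) q (XS (act s (weight_val u))).
  by have := wk_Xs l_gt0 hP (wt_act hP s (wk_star u)); rewrite -widx_top.
have [w hw] := weight_of hu.
rewrite (@eventual_valueE _ _ _ _ w m) // => k /ev[_ _ h].
by apply: weight_eq; exact: etrans (h u) (esym hw).
Qed.
End Var.
End Object.

Section Intertwiner.
Variables (l : nat) (P Q : lmodType Qi).
Variables (HP XP YP : P -> P) (HQ XQ YQ : Q -> Q).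
Hypotheses (hP : hcmod l HP XP YP) (hQ : hcmod l HQ XQ YQ).
Variables (f : P -> Q).
Hypotheses (f_lin : linear f) (fX : forall u, f (XP u) = XQ (f u))
  (fY : forall u, f (YP u) = YQ (f u)).

Lemma int_H u : f (HP u) = HQ (f u).
Proof.
by rewrite -(hc_XY hP) -(hc_XY hQ) (linear_add f_lin) (linear_opp f_lin) !(fX, fY).
Qed.

Lemma int_wt n u : wt HP n u -> wt HQ n (f u).
Proof. by move=> hu; rewrite /wt -int_H hu (linear_scale f_lin). Qed.

Lemma int_N u : f (nilop l HP XP YP u) = nilop l HQ XQ YQ (f u).
Proof.
rewrite /nilop /casimir !(linear_scale f_lin, linear_add f_lin, linear_opp f_lin).
by rewrite !(int_H, fX, fY).
Qed.

Lemma int_act p u : f (pact (nilop l HP XP YP) p u) = pact (nilop l HQ XQ YQ) p (f u).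
Proof.
apply: (@pact_morph _ _ _ _ idfun); last exact: linear_scale f_lin.
- by elim=> [//|i IH]; rewrite !iterS int_N IH.
- exact: linear_add f_lin.
Qed.

Lemma int_Xs u : f (Xs l XP u) = Xs l XQ (f u).
Proof.
rewrite /Xs (linear_scale f_lin); congr (_ *: _).
by elim: l.-1 => [//|j IH]; rewrite !iterS fX IH.
Qed.
End Intertwiner.

Lemma bijective_of (U V : choiceType) (f : U -> V) :
  injective f -> (forall v, exists u, f u = v) -> bijective f.
Proof.
by move=> hi /choice[g hg]; exists g => // u; apply: hi; rewrite hg.
Qed.

Section ObjectWd.
Variables (l : nat) (M : gkmod).
Hypotheses (l_gt0 : (0 < l)%N) (hM : is_HC l (l%:R ^+ 2) M).
Local Notation p := (l%:Z + 1).
Local Notation q := (l%:Z - 1).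
Local Notation N := (nilop l (@opH M) (@opX M) (@opY M)).
Local Notation act := (pact N).
Local Notation XS := (Xs l (@opX M)).
Local Notation c := (@opc M).
Let hP := gk_hcmod l_gt0 hM.
Let N_lin : linear N := nilop_lin hP.

Lemma act_bij m n a (f : weight M n -> weight M n) :
  (forall u, iter m N u = 0) -> a.[0] != 0 ->
  (forall u, weight_val (f u) = act a (weight_val u)) -> bijective f.
Proof.
move=> Nm ha hf; have [b hb] := inv_modX m ha.
have ab u : act a (act b u) = u.
  by rewrite -(pactM N_lin) -[RHS](pact1 N u); exact: (pact_mod N_lin u Nm).
have ba u : act b (act a u) = u.
  by rewrite -(pactM N_lin) mulrC -[RHS](pact1 N u); exact: (pact_mod N_lin u Nm).
apply: bijective_of => [u v /(congr1 (@weight_val M n))|v].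
  by rewrite !hf => /(congr1 (act b)); rewrite !ba => /weight_eq.
have [w hw] := weight_of (wt_act hP b (weight_wt v)); exists w.
by apply: weight_eq; rewrite hf hw ab.
Qed.

Lemma E_object_wd_HC : E_object_wd l M.
Proof.
have [m [m0 Nm]] := HC_nil hM.
have [s hs] := inv_sqrt_exists m0 (tau_at0 l).
have ev k := stab_eventually l_gt0 hM m0 Nm (k := k) hs.
have tau0 : (tau l).[0] != 0 by rewrite tau_at0 oner_neq0.
split.
- move=> n u; apply/eqP; have := weight_wt (wmap (@opX M) u : weight M (n + 2)).
  by rewrite wmap_opX.
- move=> n u; apply/eqP; have := weight_wt (wmap (@opY M) u : weight M (n - 2)).
  by rewrite wmap_opY.
- move=> n u; apply/eqP; rewrite (opCE l).
  have hu := weight_wt u; apply: (wtD (@opH_lin M)); apply: (wtZ (@opH_lin M)).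
    exact: (wt_N hP hu).
  exact: hu.
- move=> n u; apply/eqP; exact: (wt_opc l_gt0 hM (weight_wt u)).
- by apply: bijective_of; [exact: X_star_inj|exact: X_star_surj].
- exact: (act_bij Nm tau0 (T_minus_val l_gt0 hM)).
- move=> k; have [a [ha _ h1 h2 h3]] := stab_poly l_gt0 hM m0 Nm k.
  have a0 : a.[0] != 0 by rewrite ha oner_neq0.
  have ta0 : (tau l * a).[0] != 0 by rewrite hornerM mulf_neq0.
  split; [exact: (act_bij Nm a0 h1)|exact: (act_bij Nm ta0 h2)|].
  pose g (u : weight M (- q)) : weight M (- q) := wmap (act a) u.
  have hg u : weight_val (g u) = act a (weight_val u).
    by apply: wmap_val; apply: (wt_act hP); exact: weight_wt.
  have e : stab_star k =1 @X_star l M \o g.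
    move=> u; apply: weight_eq; apply: etrans (h3 u) _.
    by rewrite /= (X_star_val l_gt0 hM) hg.
  apply: (eq_bij _ (fsym e)); apply: bij_comp (act_bij Nm a0 hg).
  by apply: bijective_of; [exact: X_star_inj|exact: X_star_surj].
- exists m => k hk u; have [h _ _] := ev k hk; have [h' _ _] := ev m (leqnn m).
  by apply: weight_eq; exact: etrans (h u) (esym (h' u)).
- exists m => k hk u; have [_ h _] := ev k hk; have [_ h' _] := ev m (leqnn m).
  by apply: weight_eq; exact: etrans (h u) (esym (h' u)).
- exists m => k hk u; have [_ _ h] := ev k hk; have [_ _ h'] := ev m (leqnn m).
  by apply: weight_eq; exact: etrans (h u) (esym (h' u)).
Qed.

Local Notation R := (E_data l M).

Lemma E_loop_minus (y : R vstar) :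
  weight_val (rphi a_minus (rphi b_minus y)) = N (weight_val y).
Proof.
rewrite (E_a_minus) (E_b_minus).
by have := XY_wk hP (wk_star y); rewrite mul0r scale0r addr0.
Qed.

Lemma E_loop_plus (y : R vstar) :
  weight_val (rphi a_plus (rphi b_plus y)) = N (weight_val y).
Proof.
have h := E_a_plus l_gt0 hM (rphi b_plus y); rewrite (E_b_plus l_gt0 hM) in h.
have <- := base_relation l_gt0 hP (wk_star y) (wk_star (rphi a_plus (rphi b_plus y))) h.
by have := XY_wk hP (wk_star y); rewrite mul0r scale0r addr0.
Qed.

Let divisible (j : nat) (z : R vstar) := exists y, weight_val z = iter j N y.
Let reached (j : nat) (w : vertex) : R w -> Prop :=
  match w return R w -> Prop with
  | vstar => divisible j
  | vplus => fun z => exists2 y, divisible j y & z = rphi b_plus y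
  | vminus => fun z => exists2 y, divisible j y & z = rphi b_minus y
  end.

(** A path returning j times to the middle vertex picks up N ^ j. *)
Lemma E_path_reached v w (pa : qpath v w) j x :
  (2 * j + (if w is vstar then 0 else 1) <= path_length pa)%N ->
  reached j (path_act pa x).
Proof.
elim: pa j x => {v w} [v|u v w a pa IH] j x /=.
  by case: v x => x; rewrite ?addn1 // addn0 leqn0 muln_eq0 /= => /eqP ->; exists (weight_val x).
case: a pa IH => pa IH h /=.
- case: j h => [|j] h; first by exists (weight_val (rphi a_plus (path_act pa x))).
  have [|z [y ey] ->] := IH j x; first by move: h; rewrite addn0 mulnS addn1.
  by exists y; rewrite E_loop_plus ey iterS.
- case: j h => [|j] h; first by exists (weight_val (rphi a_minus (path_act pa x))).
  have [|z [y ey] ->] := IH j x; first by move: h; rewrite addn0 mulnS addn1.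
  by exists y; rewrite E_loop_minus ey iterS.
- by exists (path_act pa x) => //; apply: IH; move: h; rewrite addn1 addn0.
- by exists (path_act pa x) => //; apply: IH; move: h; rewrite addn1 addn0.
Qed.

Lemma E_phi_linear v w (a : arrow v w) : linear (@rphi R v w a).
Proof.
have L n := @weight_val_linear M n.
case: a => b u v'; apply: weight_eq; rewrite L.
- apply: (Xs_inj2 l_gt0 hP); first exact: (wk_star (@rphi R _ _ a_plus (b *: u + v'))).
    have h (x : R vplus) := wk_star (rphi a_plus x).
    by apply: (wtD (@opH_lin M)) => //; apply: (wtZ (@opH_lin M)).
  rewrite (Xs_lin hP) [LHS](E_a_plus l_gt0 hM) L (@opY_lin M).
  by congr (_ *: _ + _); exact/esym/(E_a_plus l_gt0 hM).
- rewrite [LHS](E_a_minus) L (@opX_lin M).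
  by congr (_ *: _ + _); exact/esym/(E_a_minus).
- rewrite [LHS](E_b_plus l_gt0 hM) L (Xs_lin hP) (@opX_lin M).
  by congr (_ *: _ + _); exact/esym/(E_b_plus l_gt0 hM).
- rewrite [LHS](E_b_minus) L (@opY_lin M).
  by congr (_ *: _ + _); exact/esym/(E_b_minus).
Qed.

Lemma E_nil_rep : is_nil_rep R.
Proof.
have [m [m0 Nm]] := HC_nil hM.
have [s hs] := inv_sqrt_exists m0 (tau_at0 l).
have vp := E_var_plus l_gt0 hM m0 Nm hs; have vm := E_var_minus l_gt0 hM m0 Nm hs.
have vs := E_var_star l_gt0 hM m0 Nm hs.
have L n := @weight_val_linear M n.
have semi (T : ext M -> ext M) : linear T -> forall a u v, c (T (a *: u + v)) = conjQ a *: c (T u) + c (T v).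
  by move=> hT a u v; rewrite hT opcD opcZ.
have sl : linear (fun u => XS (act s u)).
  by move=> a u v; rewrite (pact_lin N_lin) (Xs_lin hP).
split.
- by case; exact: HC_finite hM _.
- exact: E_phi_linear.
- by move=> x; apply: weight_eq; rewrite E_loop_plus; exact: E_loop_minus.
- case=> a x y; apply: weight_eq; rewrite L.
  + apply: etrans (vm _) _; rewrite L.
    apply: etrans (semi _ (pact_lin N_lin _) a _ _) _.
    by congr (_ *: _ + _); exact/esym/vm.
  + apply: etrans (vs _) _; rewrite L.
    apply: etrans (semi _ sl a _ _) _.
    by congr (_ *: _ + _); exact/esym/vs.
  + apply: etrans (vp _) _; rewrite L.
    apply: etrans (semi _ (pact_lin N_lin _) a _ _) _.
    by congr (_ *: _ + _); exact/esym/vp.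
- move=> x; apply: weight_eq; apply: etrans (vm _) _.
  apply: etrans (congr1 _ (vp x)) _.
  exact: (var_plusK hP (@opcD M) (@opcZ M) (@opc_X M) (@opc_Y M) (@opcK M) Nm hs).
- move=> x; apply: weight_eq; apply: etrans (vp _) _.
  apply: etrans (congr1 _ (vm x)) _.
  exact: (var_minusK hP (@opcD M) (@opcZ M) (@opc_X M) (@opc_Y M) (@opcK M) Nm hs).
- move=> x; apply: weight_eq; apply: etrans (vs _) _.
  apply: etrans (congr1 _ (vs x)) _.
  exact: (var_starK l_gt0 hP (@opcD M) (@opcZ M) (@opc_X M) (@opc_Y M) (@opcK M) Nm hs (wk_star x)).
- move=> v w [] x; apply: weight_eq.
  + apply: etrans (E_a_minus _) _; apply: etrans (congr1 _ (vp x)) _.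
    apply: etrans (esym (vs _)).
    exact: (var_a_plus hP (@opc_Y M) s (wk_star _) (E_a_plus l_gt0 hM x)).
  + apply: (Xs_inj2 l_gt0 hP); [exact: (wk_star (@rphi R _ _ a_plus (rvar R vminus x)))|
      exact: (wk_star (rvar R vstar (@rphi R _ _ a_minus x)))|].
    apply: etrans (E_a_plus l_gt0 hM _) _; apply: etrans (congr1 _ (vm x)) _.
    apply: etrans (congr1 _ (esym (vs _))).
    apply: etrans (congr1 _ (congr1 _ (esym (E_a_minus _)))).
    exact/esym/(var_a_minus l_gt0 hP (@opcZ M) (@opc_X M) (@opcK M) s (wk_minus x)).
  + apply: etrans (E_b_minus _) _; apply: etrans (congr1 _ (vs x)) _.
    apply: etrans (esym (vp _)); apply: etrans (congr1 _ (esym (E_b_plus l_gt0 hM _))).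
    exact: (var_b_minus hP (@opc_X M) s).
  + apply: etrans (E_b_plus l_gt0 hM _) _; apply: etrans (congr1 _ (congr1 _ (vs x))) _.
    apply: etrans (esym (vm _)); apply: etrans (congr1 _ (esym (E_b_minus _))).
    exact: (var_b_plus l_gt0 hP (@opcZ M) (@opc_X M) (@opc_Y M) (@opcK M) s (wk_star x)).
- exists (2 * m + 1)%N => v w pa hpa x.
  have h : reached m (path_act pa x).
    by apply: E_path_reached; apply: leq_trans hpa; case: w {pa x}; rewrite leq_add2l.
  have div0 z : divisible m z -> z = 0.
    by case=> y ey; apply: weight_eq; rewrite ey Nm.
  case: w pa hpa h => pa hpa /= => [[y /div0 -> ->]|/div0//|[y /div0 -> ->]].
    exact: linear_zero (E_phi_linear b_minus).
  exact: linear_zero (E_phi_linear b_plus).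
Qed.
End ObjectWd.

(** * Morphisms of (g, K)-modules *)

Section ReIm.
Variable M : lmodType rat.

Let bre (a : Qi) (m : M) : M := reQ a *: m.
Let bim (a : Qi) (m : M) : M := imagQ a *: m.
Fact bre_bilinear : qbilinear (A := Qi) bre.
Proof.
split=> [m q a b|a q m n]; rewrite /bre; first by rewrite reQ_linear scalerDl scalerA.
by rewrite scalerDr !scalerA mulrC.
Qed.
Fact bim_bilinear : qbilinear (A := Qi) bim.
Proof.
split=> [m q a b|a q m n]; rewrite /bim; first by rewrite imagQ_linear scalerDl scalerA.
by rewrite scalerDr !scalerA mulrC.
Qed.

Definition tens_re : tens Qi M -> M := tens_lift bre.
Definition tens_im : tens Qi M -> M := tens_lift bim.

Lemma tens_reD : {morph tens_re : u v / u + v}.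
Proof. exact: tens_liftD bre_bilinear. Qed.
Lemma tens_imD : {morph tens_im : u v / u + v}.
Proof. exact: tens_liftD bim_bilinear. Qed.
Lemma tens_re_pure a m : tens_re (pure a m) = reQ a *: m.
Proof. exact: tens_lift_pure _ _ bre_bilinear. Qed.
Lemma tens_im_pure a m : tens_im (pure a m) = imagQ a *: m.
Proof. exact: tens_lift_pure _ _ bim_bilinear. Qed.
Lemma tens_re1 m : tens_re (pure 1 m) = m.
Proof. by rewrite tens_re_pure scale1r. Qed.

Lemma tens_reimE u : u = pure 1 (tens_re u) + imQ *: pure 1 (tens_im u).
Proof.
move: u; apply: tens_ext => [//|u v|a m].
  by rewrite tens_reD tens_imD !pureDr scalerDr addrACA.
rewrite tens_re_pure tens_im_pure !pureZr scalerA -scalerDl -pureE.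
by rewrite [imQ * _]mulrC -QiE.
Qed.

Lemma pure1_inj : injective (@pure Qi M 1).
Proof. by move=> m n e; rewrite -[m]tens_re1 e tens_re1. Qed.
End ReIm.

Lemma opc_pure (M : gkmod) m : opc (pure 1 m : ext M) = pure 1 m.
Proof.
by rewrite /opc (tens_map_pure conjQ_linear (@linear_id _ M)) rmorph1.
Qed.

Lemma opc_fixed (M : gkmod) (u : ext M) : opc u = u -> u = pure 1 (tens_re u).
Proof.
move=> e; rewrite {1}[u]tens_reimE; move: e; rewrite {1 2}[u]tens_reimE.
rewrite opcD opcZ !opc_pure conjQ_im => /addrI/eqP; rewrite -subr_eq0.
have -> : - imQ *: pure 1 (tens_im u) - imQ *: pure 1 (tens_im u) =
    (- 2 * imQ) *: pure 1 (tens_im u) by labstract; lmodule Qi.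
have i0 : imQ == 0 = false.
  by apply/eqP => h; have := imQ_sqr; rewrite h mul0r => /eqP; rewrite eq_sym oppr_eq0 oner_eq0.
by rewrite scaler_eq0 mulf_eq0 oppr_eq0 natQ_eq0 i0 /= => /eqP ->; rewrite scaler0 addr0.
Qed.

Section Complexification.
Variable A : comAlgType rat.
Definition cplx : comAlgType rat := quad (-1 : A).

Lemma cplx_of_exists : exists iF : {lrmorphism Qi -> cplx},
  forall z, iF z = ((reQ z)%:A, (imagQ z)%:A) :> quad (-1 : A).
Proof.
pose f (z : Qi) : cplx := (((reQ z)%:A, (imagQ z)%:A) : quad (-1 : A)).
have [iF h] : exists iF : {lrmorphism Qi -> cplx}, f =1 iF.
  apply: lrmorphism_of.
    move=> q x y; congr (_, _) => /=.
      by rewrite [reQ _]reQ_linear scalerDl scalerA.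
    by rewrite [imagQ _]imagQ_linear scalerDl scalerA.
  split; first by congr (_, _) => /=; rewrite ?scale1r ?scale0r.
  have algM (a b : rat) : (a * b)%:A = a%:A * b%:A :> A by rewrite mulr_algl scalerA.
  move=> [a b] [a' b']; congr (_, _) => /=.
    by rewrite [LHS]scalerBl !algM; ring.
  by rewrite [LHS]scalerDl !algM; ring.
by exists iF => z; rewrite -h.
Qed.

Definition cplx_in : {lrmorphism A -> cplx} := @quad_in A (-1).
Definition cplx_of : {lrmorphism Qi -> cplx} := projT1 (cid cplx_of_exists).
Lemma cplx_ofE z : cplx_of z = ((reQ z)%:A, (imagQ z)%:A) :> quad (-1 : A).
Proof. exact: (projT2 (cid cplx_of_exists) z). Qed.
Lemma cplx_of_im : cplx_of imQ = quad_gen (-1 : A).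
Proof. by rewrite cplx_ofE /= scale0r scale1r. Qed.
End Complexification.

(** Intertwiners for g are intertwiners for K: after adjoining i, the group
    acts on weight vectors by powers of z. *)
Lemma gkhom_of (M N : gkmod) (f : M -> N) :
  linear f -> (forall Z m, f (gk_g Z m) = gk_g Z (f m)) -> is_gkhom f.
Proof.
move=> lf hf; split=> // A g u.
pose F : ext M -> ext N := tens_map id f.
have F_lin : linear F by exact: tens_map_linear.
have FH v : F (opH v) = opH (F v).
  have FJ w : F (opJ w) = opJ (F w).
    move: w; apply: tens_ext => [x y|x y|a m].
    - by rewrite (linear_add (@opJ_lin M)) (linear_add F_lin).
    - by rewrite (linear_add F_lin) (linear_add (@opJ_lin N)).
    rewrite /F /opJ (tens_map_pure _ (act_linr _)) // (tens_map_pure _ lf) //.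
    by rewrite (tens_map_pure _ lf) // (tens_map_pure _ (act_linr _)) // hf.
  by rewrite !opH_J (linear_scale F_lin) FJ.
pose B := cplx A; pose iA := cplx_in A; pose iF := cplx_of A.
pose FB : tens B M -> tens B N := tens_map id f.
have FB_lin : linear FB by exact: tens_map_linear.
have iA_lin : linear iA by exact: linearP.
have inc (x : tens A M) : tens_map iA id (tens_map id f x) = FB (tens_map iA id x).
  move: x; apply: tens_ext => [x y|x y|a m] /=.
  - by rewrite (tens_mapD (@linear_id _ A) lf) tens_mapD.
  - by rewrite tens_mapD // (linear_add FB_lin).
  by rewrite (tens_map_pure _ lf) // !(tens_map_pure iA_lin) // /FB (tens_map_pure _ lf).
have FBJ v : FB (baseQ iF v) = baseQ iF (F v).
  move: v; apply: tens_ext => [x y|x y|a m].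
  - by rewrite baseQD (linear_add FB_lin).
  - by rewrite (linear_add F_lin) baseQD.
  rewrite /F (tens_map_pure _ lf) // !baseQ_pure (linear_scale FB_lin).
  by rewrite /FB (tens_map_pure _ lf).
apply: (@quad_incl_inj A (-1) N).
rewrite -[LHS]/(tens_map iA id _) -[RHS]/(tens_map iA id _).
rewrite (so2_rep_nat (gk_rep (gkP N))) !inc (so2_rep_nat (gk_rep (gkP M))).
move: (tens_map iA id u) => {}u; elim/(@baseQ_ind B iF M): u => [|x y hx hy|b v].
- by rewrite (morph_add0 (@gk_kD M B _)) !(linear_zero FB_lin) (morph_add0 (@gk_kD N B _)).
- by rewrite gk_kD !(linear_add FB_lin) gk_kD hx hy.
rewrite gk_kZ !(linear_scale FB_lin) gk_kZ; congr (_ *: _).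
move: v; apply: (wt_ext (@gk_weighted M)) => [x y|x y|n x hx].
- by rewrite baseQD gk_kD (linear_add FB_lin).
- by rewrite baseQD (linear_add FB_lin) gk_kD.
have hFx : wt (@opH N) n (F x) by rewrite /wt -FH hx (linear_scale F_lin).
by rewrite (gk_k_wt iF _ hx) (linear_scale FB_lin) !FBJ (gk_k_wt iF _ hFx).
Qed.

Section ExtMor.
Variables (M N : gkmod) (f : gkhom M N).
Definition gext : ext M -> ext N := tens_map id (gkhom_fun f).
Let lf : linear (gkhom_fun f). Proof. exact: gkhom_linear (gkhomP f). Qed.

Lemma gext_lin : linear gext. Proof. exact: tens_map_linear. Qed.

Lemma gext_act Z u : gext (tens_map id (gk_g Z) u) = tens_map id (gk_g Z) (gext u).
Proof.
move: u; apply: tens_ext => [x y|x y|a m].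
- by rewrite (linear_add (@tens_map_linear Qi M M _ (act_linr Z))) (linear_add gext_lin).
- by rewrite (linear_add gext_lin) (linear_add (@tens_map_linear Qi N N _ (act_linr Z))).
rewrite /gext (tens_map_pure _ (act_linr _)) // (tens_map_pure _ lf) //.
by rewrite (tens_map_pure _ lf) // (tens_map_pure _ (act_linr _)) // (gkhom_g (gkhomP f)).
Qed.

Lemma gext_H u : gext (opH u) = opH (gext u).
Proof.
by rewrite !opHE /opFm /opE /exF /exE (linear_scale gext_lin) (linear_add gext_lin) (linear_opp gext_lin) !gext_act.
Qed.
Lemma gext_X u : gext (opX u) = opX (gext u).
Proof.
by rewrite !opXE /opFm /opE /opD /exD /exE /exF !(linear_scale gext_lin, linear_add gext_lin) !gext_act.
Qed.
Lemma gext_Y u : gext (opY u) = opY (gext u).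
Proof.
rewrite !opYE /opFm /opE /opD /exD /exE /exF !(linear_scale gext_lin, linear_add gext_lin, linear_opp gext_lin).
by rewrite !gext_act.
Qed.

Lemma gext_c u : gext (opc u) = opc (gext u).
Proof.
move: u; apply: tens_ext => [x y|x y|a m].
- by rewrite opcD (linear_add gext_lin).
- by rewrite (linear_add gext_lin) opcD.
have P (M' : gkmod) := tens_map_pure conjQ_linear (@linear_id _ M').
by rewrite /opc /gext P !(tens_map_pure _ lf) // P.
Qed.

Lemma gext_pure m : gext (pure 1 m) = pure 1 (f m).
Proof. by rewrite /gext (tens_map_pure _ lf). Qed.

Lemma gext_wt n u : wt (@opH M) n u -> wt (@opH N) n (gext u).
Proof. by move=> hu; rewrite /wt -gext_H hu (linear_scale gext_lin). Qed.

Lemma E_mor_val l v (u : E_data l M v) : weight_val (E_mor l f v u) = gext (weight_val u).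
Proof. by apply: wmap_val; apply: gext_wt; exact: weight_wt. Qed.
End ExtMor.

Lemma gext_id (M : gkmod) u : gext (gkhom_id M) u = u.
Proof. exact: tens_map_id. Qed.
Lemma gext_comp (M N P : gkmod) (g : gkhom N P) (f : gkhom M N) u :
  gext (gkhom_comp g f) u = gext g (gext f u).
Proof.
exact: (tens_map_comp (gkhom_linear (gkhomP g)) (gkhom_linear (gkhomP f)) u).
Qed.

Section MorWd.
Variables (l : nat) (M N : gkmod).
Hypotheses (l_gt0 : (0 < l)%N) (hM : is_HC l (l%:R ^+ 2) M) (hN : is_HC l (l%:R ^+ 2) N).
Let cM := gk_hcmod l_gt0 hM.
Let cN := gk_hcmod l_gt0 hN.

Lemma HC_nil2 : exists m, [/\ (0 < m)%N,
  forall u : ext M, iter m (nilop l (@opH M) (@opX M) (@opY M)) u = 0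
  & forall u : ext N, iter m (nilop l (@opH N) (@opX N) (@opY N)) u = 0].
Proof.
have [m [m0 Nm]] := HC_nil hM; have [n [n0 Nn]] := HC_nil hN.
exists (m + n)%N; split=> [|u|u]; first by rewrite addn_gt0 m0.
- by rewrite iterD; exact: Nm.
- by rewrite addnC iterD; exact: Nn.
Qed.

Lemma E_mor_hom (f : gkhom M N) : @is_rephom (E_data l M) (E_data l N) (E_mor l f).
Proof.
have fl := gext_lin f; have fX := gext_X f; have fY := gext_Y f.
have [m [m0 Nm Nn]] := HC_nil2; have [s hs] := inv_sqrt_exists m0 (tau_at0 l).
have val v (u : E_data l M v) := E_mor_val f u.
have fXs := int_Xs l fl fX; have fact := int_act cM cN fl fX fY.
split.
- move=> v a u w; apply: weight_eq; rewrite weight_val_linear.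
  by apply: etrans (val _ _) _; rewrite weight_val_linear fl; congr (_ *: _ + _); exact/esym/val.
- move=> v w [] x; apply: weight_eq; apply: etrans (val _ _) _.
  + apply: (Xs_inj2 l_gt0 cN).
    * by apply: (int_wt cM cN fl fX fY); exact: (wk_star (@rphi (E_data l M) _ _ a_plus x)).
    * exact: (wk_star (@rphi (E_data l N) _ _ a_plus (E_mor l f _ x))).
    rewrite -fXs; apply: etrans (congr1 _ (E_a_plus l_gt0 hM x)) _.
    apply: etrans (fY _) _; apply: etrans (esym (E_a_plus l_gt0 hN _)).
    exact: congr1 _ (esym (val _ _)).
  + apply: etrans (congr1 _ (E_a_minus x)) _; apply: etrans (fX _) _.
    by apply: etrans (esym (E_a_minus _)); exact: congr1 _ (esym (val _ _)).
  + apply: etrans (congr1 _ (E_b_plus l_gt0 hM x)) _; apply: etrans (fX _) _.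
    apply: etrans (esym (E_b_plus l_gt0 hN _)); rewrite fXs.
    exact: (congr1 (fun z => opX (Xs l (@opX N) z)) (esym (val vstar x))).
  + apply: etrans (congr1 _ (E_b_minus x)) _; apply: etrans (fY _) _.
    by apply: etrans (esym (E_b_minus _)); exact: congr1 _ (esym (val _ _)).
- case=> x; apply: weight_eq; apply: etrans (val _ _) _.
  + apply: etrans (congr1 _ (E_var_minus l_gt0 hM m0 Nm hs x)) _.
    apply: etrans (esym (E_var_minus l_gt0 hN m0 Nn hs _)).
    apply: etrans (gext_c f _) (congr1 (@opc N) _); apply: etrans (fact _ _) _.
    exact: (congr1 (pact _ _) (esym (val vminus x))).
  + apply: etrans (congr1 _ (E_var_star l_gt0 hM m0 Nm hs x)) _.
    apply: etrans (esym (E_var_star l_gt0 hN m0 Nn hs _)).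
    apply: etrans (gext_c f _) (congr1 (@opc N) _); apply: etrans (fXs _) (congr1 (Xs l (@opX N)) _).
    apply: etrans (fact _ _) _.
    exact: (congr1 (pact _ _) (esym (val vstar x))).
  + apply: etrans (congr1 _ (E_var_plus l_gt0 hM m0 Nm hs x)) _.
    apply: etrans (esym (E_var_plus l_gt0 hN m0 Nn hs _)).
    apply: etrans (gext_c f _) (congr1 (@opc N) _); apply: etrans (fact _ _) _.
    exact: (congr1 (pact _ _) (esym (val vplus x))).
Qed.

(** A module is generated by the weight spaces of the vertices. *)
Lemma E_faithful (f g : gkhom M N) :
  (forall v (u : E_data l M v), E_mor l f v u = E_mor l g v u) -> f = g.
Proof.
move=> h; apply: gkhom_eq; apply/funext => m; apply: pure1_inj; rewrite -!gext_pure.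
have hv v (u : E_data l M v) : gext f (weight_val u) = gext g (weight_val u).
  by rewrite -!E_mor_val h.
apply: (hc_ext l_gt0 cM (XV := @opX N) (YV := @opY N)).
- exact: linear_add (gext_lin f).
- exact: linear_add (gext_lin g).
- exact: gext_X.
- exact: gext_X.
- exact: gext_Y.
- exact: gext_Y.
- by rewrite -widx_plus => u /weight_of[w <-]; exact: (hv vplus).
- by rewrite -widx_star => u /weight_of[w <-]; exact: (hv vstar).
- by rewrite -widx_minus => u /weight_of[w <-]; exact: (hv vminus).
Qed.
End MorWd.

Lemma E_wd_HC l : (0 < l)%N -> E_wd l (l%:R ^+ 2).
Proof.
move=> l_gt0; split.
- by move=> M; exact: E_object_wd_HC l_gt0 (HCP M).
- by move=> M; exact: E_nil_rep l_gt0 (HCP M).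
- by move=> M N f n u; apply/eqP; exact: (gext_wt f (weight_wt u)).
- by move=> M N f; exact: E_mor_hom l_gt0 (HCP M) (HCP N) f.
- by move=> M v u; apply: weight_eq; rewrite (E_mor_val (gkhom_id M)) gext_id.
- move=> M N P g f v u; apply: weight_eq; apply: etrans (E_mor_val _ _) _.
  apply: etrans (gext_comp g f _) _; rewrite /=.
  by apply: etrans (esym (E_mor_val _ _)); congr (gext g _); exact: esym (E_mor_val _ _).
Qed.

(** * Fullness *)

Section Full.
Variables (l : nat) (M N : gkmod).
Hypotheses (l_gt0 : (0 < l)%N) (hM : is_HC l (l%:R ^+ 2) M) (hN : is_HC l (l%:R ^+ 2) N).
Let cM := gk_hcmod l_gt0 hM.
Let cN := gk_hcmod l_gt0 hN.
Local Notation NM := (nilop l (@opH M) (@opX M) (@opY M)).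
Variable g : rephom (E_data l M) (E_data l N).
Let gL v : linear (g v). Proof. exact: rephom_linear (rephomP g) v. Qed.
Let gphi v w (a : arrow v w) x : g w (rphi a x) = rphi a (g v x).
Proof. exact: rephom_phi (rephomP g) _ _ a x. Qed.
Let gvar v x : g (cvertex v) (rvar (E_data l M) v x) = rvar (E_data l N) v (g v x).
Proof. exact: rephom_var (rephomP g) v x. Qed.

(* Off the weight space of the vertex the value is irrelevant. *)
Let lift v (u : ext M) : E_data l M v := insubd (0 : weight M (vweight l v)) u.
Let gext_at v (u : ext M) : ext N := weight_val (g v (lift v u)).

Let lift_val v u : wt (@opH M) (vweight l v) u -> weight_val (lift v u) = u.
Proof. by move=> h; apply: insubdK; apply/eqP. Qed.
Let liftK v (u : E_data l M v) : lift v (weight_val u) = u.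
Proof. by apply: weight_eq; apply: lift_val; exact: weight_wt. Qed.
Let gext_at_val v (u : E_data l M v) : gext_at v (weight_val u) = weight_val (g v u).
Proof. by rewrite /gext_at liftK. Qed.

Let at_vertex v (u : ext M) : wt (@opH M) (widx l (vidx l v)) u ->
  exists u' : E_data l M v, weight_val u' = u.
Proof. by rewrite -vweightE => /weight_of. Qed.

Let gext_semilinear v : semilinear_on l (@opH M) (@opH N) idfun (vidx l v) (gext_at v).
Proof.
split=> [u|a u w] /at_vertex[u' <-].
  by rewrite gext_at_val -vweightE; exact: weight_wt.
move=> /at_vertex[w' <-]; rewrite -weight_val_linear !gext_at_val gL.
exact: weight_val_linear.
Qed.

Let XM_split w : iter l (@opX M) w = gam l *: opX (Xs l (@opX M) w).
Proof.
rewrite /Xs (linear_scale (@opX_lin M)) scalerA mulfV ?gam_neq0 // scale1r.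
by rewrite -iterS prednK.
Qed.
Let XN_split w : iter l (@opX N) w = gam l *: opX (Xs l (@opX N) w).
Proof.
rewrite /Xs (linear_scale (@opX_lin N)) scalerA mulfV ?gam_neq0 // scale1r.
by rewrite -iterS prednK.
Qed.

Lemma E_extension : exists F : ext M -> ext N,
  [/\ linear F, forall u, F (opX u) = opX (F u), forall u, F (opY u) = opY (F u)
    & forall v (u : E_data l M v), F (weight_val u) = weight_val (g v u)].
Proof.
have [|u|u|u w|F [FL FX FY [Fm Fs Fp]]] :=
    hc_extension l_gt0 cM cN (gext_semilinear vminus) (gext_semilinear vstar)
      (gext_semilinear vplus).
- move=> u /(@at_vertex vminus)[x <-].
  rewrite -(E_a_minus x); apply: etrans (gext_at_val (rphi a_minus x)) _.
  rewrite gphi; apply: etrans (E_a_minus _) _.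
  exact: congr1 _ (esym (gext_at_val x)).
- move=> /(@at_vertex vstar)[x <-].
  rewrite -(E_b_minus x); apply: etrans (gext_at_val (rphi b_minus x)) _.
  rewrite gphi; apply: etrans (E_b_minus _) _.
  exact: congr1 _ (esym (gext_at_val x)).
- move=> /(@at_vertex vstar)[x <-].
  rewrite XM_split XN_split -(E_b_plus l_gt0 hM x) -(linear_scale (@weight_val_linear M _)).
  apply: etrans (gext_at_val (gam l *: rphi b_plus x)) _.
  rewrite (linear_scale (@gL vplus)) gphi (linear_scale (@weight_val_linear N _)).
  apply: congr1; apply: etrans (E_b_plus l_gt0 hN _) _.
  exact: (congr1 (fun z => opX (Xs l (@opX N) z)) (esym (gext_at_val x))).
- move=> /(@at_vertex vplus)[x <-] /(@at_vertex vstar)[y <-] e.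
  have ey : rphi a_plus x = gam l *: y :> E_data l M vstar.
    apply: weight_eq; rewrite (linear_scale (@weight_val_linear M _)).
    apply: (Xs_inj2 l_gt0 cM).
    - exact: (wk_star (@rphi (E_data l M) _ _ a_plus x)).
    - by apply: (wtZ (@opH_lin M)); exact: wk_star.
    apply: etrans (E_a_plus l_gt0 hM x) _; rewrite -e.
    rewrite (linear_scale (Xs_lin cM)) /Xs scalerA mulfV ?gam_neq0 ?scale1r //.
  have := congr1 (g vstar) ey; rewrite gphi (linear_scale (@gL vstar)) => ey'.
  rewrite !gext_at_val; apply: etrans (E_a_plus l_gt0 hN _).
  apply: etrans (congr1 (fun z : E_data l N vstar => Xs l (@opX N) (weight_val z)) (esym ey')).
  rewrite (linear_scale (@weight_val_linear N _)) (linear_scale (Xs_lin cN)) /Xs scalerA.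
  by rewrite mulfV ?gam_neq0 ?scale1r.
exists F; split; [exact: FL|exact: FX|exact: FY|move=> v u; rewrite -gext_at_val].
have hu := eq_ind _ (fun n => wt (@opH M) n (weight_val u)) (weight_wt u) _ (vweightE l v).
by case: v u hu => u hu; [exact: Fm|exact: Fs|exact: Fp].
Qed.

(** The extension commutes with conjugation: it does so at the vertices, where
    conjugation is the involution of the quiver up to an invertible
    polynomial in N. *)
Lemma E_extension_conj (F : ext M -> ext N) : linear F ->
  (forall u, F (opX u) = opX (F u)) -> (forall u, F (opY u) = opY (F u)) ->
  (forall v (u : E_data l M v), F (weight_val u) = weight_val (g v u)) ->
  forall u, F (opc u) = opc (F u).
Proof.
move=> FL FX FY Fg.
have [m [m0 Nm Nn]] := HC_nil2 hM hN; have [s hs] := inv_sqrt_exists m0 (tau_at0 l).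
have Fact := int_act cM cN FL FX FY; have FXs := int_Xs l FL FX.
have Fwt := int_wt cM cN FL FX FY.
have wM n p u : wt (@opH M) n u -> wt (@opH M) n (pact NM p u) := @wt_act _ _ _ _ _ cM n p u.
have invM u : pact NM s (pact NM (tau l * s) u) = u.
  by apply: etrans (act_inv cM Nm hs u); exact: (pact_comm (nilop_lin cM)).
have invM' := act_inv cM Nm hs.
have at_p u : wt (@opH M) (widx l l%:Z) u -> F (opc u) = opc (F u).
  move=> hu; have [x ex] := at_vertex (v := vplus) (wM _ (tau l * s) _ hu).
  have := etrans (congr1 F (esym (E_var_plus l_gt0 hM m0 Nm hs x)))
    (etrans (Fg _ (rvar (E_data l M) vplus x)) (etrans (congr1 (@weight_val N _) (gvar x))
      (E_var_plus l_gt0 hN m0 Nn hs (g vplus x)))).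
  by rewrite -(Fg vplus x) ex /var_plus -Fact !invM.
have at_m u : wt (@opH M) (widx l (-1)) u -> F (opc u) = opc (F u).
  move=> hu; have [x ex] := at_vertex (v := vminus) (wM _ s _ hu).
  have := etrans (congr1 F (esym (E_var_minus l_gt0 hM m0 Nm hs x)))
    (etrans (Fg _ (rvar (E_data l M) vminus x)) (etrans (congr1 (@weight_val N _) (gvar x))
      (E_var_minus l_gt0 hN m0 Nn hs (g vminus x)))).
  by rewrite -(Fg vminus x) ex /var_minus -Fact !invM'.
have at_top u : wt (@opH M) (widx l (l%:Z - 1)) u -> F (opc u) = opc (F u).
  move=> /(Xs_surj l_gt0 cM)[w hw <-].
  have [x ex] := at_vertex (v := vstar) (wM _ (tau l * s) _ hw).
  have := etrans (congr1 F (esym (E_var_star l_gt0 hM m0 Nm hs x)))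
    (etrans (Fg _ (rvar (E_data l M) vstar x)) (etrans (congr1 (@weight_val N _) (gvar x))
      (E_var_star l_gt0 hN m0 Nn hs (g vstar x)))).
  by rewrite -(Fg vstar x) ex /var_star -Fact !invM FXs.
have at_s u : wt (@opH M) (widx l 0) u -> F (opc u) = opc (F u).
  move=> hu; have hcu : wt (@opH M) (widx l (l%:Z - 1)) (opc u).
    by rewrite -widx_top -[_ - 1]opprK widx_star; exact: (wt_opc l_gt0 hM hu).
  by rewrite -{2}[u]opcK (at_top _ hcu) opcK.
apply: (hc_ext l_gt0 cM (XV := @opY N) (YV := @opX N)).
- by move=> u v; rewrite opcD (linear_add FL).
- by move=> u v; rewrite (linear_add FL) opcD.
- by move=> u; rewrite opc_X FY.
- by move=> u; rewrite FX opc_X.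
- by move=> u; rewrite opc_Y FX.
- by move=> u; rewrite FY opc_Y.
- exact: at_p.
- exact: at_s.
- exact: at_m.
Qed.

(** A morphism of F (x) M_Q commuting with conjugation is defined over Q. *)
Lemma E_full : exists f : gkhom M N, forall v u, E_mor l f v u = g v u.
Proof.
have [F [FL FX FY Fg]] := E_extension.
have Fc := E_extension_conj FL FX FY Fg.
pose f (m : M) : N := tens_re (F (pure 1 m)).
have Ff m : F (pure 1 m) = pure 1 (f m) by apply: opc_fixed; rewrite -Fc opc_pure.
have f_lin : linear f.
  move=> q m n; apply: pure1_inj; rewrite -Ff !(pureDr, pureZr) (linear_add FL) (linear_scale FL).
  by rewrite !Ff.
have FE u : F u = tens_map id f u.
  move: u; apply: tens_ext => [u v|u v|a m]; first exact: (linear_add FL u v).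
    exact: (linear_add (@tens_map_linear Qi M N f f_lin) u v).
  by rewrite (tens_map_pure _ f_lin) // [pure a m]pureE (linear_scale FL) Ff -pureE.
have FH := int_H cM cN FL FX FY.
have comb x y z u : F (x *: opX u + y *: opY u + z *: opH u) =
    x *: opX (F u) + y *: opY (F u) + z *: opH (F u).
  rewrite (linear_add FL (x *: opX u + y *: opY u)) (linear_add FL (x *: opX u)).
  rewrite (linear_scale FL x (opX u)) (linear_scale FL y (opY u)) (linear_scale FL z (opH u)).
  by rewrite (FX u) (FY u) (FH u).
have FD u : F (opD u) = opD (F u).
  by rewrite (opD_comb u) (opD_comb (F u)) comb.
have FEE u : F (opE u) = opE (F u).
  by rewrite (opE_comb u) (opE_comb (F u)) comb.
have FF u : F (opFm u) = opFm (F u).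
  by rewrite (opFm_comb u) (opFm_comb (F u)) comb.
have L := (linear_add FL, linear_scale FL, linear_opp FL).
have p1 (M' : gkmod) Z (m : M') : pure 1 (gk_g Z m) = tens_map id (gk_g Z) (pure 1 m) :> ext M'.
  by rewrite (tens_map_pure _ (act_linr _)).
have fg Z m : f (gk_g Z m) = gk_g Z (f m).
  apply: pure1_inj; rewrite -Ff (actE Z m) (actE Z (f m)) !(pureDr, pureZr) !p1.
  by rewrite -!Ff !L -[RHS]/(_ *: opD _ + _ *: opE _ + _ *: opFm _) -FD -FEE -FF.
exists (GKHom (gkhom_of f_lin fg)) => v u; apply: weight_eq.
by apply: etrans (E_mor_val _ _) _; rewrite -Fg FE.
Qed.
End Full.

(** * Integrating a g-action with integral weights *)

Lemma zpow_swap (B : comPzRingType) (z z' : B) n : z * z' = 1 -> zpow z' z n = zpow z z' (- n).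
Proof.
move=> h; have h' : z' * z = 1 by rewrite mulrC.
have [a [b ->]] := zpowE n.
by rewrite opprB !zpow_sub // mulrC.
Qed.

Section BaseQExt.
Variables (M : lmodType rat) (H : tens Qi M -> tens Qi M).
Hypothesis Hw : weighted H.

Lemma baseQ_wt_ext (B : comAlgType rat) (iF : {lrmorphism Qi -> B}) (V : zmodType)
    (f g : tens B M -> V) :
  {morph f : u v / u + v} -> {morph g : u v / u + v} ->
  (forall b n u, wt H n u -> f (b *: baseQ iF u) = g (b *: baseQ iF u)) -> f =1 g.
Proof.
move=> fD gD h; elim/(@baseQ_ind B iF M) => [|x y hx hy|b u].
- by rewrite !morph_add0.
- by rewrite fD gD hx hy.
move: u; apply: (wt_ext Hw) => [x y|x y|n x hx]; last exact: h hx.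
- by rewrite baseQD scalerDr fD.
- by rewrite baseQD scalerDr gD.
Qed.
End BaseQExt.

Section Integrate.
Variables (M : lmodType rat) (act : sl2 rat -> M -> M).
Hypotheses (act_l : forall m, linear (act^~ m)) (act_r : forall Z, linear (act Z))
  (act_b : forall Z W m, act (bracket Z W) m = act Z (act W m) - act W (act Z m)).
Variables (H X Y : tens Qi M -> tens Qi M).
Hypotheses (H_lin : linear H) (X_lin : linear X) (Y_lin : linear Y)
  (HX : forall u, H (X u) = X (H u) + 2 *: X u) (HY : forall u, H (Y u) = Y (H u) - 2 *: Y u)
  (DE : forall u, exD act u = X u + Y u)
  (EE : forall u, exE act u =
     (- (2^-1 * imQ)) *: X u + (2^-1 * imQ) *: Y u + (2^-1 * imQ) *: H u)
  (FE : forall u, exF act u =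
     (- (2^-1 * imQ)) *: X u + (2^-1 * imQ) *: Y u + (- (2^-1 * imQ)) *: H u)
  (Hw : weighted H).

(** First over algebras B containing F: the point g acts on weight n by z^n. *)
Section KB.
Variables (B : comAlgType rat) (iF : {lrmorphism Qi -> B}) (g : so2 B).
Let F n (u : tens Qi M) : tens B M := kpow iF g n *: baseQ iF u.
Let FD n : {morph F n : u v / u + v}.
Proof. by move=> u v; rewrite /F baseQD scalerDr. Qed.

Lemma kB_exists : exists f : tens B M -> tens B M,
  linear f /\ forall n u, wt H n u -> f (baseQ iF u) = kpow iF g n *: baseQ iF u.
Proof.
have wsumZ a u : wsum H F (a *: u) = iF a *: wsum H F u.
  move: u; apply: (wt_ext Hw) => [u v|u v|n u hu] /=.
  - by rewrite scalerDr wsumD.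
  - by rewrite wsumD // scalerDr.
  rewrite !(wsum_wt H_lin Hw FD (n := n)) //; last exact: wtZ.
  by rewrite /F baseQZ !scalerA mulrC.
have [|f [f_lin hf]] := @tens_extend B M (tens B M) (fun m => wsum H F (pure 1 m)).
  move=> q m n; rewrite pureDr pureZr wsumD // wsumZ.
  by rewrite linearZ /= rmorph1.
exists f; split=> // n u hu; rewrite -[RHS]/(F n u) -(wsum_wt H_lin Hw FD hu).
move: u {hu}; apply: tens_ext => [u v|u v|a m].
- by rewrite baseQD (linear_add f_lin).
- by rewrite wsumD.
by rewrite baseQ_pure (linear_scale f_lin) hf -wsumZ -pureE.
Qed.

Definition kB : tens B M -> tens B M := projT1 (cid kB_exists).
Lemma kB_lin : linear kB. Proof. exact: (projT2 (cid kB_exists)).1. Qed.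
Lemma kB_wt n u : wt H n u -> kB (baseQ iF u) = kpow iF g n *: baseQ iF u.
Proof. exact: (projT2 (cid kB_exists)).2. Qed.
End KB.

Lemma kB_map (B C : comAlgType rat) (iF : {lrmorphism Qi -> B}) (iG : {lrmorphism Qi -> C})
    (phi : {lrmorphism B -> C}) (g : so2 B) u : (forall z, phi (iF z) = iG z) ->
  tens_map phi id (kB iF g u) = kB iG (so2_map phi g) (tens_map phi id u).
Proof.
move=> e; have lphi : linear phi by exact: linearP.
have Z b x : tens_map phi id (b *: x) = phi b *: tens_map phi id x :> tens C M.
  by apply: tens_mapZ => //; exact: rmorphM.
have J v : tens_map phi id (baseQ iF v) = baseQ iG v :> tens C M.
  move: v; apply: tens_ext => [v w|v w|a m]; rewrite ?baseQD ?tens_mapD //.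
  by rewrite !baseQ_pure Z e tens_map_pure // rmorph1.
move: u; apply: (baseQ_wt_ext Hw (iF := iF)) => [u v|u v|b n u hu].
- by rewrite (linear_add (kB_lin iF g)) tens_mapD.
- by rewrite tens_mapD // (linear_add (kB_lin iG _)).
rewrite (linear_scale (kB_lin iF g)) !Z (linear_scale (kB_lin iG _)); congr (_ *: _).
by rewrite (kB_wt iF g hu) Z J (kB_wt iG _ hu) (@kpow_map _ _ iF iG).
Qed.

Lemma kB_one (B : comAlgType rat) (iF : {lrmorphism Qi -> B}) u : kB iF (so2_one B) u = u.
Proof.
move: u; apply: (baseQ_wt_ext Hw (iF := iF)) => [|//|b n u hu].
  exact: linear_add (kB_lin _ _).
by rewrite (linear_scale (kB_lin _ _)) (kB_wt iF _ hu) kpow1 scale1r.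
Qed.

Lemma kB_mul (B : comAlgType rat) (iF : {lrmorphism Qi -> B}) g h u :
  kB iF (so2_mul g h) u = kB iF g (kB iF h u).
Proof.
move: u; apply: (baseQ_wt_ext Hw (iF := iF)) => [|u v|b n u hu].
- exact: linear_add (kB_lin _ _).
- by rewrite !(linear_add (kB_lin _ _)).
rewrite !(linear_scale (kB_lin _ _)) !(kB_wt iF _ hu) (linear_scale (kB_lin _ _)).
by rewrite (kB_wt iF _ hu) kpow_mul !scalerA; congr (_ *: _); ring.
Qed.

Section LieB.
Variables (B : comAlgType rat) (iF : {lrmorphism Qi -> B}).
Local Notation J := (@baseQ B iF M).

Lemma baseQ_act Z u : tens_map id (act Z) (J u) = J (tens_map id (act Z) u).
Proof.
move: u; apply: tens_ext => [u v|u v|a m].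
- by rewrite baseQD (linear_add (@tens_map_linear B M M _ (act_r Z))).
- by rewrite (linear_add (@tens_map_linear Qi M M _ (act_r Z))) baseQD.
rewrite (tens_map_pure _ (act_r _)) // !baseQ_pure.
by rewrite (linear_scale (@tens_map_linear B M M _ (act_r Z))) (tens_map_pure _ (act_r _)).
Qed.

Lemma lie_extD (A : comAlgType rat) (Z : 'M[A]_2) : {morph lie_ext act Z : u v / u + v}.
Proof.
have D V := linear_add (@tens_map_linear A M M _ (act_r V)).
by move=> u v; rewrite /lie_ext !D; lmodule A.
Qed.
Lemma lie_extZ (A : comAlgType rat) (Z : 'M[A]_2) b u : lie_ext act Z (b *: u) = b *: lie_ext act Z u.
Proof.
have D V := linear_scale (@tens_map_linear A M M _ (act_r V)).
by rewrite /lie_ext !D !scalerDr !scalerA ![b * _]mulrC.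
Qed.

Let j : B := iF (2^-1 * imQ).
Let jj : iF imQ = j + j.
Proof. by rewrite /j -rmorphD /=; congr (iF _); qfield. Qed.

Let baseQ_comb x y z p q r :
  J (x *: p + y *: q + z *: r) = iF x *: J p + iF y *: J q + iF z *: J r.
Proof. by rewrite !baseQD !baseQZ. Qed.

Lemma lie_ext_baseQ (Z : 'M[B]_2) u : lie_ext act Z (J u) =
  (Z 0 0 - j * (Z 0 1 + Z 1 0)) *: J (X u) + (Z 0 0 + j * (Z 0 1 + Z 1 0)) *: J (Y u)
  + (j * (Z 0 1 - Z 1 0)) *: J (H u).
Proof.
have eD : J (exD act u) = J (X u) + J (Y u).
  by rewrite DE baseQD.
have jN : iF (- (2^-1 * imQ)) = - j by exact: rmorphN.
have eE : J (exE act u) = - j *: J (X u) + j *: J (Y u) + j *: J (H u).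
  by rewrite EE baseQ_comb jN.
have eF : J (exF act u) = - j *: J (X u) + j *: J (Y u) + - j *: J (H u).
  by rewrite FE baseQ_comb jN.
rewrite /lie_ext !baseQ_act -/(exD act) -/(exE act) -/(exF act) eD eE eF.
by move: (J (X u)) (J (Y u)) (J (H u)) (j) => p q r j'; lmodule B.
Qed.

(** Conjugation by g multiplies X by z^2 and Y by z^-2, as their weights demand. *)
Lemma kB_lie (g : so2 B) (Z : 'M[B]_2) u : Z 1 1 = - Z 0 0 ->
  kB iF g (lie_ext act Z u) = lie_ext act (Defs.rot g *m Z *m Defs.rot (so2_inv g)) (kB iF g u) :> tens B M.
Proof.
move=> hZ; move: u; apply: (baseQ_wt_ext Hw (iF := iF)) => [u v|u v|b n u hu].
- by rewrite lie_extD (linear_add (kB_lin _ _)).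
- by rewrite (linear_add (kB_lin _ _)) lie_extD.
rewrite lie_extZ !(linear_scale (kB_lin _ _)) lie_extZ; congr (_ *: _).
have hX : wt H (n + 2) (X u).
  by rewrite /wt HX hu (linear_scale X_lin) -scalerDl rmorphD.
have hY : wt H (n - 2) (Y u).
  by rewrite /wt HY hu (linear_scale Y_lin) -scalerBl rmorphB.
have hH : wt H n (H u) by rewrite hu; apply: wtZ.
rewrite (kB_wt iF g hu) lie_extZ !lie_ext_baseQ.
have kL := kB_lin iF g.
rewrite !(linear_add kL) !(linear_scale kL) (kB_wt iF g hX) (kB_wt iF g hY) (kB_wt iF g hH).
have k2 : kpow iF g (n + 2) = kpow iF g n * (kz iF g * kz iF g) by rewrite kpowD.
have k2' : kpow iF g (n - 2) = kpow iF g n * (kz' iF g * kz' iF g) by rewrite kpowD.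
rewrite k2 k2' !mulmx2E !mx2E hZ.
rewrite /kz /kz' jj; have j4 : j * j * 4 = -1 by rewrite -(iF_sqr iF) jj; ring.
set x := so2x g; set y := so2y g; rewrite /= -/x -/y.
have xy : x ^+ 2 = 1 - y ^+ 2 by rewrite -(so2P g) addrK.

have e0 r t v : r - t = (j * j * 4 + 1) * v -> r = t.
  by rewrite j4 addNr mul0r => /eqP; rewrite subr_eq0 => /eqP.
(* The coefficients of X and Y agree modulo 4 i ^ 2 + 1 = 0, the local i being half
   of the imaginary unit; the arguments of e0 are the cofactors. *)
move: (j) j4 e0 => i j4 e0; rewrite !scalerDr !scalerA.
congr (_ *: _ + _ *: _ + _ *: _).
- apply: (e0 _ _ (kpow iF g n * ((Z 0 0 - i * (Z 0 1 + Z 1 0)) * y ^+ 2 + x * y * (Z 0 1 + Z 1 0)))).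
  by ring.
- apply: (e0 _ _ (kpow iF g n * ((Z 0 0 + i * (Z 0 1 + Z 1 0)) * y ^+ 2 + x * y * (Z 0 1 + Z 1 0)))).
  by ring.
- by ring: xy.
Qed.
End LieB.

Let Jop (A : comAlgType rat) : tens A M -> tens A M := tens_map id (act (sl2_of 0 (-1) 1)).
Hypothesis HJ : forall u, H u = imQ *: Jop u.

Lemma wt_Jop n u : wt H n u -> Jop u = (- (n%:~R * imQ)) *: u.
Proof.
rewrite /wt HJ => e; apply: oppr_inj; rewrite -scaleNr opprK.
transitivity (imQ *: (imQ *: Jop u)); first by rewrite scalerA imQ_sqr scaleN1r.
by rewrite e scalerA mulrC.
Qed.

Lemma kB_inf (B : comAlgType rat) (iF : {lrmorphism Qi -> B}) (g : so2 B) u :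
  so2x g = 1 -> kB iF g u = u + so2y g *: Jop u.
Proof.
move=> gx; have JB : linear (@Jop B) by exact: tens_map_linear.
move: u; apply: (baseQ_wt_ext Hw (iF := iF)) => [|u v|b n u hu].
- exact: linear_add (kB_lin _ _).
- by rewrite (linear_add JB) scalerDr addrACA.
rewrite (linear_scale (kB_lin _ _)) (kB_wt iF g hu) kpow_inf // (linear_scale JB).
rewrite /Jop baseQ_act -/(@Jop Qi) (wt_Jop hu) baseQZ rmorphN /=.
by lmodule B.
Qed.

Let conjE : tens Qi M -> tens Qi M := tens_map conjQ id.

Lemma wt_conjE n u : wt H n u -> wt H (- n) (conjE u).
Proof.
have cD : {morph conjE : u v / u + v} := tens_mapD conjQ_linear (@linear_id _ M).
have cZ a v : conjE (a *: v) = conjQ a *: conjE v.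
  by apply: tens_mapZ; [exact: conjQ_linear|exact: linear_id|exact: rmorphM].
have JD := linear_add (@tens_map_linear Qi M M _ (act_r (sl2_of 0 (-1) 1))).
have cJ v : conjE (Jop v) = Jop (conjE v).
  move: v; apply: tens_ext => [v w|v w|a m]; first by rewrite /Jop JD cD.
    by rewrite /Jop cD JD.
  have h := tens_map_pure conjQ_linear (@linear_id _ M).
  by rewrite /Jop (tens_map_pure _ (act_r _)) // /conjE !h (tens_map_pure _ (act_r _)).
move=> hu; have := congr1 conjE hu; rewrite HJ !cZ cJ conjQ_im rmorph_int scaleNr -HJ => e.
by rewrite /wt -[LHS]opprK e rmorphN scaleNr.
Qed.

(** Then over an arbitrary A: what was defined over A (x) F commutes with
    conjugation, hence preserves A (x) M. *)
Section KA.
Variable A : comAlgType rat.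
Local Notation B := (cplx A).
Local Notation iA := (cplx_in A).
Local Notation iF := (cplx_of A).
Let incl : tens A M -> tens B M := tens_map iA id.

Definition conjB (u : quad (-1 : A)) : quad (-1 : A) := (u.1, - u.2).
Lemma conjB_linear : linear (conjB : B -> B).
Proof. by move=> q u v; congr (_, _); rewrite /= opprD scalerN. Qed.
Lemma conjB_mul : {morph (conjB : B -> B) : u v / u * v}.
Proof. by move=> u v; congr (_, _) => /=; ring. Qed.

Let sg : tens B M -> tens B M := tens_map conjB id.
Let sgD : {morph sg : u v / u + v}. Proof. exact: tens_mapD conjB_linear _. Qed.
Let sgZ b u : sg (b *: u) = conjB b *: sg u.
Proof. by apply: tens_mapZ; [exact: conjB_linear|exact: linear_id|exact: conjB_mul]. Qed.

Let sg_incl u : sg (incl u) = incl u.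
Proof.
have lA : linear iA by exact: linearP.
move: u; apply: tens_ext => [u v|u v|a m].
- by rewrite /incl (tens_mapD lA) // sgD.
- by rewrite /incl (tens_mapD lA).
rewrite /incl (tens_map_pure lA) // /sg (tens_map_pure conjB_linear) //.
by congr pure; congr (_, _); rewrite /= oppr0.
Qed.

Let sg_baseQ u : sg (baseQ iF u) = baseQ iF (conjE u).
Proof.
move: u; apply: tens_ext => [u v|u v|a m].
- by rewrite baseQD sgD.
- by rewrite /conjE (tens_mapD conjQ_linear) // baseQD.
rewrite /conjE (tens_map_pure conjQ_linear) // !baseQ_pure sgZ.
have -> : sg (pure 1 m) = pure 1 m.
  by rewrite /sg (tens_map_pure conjB_linear) //; congr pure; congr (_, _); rewrite /= oppr0.
congr (_ *: _); rewrite !cplx_ofE; case: a => a b; congr (_, _).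
by rewrite /= scaleNr.
Qed.

(** A vector over A (x) F comes from A when it is fixed by conjugation. *)
Let sg_fixed u : sg u = u -> incl (tens_map (@quad_fst A (-1)) id u) = u.
Proof.
move=> e; have := quad_tensE u; rewrite -/incl => eu; rewrite [RHS]eu.
have s1 : conjB (quad_gen (-1)) = - quad_gen (-1) by congr (_, _); rewrite /= oppr0.
have := congr1 (tens_map (@quad_snd A (-1)) id) e.
rewrite {1 2}eu sgD sgZ !sg_incl s1 scaleNr -scalerN.
have -> : - incl (tens_map (@quad_snd A (-1)) id u) = incl (- tens_map (@quad_snd A (-1)) id u).
  have lA : linear iA by exact: linearP.
  by rewrite /incl (morph_addN (tens_mapD lA (@linear_id _ M))).
rewrite !quad_tens_snd => /eqP; rewrite eq_sym -subr_eq0 opprK => /eqP h.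
have -> : tens_map (@quad_snd A (-1)) id u = 0.
  have two : (2^-1)%:A * 2 = 1 :> A.
    by rewrite mulr_algl -scaler_nat scalerA mulVf // scale1r.
  move: (tens_map (@quad_snd A (-1)) id u) h => w h.
  have w2 : w *+ 2 = 0 := h.
  by rewrite -[LHS]scale1r -two -scalerA scaler_nat w2 scaler0.
have lA : linear iA by exact: linearP.
by rewrite [incl 0](morph_add0 (tens_mapD lA (@linear_id _ M))) scaler0 addr0.
Qed.

Definition kA (g : so2 A) (u : tens A M) : tens A M :=
  tens_map (@quad_fst A (-1)) id (kB iF (so2_map iA g) (incl u)).

(* Conjugation exchanges z with its inverse and weight n with weight -n. *)
Let sg_kB (g : so2 A) u : sg (kB iF (so2_map iA g) u) = kB iF (so2_map iA g) (sg u).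
Proof.
have kL := kB_lin iF (so2_map iA g).
move: u; apply: (baseQ_wt_ext Hw (iF := iF)) => [u v|u v|b n u hu].
- by rewrite (linear_add kL) sgD.
- by rewrite sgD (linear_add kL).
rewrite (linear_scale kL) !sgZ (linear_scale kL) (kB_wt iF _ hu) sgZ sg_baseQ.
rewrite (kB_wt iF _ (wt_conjE hu)); congr (_ *: (_ *: _)).
have [cB hcB] : exists cB : {lrmorphism B -> B}, (conjB : B -> B) =1 cB.
  apply: lrmorphism_of; first exact: conjB_linear.
  by split; [congr (_, _); rewrite /= oppr0|exact: conjB_mul].
have cz : cB (kz iF (so2_map iA g)) = kz' iF (so2_map iA g).
  by apply: etrans (esym (hcB _)) _; rewrite /kz /kz' cplx_of_im; congr (_, _) => /=; ring.
have cz' : cB (kz' iF (so2_map iA g)) = kz iF (so2_map iA g).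
  by apply: etrans (esym (hcB _)) _; rewrite /kz /kz' cplx_of_im; congr (_, _) => /=; ring.
apply: etrans (hcB _) _; apply: etrans (zpow_morph cB _ _ n) _.
apply: etrans (congr2 (fun a b : B => zpow a b n) cz cz') _.
exact: zpow_swap (kzK _ _).
Qed.

Lemma kA_incl (g : so2 A) u : incl (kA g u) = kB iF (so2_map iA g) (incl u).
Proof. by apply: sg_fixed; rewrite sg_kB sg_incl. Qed.

Lemma incl_inj : injective incl. Proof. exact: quad_incl_inj. Qed.
Lemma inclD : {morph incl : u v / u + v}.
Proof. by have lA : linear iA by [exact: linearP]; exact: tens_mapD. Qed.
Lemma inclZ a u : incl (a *: u) = iA a *: incl u.
Proof. by apply: tens_mapZ; [exact: linearP|exact: linear_id|exact: rmorphM]. Qed.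
Lemma incl_pure a m : incl (pure a m) = pure (iA a) m.
Proof. by have lA : linear iA by [exact: linearP]; exact: tens_map_pure. Qed.

Lemma incl_act Z u : incl (tens_map id (act Z) u) = tens_map id (act Z) (incl u).
Proof.
move: u; apply: tens_ext => [u v|u v|a m].
- by rewrite (linear_add (@tens_map_linear A M M _ (act_r Z))) inclD.
- by rewrite inclD (linear_add (@tens_map_linear B M M _ (act_r Z))).
by rewrite (tens_map_pure _ (act_r _)) // !incl_pure (tens_map_pure _ (act_r _)).
Qed.

Lemma incl_lie (Z : 'M[A]_2) u : incl (lie_ext act Z u) = lie_ext act (map_mx iA Z) (incl u).
Proof. by rewrite /lie_ext !inclD !inclZ !incl_act !mxE. Qed.
End KA.

Lemma kA_nat (A A' : comAlgType rat) (phi : {lrmorphism A -> A'}) (g : so2 A) u :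
  tens_map phi id (kA g u) = kA (so2_map phi g) (tens_map phi id u).
Proof.
have lphi : linear phi by exact: linearP.
pose q (u : quad (-1 : A)) : quad (-1 : A') := (phi u.1, phi u.2).
have [Phi hPhi] : exists Phi : {lrmorphism cplx A -> cplx A'}, (q : cplx A -> cplx A') =1 Phi.
  apply: lrmorphism_of; first by move=> r x y; congr (_, _); rewrite /= linearP.
  split; first by congr (_, _); rewrite /= ?rmorph1 ?rmorph0.
  move=> x y; congr (_, _); rewrite /= rmorphD !rmorphM /= ?rmorphN1 //.
have hin v : tens_map Phi id (tens_map (cplx_in A) id v) = tens_map (cplx_in A') id (tens_map phi id v) :> tens (cplx A') M.
  have l1 : linear Phi by exact: linearP.
  have l2 : linear (cplx_in A) by exact: linearP.
  have l3 : linear (cplx_in A') by exact: linearP.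
  move: v; apply: tens_ext => [v w|v w|a m]; rewrite ?tens_mapD //.
  rewrite !tens_map_pure // -hPhi; congr pure; congr (_, _).
  by rewrite /= rmorph0.
have hz z : Phi (cplx_of A z) = cplx_of A' z.
  by rewrite -hPhi !cplx_ofE; congr (_, _); rewrite /= linearZ /= rmorph1.
have hg : so2_map Phi (so2_map (cplx_in A) g) = so2_map (cplx_in A') (so2_map phi g).
  by apply: so2_eq; rewrite /= -hPhi; congr (_, _); rewrite /= rmorph0.
apply: (@incl_inj A'); apply: etrans (esym (hin _)) _.
apply: etrans (congr1 (tens_map Phi id) (kA_incl g u)) _.
apply: etrans (kB_map _ _ hz) _; apply: etrans _ (esym (kA_incl _ _)).
by have e := hin u; rewrite hg -e.
Qed.

Theorem integrate : exists k : (forall A : comAlgType rat, so2 A -> tens A M -> tens A M),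
  gk_axioms k act.
Proof.
exists (fun A => @kA A); split=> //.
- split.
  + move=> A g a u v; apply: incl_inj; rewrite kA_incl !inclD !inclZ !kA_incl.
    exact: kB_lin.
  + move=> A u; apply: incl_inj; rewrite kA_incl (_ : so2_map _ _ = so2_one _) ?kB_one //.
    by apply: so2_eq; rewrite /= ?rmorph1 ?rmorph0.
  + move=> A g h u; apply: (@incl_inj A); apply: etrans (kA_incl _ _) _.
    apply: etrans _ (esym (kA_incl _ _)).
    apply: etrans _ (esym (congr1 (kB _ (so2_map (cplx_in A) g)) (kA_incl h u))).
    apply: etrans _ (kB_mul _ _ _ _).
    have -> // : so2_map (cplx_in A) (so2_mul g h) =
      so2_mul (so2_map (cplx_in A) g) (so2_map (cplx_in A) h).
    by apply: so2_eq; rewrite /= ?rmorphB ?rmorphD !rmorphM.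
  + by move=> A A' phi g u; exact: kA_nat.
- move=> A g Z u; apply: (@incl_inj A); apply: etrans (kA_incl _ _) _.
  apply: etrans (congr1 (kB _ (so2_map (cplx_in A) g)) (incl_lie _ _)) _.
  apply: etrans (kB_lie _ _ _ _) _.
    by rewrite !mxE (sl2_11 Z) rmorphN.
  apply: etrans _ (esym (incl_lie _ _)).
  apply: etrans (congr1 (lie_ext act _) (esym (kA_incl g u))) _.
  congr (lie_ext _ _ _).
  have -> : map_mx (cplx_in A) (Defs.rot g *m Z *m Defs.rot (so2_inv g)) =
    map_mx (cplx_in A) (Defs.rot g) *m map_mx (cplx_in A) Z *m map_mx (cplx_in A) (Defs.rot (so2_inv g)).
    by apply: etrans (map_mxM (cplx_in A) _ _) _; rewrite (map_mxM (cplx_in A)).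
  have hr h : map_mx (cplx_in A) (Defs.rot h) = Defs.rot (so2_map (cplx_in A) h).
    by apply: mx2_eq; rewrite !mxE /= ?mx2E //= rmorphN.
  rewrite !hr; congr (_ *m Defs.rot _); apply: so2_eq => //=.
  by rewrite rmorphN.
- move=> A g m gx; apply: incl_inj; rewrite kA_incl kB_inf; last by rewrite /= gx rmorph1.
  rewrite inclD !incl_pure rmorph1 /Jop (tens_map_pure _ (act_r _)) //.
  by rewrite -pureE.
Qed.
End Integrate.

(** Over F the group SO(2) becomes the multiplicative group, and on weight n the
    point (x, y) acts by (x - iy)^n; this commutes with conjugation, which swaps
    the weights n and -n, so that it descends to Q. *)
Theorem integrable (M : lmodType rat) (act : sl2 rat -> M -> M) :
  (forall m, linear (act^~ m)) -> (forall Z, linear (act Z)) ->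
  (forall Z W m, act (bracket Z W) m = act Z (act W m) - act W (act Z m)) ->
  weighted (exH act) ->
  exists k : (forall A : comAlgType rat, so2 A -> tens A M -> tens A M), gk_axioms k act.
Proof.
move=> act_l act_r act_b Hw.
apply: (@integrate M act act_l act_r act_b (exH act) (exX act) (exY act)) => //.
- exact: exH_lin.
- exact: exX_lin.
- exact: exY_lin.
- exact: exHX.
- exact: exHY.
- by move=> u; rewrite {1}exD_comb !scale1r scale0r addr0.
- exact: exE_comb.
- exact: exF_comb.
- exact: exH_J.
Qed.

(** * Conjugation on a module from the involution of its quiver *)

Section ConjOfQuiver.
Variables (l : nat) (P : lmodType Qi) (H X Y : P -> P).
Hypotheses (l_gt0 : (0 < l)%N) (hP : hcmod l H X Y).
Local Notation N := (nilop l H X Y).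
Local Notation wk k := (wt H (widx l k)).
Local Notation act := (pact N).
Local Notation XS := (Xs l X).
Local Notation YS := (Ys l Y).
Variable psi : vertex -> P -> P.
Hypotheses (psiD : forall v, {morph psi v : x y / x + y})
  (psiZ : forall v a x, psi v (a *: x) = conjQ a *: psi v x)
  (psi_wk : forall v x, wk (vidx l v) x -> wk (vidx l (cvertex v)) (psi v x))
  (psiN : forall v x, psi v (N x) = N (psi v x))
  (psiK : forall v x, wk (vidx l v) x -> psi (cvertex v) (psi v x) = x).
Hypotheses (psi_a_minus : forall x, wk (-1) x -> XS (psi vstar (X x)) = Y (psi vminus x))
  (psi_b_minus : forall x, wk 0 x -> psi vminus (Y x) = X (XS (psi vstar x)))
  (psi_b_plus : forall x, wk 0 x -> psi vplus (X (XS x)) = Y (psi vstar x))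
  (psi_a_plus : forall x w, wk l%:Z x -> wk 0 w -> XS w = Y x -> X (psi vplus x) = psi vstar w).
Variables (m : nat) (s : {poly rat}).
Hypotheses (Nm : forall u, iter m N u = 0) (hs : inv_sqrt m (tau l) s).

Let N_lin := nilop_lin hP.
Let X_lin := hc_X hP.
Let Y_lin := hc_Y hP.
Let t := tau l * s.
Let st u : act t (act s u) = u := act_inv hP Nm hs u.
Let ts u : act s (act t u) = u. Proof. by rewrite (pact_comm N_lin) st. Qed.
Let tauss u : act (tau l) (act s (act s u)) = u.
Proof. by rewrite -(pactM N_lin) -/t st. Qed.

Let psi_act v p x : psi v (act p x) = act p (psi v x).
Proof.
apply: (@pact_morph _ _ _ _ conjQ) => // i.
by elim: i => [//|i IH]; rewrite !iterS psiN IH.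
Qed.

Let wt_negH n u : wt H (- n) u -> wt (fun u => - H u) n u.
Proof. by rewrite /wt rmorphN scaleNr => ->; rewrite opprK. Qed.

Let iterX w : iter l.-1 X w = gam l *: XS w.
Proof. by rewrite /Xs scalerA mulfV ?gam_neq0 // scale1r. Qed.
Let iterY w : iter l.-1 Y w = gam l *: YS w.
Proof. by rewrite /Ys scalerA mulfV ?gam_neq0 // scale1r. Qed.
Let iterXl w : iter l X w = gam l *: X (XS w).
Proof. by rewrite -(linear_scale X_lin) -iterX -iterS prednK. Qed.
Let iterYl w : iter l Y w = gam l *: Y (YS w).
Proof. by rewrite -(linear_scale Y_lin) -iterY -iterS prednK. Qed.

Let gam_conj : conjQ (gam l) = gam l. Proof. by rewrite rmorph_nat. Qed.

(* These are the values forced on a conjugation c by var_minus, var_star and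
   var_plus being psi. *)
Let gm u := psi vminus (act s u).
Let gs u := XS (psi vstar (act s u)).
Let gp u := psi vplus (act t u).

Let wkA k p u : wk k u -> wk k (act p u). Proof. exact: (wt_act hP). Qed.

(** The values at the vertices extend to a semi-linear map exchanging X and Y,
    by hc_extension towards the module with X and Y swapped; its square is the
    identity because it is so at the vertices. *)
Theorem conj_of_quiver : exists c : P -> P,
  [/\ {morph c : u v / u + v}, forall a u, c (a *: u) = conjQ a *: c u,
   forall u, c (X u) = Y (c u), forall u, c (Y u) = X (c u) & involutive c] /\
  [/\ forall u, wk (-1) u -> var_minus l H X Y c s u = psi vminus u,
   forall u, wk 0 u -> var_star l H X Y c s u = psi vstar u
   & forall u, wk l%:Z u -> var_plus l H X Y c s u = psi vplus u].
Proof.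
have actD p u v : act p (u + v) = act p u + act p v := linear_add (pact_lin N_lin p) u v.
have actZ p a u : act p (a *: u) = a *: act p u := linear_scale (pact_lin N_lin p) a u.
have XsZ a u : XS (a *: u) = a *: XS u := linear_scale (Xs_lin hP) a u.
have gmL : semilinear_on l H (fun u => - H u) conjQ (-1) gm.
  split=> [u hu|a u v _ _]; last by rewrite /gm actD actZ psiD psiZ.
  by apply: wt_negH; have := @psi_wk vminus _ (wkA s hu); rewrite -widx_minus opprK widx_plus.
have gsL : semilinear_on l H (fun u => - H u) conjQ 0 gs.
  split=> [u hu|a u v _ _].
    apply: wt_negH; have := wk_Xs l_gt0 hP (@psi_wk vstar _ (wkA s hu)).
    by rewrite -widx_star opprK -widx_top.
  by rewrite /gs actD actZ psiD psiZ (linear_add (Xs_lin hP)) XsZ.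
have gpL : semilinear_on l H (fun u => - H u) conjQ l%:Z gp.
  split=> [u hu|a u v _ _]; last by rewrite /gp actD actZ psiD psiZ.
  by apply: wt_negH; have := @psi_wk vplus _ (wkA t hu); rewrite -widx_plus widx_minus.
have [|u hu|u hu|u w hu hw e|c [cL cX cY [cm cs cp]]] :=
    hc_extension l_gt0 hP (hcmod_swap hP) gmL gsL gpL.
- by move=> u hu; rewrite /gs -(act_X hP) psi_a_minus //; exact: wkA.
- by rewrite /gm -(act_Y hP) psi_b_minus //; exact: wkA.
- rewrite iterXl iterYl /gp actZ psiZ gam_conj; congr (_ *: _).
  rewrite -(act_X hP) -(act_Xs hP) psi_b_plus; last exact: wkA.
  rewrite /gs (YsXs l_gt0 hP); last exact/(@psi_wk vstar)/wkA.
  by rewrite -!psi_act -(pactM N_lin).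
- rewrite iterY /gs (YsXs l_gt0 hP); last exact/(@psi_wk vstar)/wkA.
  rewrite -!psi_act -(pactM N_lin) -gam_conj -psiZ; apply/esym/psi_a_plus; first exact: wkA.
    by apply: (wtZ (hc_H hP)); exact: wkA.
  by rewrite XsZ (act_Xs hP) -actZ -iterX e (act_Y hP).
have cD : {morph c : u v / u + v} by move=> u v; have := cL 1 u v; rewrite rmorph1 !scale1r.
have cZ a u : c (a *: u) = conjQ a *: c u.
  by have := cL a u 0; rewrite addr0 (morph_add0 cD) addr0.
have cXs u : c (XS u) = YS (c u) := c_Xs l cZ cX u.
have cXX u : c (c (X u)) = X (c (c u)) by rewrite cX cY.
have cYY u : c (c (Y u)) = Y (c (c u)) by rewrite cY cX.
have ccD : {morph c \o c : u v / u + v} by move=> u v; rewrite /= !cD.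
have cK : involutive c.
  apply: (hc_ext l_gt0 hP (XV := X) (YV := Y) (f := c \o c) (g := id)) => //= u hu.
  - have hu' := @psi_wk vplus _ (wkA t hu).
    by rewrite (cp u) // cm // /gm /gp -psi_act (@psiK vplus) ts.
  - have hu' := @psi_wk vstar _ (wkA s hu).
    rewrite (cs u) // /gs cXs cs // /gs (YsXs l_gt0 hP); last exact/(@psi_wk vstar)/wkA.
    by rewrite -!psi_act (@psiK vstar) ?tauss //; apply/wkA/wkA/wkA.
  - have hu' := @psi_wk vminus _ (wkA s hu).
    by rewrite (cm u) // cp // /gm /gp -psi_act (@psiK vminus) st.
exists c; split; first by split.
split=> u hu.
- by rewrite /var_minus cm; [rewrite /gm ts|exact: wkA].
- rewrite /var_star cXs cs; last exact: wkA.
  by rewrite /gs (YsXs l_gt0 hP) -?psi_act ?tauss //; exact/(@psi_wk vstar)/wkA/wkA.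
- by rewrite /var_plus cp; [rewrite /gp st|exact: wkA].
Qed.
End ConjOfQuiver.

(** * Ladders of vector spaces *)

From mathcomp Require Import functions.

Section LadderType.
Variables (V : lmodType Qi) (pr : int -> {linear V -> V}).

Definition in_ladder : {pred (int -> V)} := fun f =>
  `[< (exists n : nat, forall k, (n < `|k|)%N -> f k = 0) /\ forall k, pr k (f k) = f k >].

(** The direct sum over k of the images of the projectors pr k, which all live
    in one space V so that the rungs need no transport. *)
Record ladder := Ladder { lad_val :> int -> V; ladderP : lad_val \in in_ladder }.

Lemma in_ladder_submod : submod_closed in_ladder.
Proof.
split; first by apply/asboolP; split=> [|k]; [exists 0|exact: linear0].
move=> a f g /asboolP[[m hf] pf] /asboolP[[n hg] pg]; apply/asboolP; split=> [|k].
  exists (m + n)%N => k hk; rewrite -[LHS]/(a *: f k + g k) hf ?hg ?scaler0 ?addr0 //.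
    by apply: leq_ltn_trans hk; exact: leq_addl.
  by apply: leq_ltn_trans hk; exact: leq_addr.
by rewrite -[(_ + _) k]/(a *: f k + g k) linearP pf pg.
Qed.

HB.instance Definition _ :=
  GRing.isSubmodClosed.Build Qi (int -> V) in_ladder in_ladder_submod.
HB.instance Definition _ := [isSub for lad_val].
HB.instance Definition _ := [Choice of ladder by <:].
HB.instance Definition _ := [SubChoice_isSubLmodule of ladder by <:].

Lemma lad_eq (f g : ladder) : (forall k, f k = g k) -> f = g.
Proof. by move=> h; apply: val_inj; apply/funext. Qed.
Lemma ladD (f g : ladder) k : (f + g) k = f k + g k. Proof. by []. Qed.
Lemma ladN (f : ladder) k : (- f) k = - f k. Proof. by []. Qed.
Lemma ladZ a (f : ladder) k : (a *: f) k = a *: f k. Proof. by []. Qed.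
Lemma lad_pr (f : ladder) k : pr k (f k) = f k.
Proof. by have /asboolP[_] := ladderP f. Qed.

Definition lad_of (f : int -> V) : ladder := insubd 0 f.
Lemma lad_ofE f k : (exists n : nat, forall k, (n < `|k|)%N -> f k = 0) ->
  (forall k, pr k (f k) = f k) -> lad_of f k = f k.
Proof. by move=> h1 h2; rewrite /lad_of (@insubdK _ _ ladder) //; apply/asboolP. Qed.

Definition rung k (x : V) : ladder := lad_of (fun j => if j == k then x else 0).
Lemma rungE k x j : pr k x = x -> rung k x j = if j == k then x else 0.
Proof.
move=> h; rewrite /rung lad_ofE //; last first.
  by move=> i; case: eqP => [->|_] //; exact: linear0.
exists `|k|%N => i; case: eqP => [->|//]; by rewrite ltnn.
Qed.
Lemma rung_at k x : pr k x = x -> rung k x k = x.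
Proof. by move=> h; rewrite rungE // eqxx. Qed.

Lemma lad_sum_rung (f : ladder) : exists s : seq int, f = \sum_(k <- s) rung k (f k).
Proof.
have /asboolP[[n hn] _] := ladderP f.
exists [seq i%:Z - n%:Z | i <- iota 0 (n + n).+1]; apply: lad_eq => k.
have sE (F : int -> ladder) r : (\sum_(i <- r) F i) k = \sum_(i <- r) F i k.
  by elim: r => [|i r IH]; rewrite ?big_nil // !big_cons ladD IH.
rewrite sE; have u : uniq [seq i%:Z - n%:Z | i <- iota 0 (n + n).+1].
  by rewrite map_inj_uniq ?iota_uniq // => i j /addIr [].
case: (boolP (k \in [seq i%:Z - n%:Z | i <- iota 0 (n + n).+1])) => hk.
  rewrite (bigD1_seq k) //= rung_at ?lad_pr // big1 ?addr0 // => i /negPf ik.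
  by rewrite rungE ?lad_pr // eq_sym ik.
rewrite big_seq big1 => [|i hi]; last first.
  by rewrite rungE ?lad_pr //; case: eqP => // e; rewrite e hi in hk.
apply: hn; rewrite ltnNge; apply: contra hk => hk; apply/mapP.
by exists (absz (k + n%:Z)); [rewrite mem_iota|]; lia.
Qed.
End LadderType.

(** Relations for up and down along the ladder that make it a module for sl_2 on
    which the nilpotent operator acts by N on every rung. *)
Section LadderOps.
Variables (l : nat) (V : lmodType Qi) (pr : int -> {linear V -> V}).
Variables (up dn : int -> V -> V) (N : V -> V).
Local Notation S k x := (pr k x = x).
Hypotheses (l_gt0 : (0 < l)%N) (up_lin : forall k, linear (up k))
  (dn_lin : forall k, linear (dn k)).
Hypotheses (up_pr : forall k x, S (k - 1) x -> S k (up k x))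
  (dn_pr : forall k x, S k x -> S (k - 1) (dn k x))
  (dn_up : forall k x, S (k - 1) x -> dn k (up k x) = N x + (k * (l%:Z - k))%:~R *: x)
  (up_dn : forall k x, S k x -> up k (dn k x) = N x + (k * (l%:Z - k))%:~R *: x)
  (N_nil : exists m, forall x, iter m N x = 0)
  (up_id : forall k x, 0 < k < l%:Z -> up k x = x).
Local Notation P := (ladder pr).

Definition ladH (f : P) : P := lad_of pr (fun k => (widx l k)%:~R *: f k).
Definition ladX (f : P) : P := lad_of pr (fun k => up k (f (k - 1))).
Definition ladY (f : P) : P := lad_of pr (fun k => dn (k + 1) (f (k + 1))).

Let support (f : P) : exists n : nat, forall k, (n < `|k|)%N -> f k = 0.
Proof. by have /asboolP[] := ladderP f. Qed.

Lemma ladHE f k : ladH f k = (widx l k)%:~R *: f k.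
Proof.
rewrite /ladH lad_ofE // => [|j]; last by rewrite linearZ /= lad_pr.
by have [n hn] := support f; exists n => j /hn ->; rewrite scaler0.
Qed.
Lemma ladXE f k : ladX f k = up k (f (k - 1)).
Proof.
rewrite /ladX lad_ofE // => [|j]; last exact/up_pr/lad_pr.
have [n hn] := support f; exists n.+1 => j hj; rewrite hn ?(linear_zero (up_lin _)) //.
by lia.
Qed.
Lemma ladYE f k : ladY f k = dn (k + 1) (f (k + 1)).
Proof.
rewrite /ladY lad_ofE // => [|j]; last by rewrite -{1}[j](addrK 1); exact/dn_pr/lad_pr.
have [n hn] := support f; exists n.+1 => j hj; rewrite hn ?(linear_zero (dn_lin _)) //.
by lia.
Qed.

Let uZ k := linear_scale (up_lin k). Let dZ k := linear_scale (dn_lin k).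

Lemma lad_XY f k : ladX (ladY f) k = N (f k) + (k * (l%:Z - k))%:~R *: f k.
Proof. by rewrite ladXE ladYE subrK up_dn // lad_pr. Qed.
Lemma lad_YX f k : ladY (ladX f) k = N (f k) + ((k + 1) * (l%:Z - (k + 1)))%:~R *: f k.
Proof. by rewrite ladYE ladXE addrK dn_up // addrK lad_pr. Qed.

Lemma lad_nilop f k : nilop l ladH ladX ladY f k = N (f k).
Proof.
rewrite /nilop /casimir !(ladZ, ladD, ladN, ladHE) lad_XY.
by lmodule_with Qi ltac:(rewrite /widx; qfield).
Qed.

Lemma lad_wt k f : wt ladH (widx l k) f <-> forall j, j != k -> f j = 0.
Proof.
split=> [e j jk|h].
  have /eqP := congr1 (fun g : P => g j) e.
  rewrite ladHE ladZ -subr_eq0 -scalerBl -rmorphB scaler_eq0 intQ_eq0 subr_eq0.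
  by case: eqP => [/widx_inj jk'|_ /eqP //]; rewrite jk' eqxx in jk.
apply: lad_eq => j; rewrite ladHE ladZ.
by have [->//|/h ->] := eqVneq j k; rewrite !scaler0.
Qed.

Lemma wt_rung k x : S k x -> wt ladH (widx l k) (rung pr k x).
Proof. by move=> hx; apply/lad_wt => j /negPf jk; rewrite rungE // jk. Qed.

Lemma lad_wtE k f : wt ladH (widx l k) f -> f = rung pr k (f k).
Proof.
move=> /lad_wt h; apply: lad_eq => j; rewrite rungE ?lad_pr //.
by case: eqP => [->|/eqP/h].
Qed.

Lemma ladH_lin : linear ladH.
Proof.
move=> a f g; apply: lad_eq => k; rewrite !(ladHE, ladD, ladZ).
by rewrite scalerDr !scalerA mulrC.
Qed.

Lemma lad_hcmod : hcmod l ladH ladX ladY.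
Proof.
split.
- exact: ladH_lin.
- by move=> a f g; apply: lad_eq => k; rewrite !(ladXE, ladD, ladZ) up_lin.
- by move=> a f g; apply: lad_eq => k; rewrite !(ladYE, ladD, ladZ) dn_lin.
- move=> f; apply: lad_eq => k; rewrite !(ladXE, ladHE, ladD, ladZ) uZ.
  by rewrite -scalerDl; congr (_ *: _); rewrite /widx; ring.
- move=> f; apply: lad_eq => k; rewrite !(ladYE, ladHE, ladD, ladN, ladZ) dZ.
  by rewrite -scalerBl; congr (_ *: _); rewrite /widx; ring.
- move=> f; apply: lad_eq => k; rewrite ladD ladN lad_XY lad_YX ladHE.
  by lmodule_with Qi ltac:(rewrite /widx; ring).
- apply: (weighted_gen ladH_lin) => f; have [s es] := lad_sum_rung f.
  exists [seq rung pr k (f k) | k <- s]; rewrite big_map; split=> // x /mapP[k _ ->].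
  by exists (widx l k); apply: wt_rung; exact: lad_pr.
- move=> n f hf f0; apply/not_existsP => hn; apply: f0; apply: lad_eq => k.
  have /eqP := congr1 (fun g : P => g k) hf.
  rewrite ladHE ladZ -subr_eq0 -scalerBl -rmorphB scaler_eq0 intQ_eq0 subr_eq0.
  by case/orP => /eqP // e; case: (hn k).
- have [m hm] := N_nil; exists m => f; apply: lad_eq => k; apply: etrans _ (hm (f k)).
  by elim: m {hm} => [//|m IH]; rewrite !iterS lad_nilop IH.
Qed.

Lemma lad_iterX j f : (j < l)%N -> iter j ladX f j = f 0.
Proof.
elim: j => [//|j IH] hj; rewrite iterS ladXE up_id ?ltz_nat ?ltr0n ?andbT; last by lia.
by rewrite -addn1 PoszD addrK IH // ltnW.
Qed.
Lemma lad_Xs f : Xs l ladX f (l%:Z - 1) = (gam l)^-1 *: f 0.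
Proof. by rewrite /Xs ladZ -predn_int // lad_iterX // ltn_predL. Qed.
End LadderOps.

(** * The module over F of a representation of the quiver *)

Definition loop (R : rep_data) (v : vertex) : R v -> R v :=
  match v return R v -> R v with
  | vminus => fun x => rphi b_minus (rphi a_minus x)
  | vstar => fun x => rphi a_minus (rphi b_minus x)
  | vplus => fun x => rphi b_plus (rphi a_plus x)
  end.

(** P with H, X, Y is generated over the weight spaces em v (R v) of the
    vertices, on which X and Y induce the arrows; at_ v is the coordinate there. *)
Record is_model (l : nat) (R : rep_data) (P : lmodType Qi) (H X Y : P -> P)
    (em : forall v, R v -> P) (at_ : forall v, P -> R v) : Prop := {
  mod_hc : hcmod l H X Y;
  mod_em : forall v, linear (em v);
  mod_at : forall v, linear (at_ v);
  mod_emK : forall v x, at_ v (em v x) = x;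
  mod_atK : forall v u, wt H (widx l (vidx l v)) u -> em v (at_ v u) = u;
  mod_wt : forall v x, wt H (widx l (vidx l v)) (em v x);
  mod_N : forall v u, at_ v (nilop l H X Y u) = loop (at_ v u);
  mod_a_minus : forall x, X (em vminus x) = em vstar (rphi a_minus x);
  mod_b_minus : forall x, Y (em vstar x) = em vminus (rphi b_minus x);
  mod_b_plus : forall x, X (Xs l X (em vstar x)) = em vplus (rphi b_plus x);
  mod_a_plus : forall x, Y (em vplus x) = Xs l X (em vstar (rphi a_plus x));
  mod_finite : forall n, exists (v : vertex) (f : R v -> P),
    [/\ linear f, forall x, wt H n (f x) & forall u, wt H n u -> exists x, u = f x] }.

Section Model.
Variables (l : nat) (R : rep_obj).
Hypothesis l_gt0 : (0 < l)%N.
Local Notation V := (R vminus * R vstar * R vplus)%type.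
Let phiL v w (a : arrow v w) : linear (@rphi R v w a) := rep_linear (repP R) a.
Let rel := rep_relation (repP R).

Definition proj (v : vertex) : V -> R v :=
  match v return V -> R v with
  | vminus => fun x => x.1.1 | vstar => fun x => x.1.2 | vplus => fun x => x.2
  end.
Definition inj (v : vertex) : R v -> V :=
  match v return R v -> V with
  | vminus => fun x => (x, 0, 0) | vstar => fun x => (0, x, 0) | vplus => fun x => (0, 0, x)
  end.
Definition vproj (v : vertex) (x : V) : V := inj (proj v x).

Lemma proj_lin v : linear (proj v). Proof. by case: v. Qed.
Lemma inj_lin v : linear (@inj v).
Proof. by case: v => a x y; rewrite /inj; congr (_, _, _); rewrite /= scaler0 addr0. Qed.
Lemma vproj_lin v : linear (vproj v).
Proof. by move=> a x y; rewrite /vproj proj_lin inj_lin. Qed.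
HB.instance Definition _ v := GRing.isLinear.Build Qi V V *:%R (vproj v) (vproj_lin v).
Lemma injK v x : proj v (inj x) = x. Proof. by case: v x. Qed.

Definition vert (k : int) : vertex :=
  if k < 0 then vminus else if k < l%:Z then vstar else vplus.

Lemma vert_vidx v : vert (vidx l v) = v.
Proof. by case: v; rewrite /vert //= ?ltxx ?ltz_nat ?l_gt0. Qed.

(** X and Y at the places where the vertex changes are the arrows; elsewhere X
    is the identity, and the relation between X and Y forces Y. *)
Definition vloop (x : V) : V := (loop (proj vminus x), loop (proj vstar x), loop (proj vplus x)).
Definition vup (k : int) (x : V) : V :=
  if k == 0 then inj (rphi a_minus (proj vminus x))
  else if k == l%:Z then inj (gam l *: rphi b_plus (proj vstar x)) else x.
Definition vdn (k : int) (x : V) : V :=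
  if k == 0 then inj (rphi b_minus (proj vstar x))
  else if k == l%:Z then inj ((gam l)^-1 *: rphi a_plus (proj vplus x))
  else vloop x + (k * (l%:Z - k))%:~R *: x.

Local Notation pr := (fun k => vproj (vert k) : {linear V -> V}).
Local Notation P := (ladder pr).

Let loop_lin v : linear (@loop R v).
Proof. by case: v => a x y; rewrite /loop !phiL. Qed.
Let vloop_lin : linear vloop.
Proof. by move=> a x y; rewrite /vloop !proj_lin !loop_lin. Qed.
Let vloop_proj v x : proj v (vloop x) = loop (proj v x). Proof. by case: v. Qed.
Let vloop_inj v (x : R v) : vloop (inj x) = inj (loop x).
Proof.
have loop0 w : @loop R w 0 = 0 := linear_zero (@loop_lin w).
by case: v x => x; rewrite /vloop /inj; congr (_, _, _); rewrite /= ?loop0 //; exact: loop0.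
Qed.

Lemma vup_lin k : linear (vup k).
Proof.
move=> a x y; rewrite /vup; case: ifP => _; first by rewrite proj_lin phiL inj_lin.
case: ifP => // _; rewrite proj_lin phiL -inj_lin; congr inj.
by rewrite scalerDr !scalerA mulrC.
Qed.
Lemma vdn_lin k : linear (vdn k).
Proof.
move=> a x y; rewrite /vdn; case: ifP => _; first by rewrite proj_lin phiL inj_lin.
case: ifP => _; first by rewrite proj_lin phiL -inj_lin; congr inj; rewrite scalerDr !scalerA mulrC.
by rewrite vloop_lin; lmodule Qi.
Qed.

Let at_inj v x : vproj v x = x -> exists y : R v, x = inj y.
Proof. by move=> <-; exists (proj v x). Qed.
Let pr_inj v (y : R v) : vproj v (inj y) = inj y.
Proof. by rewrite /vproj injK. Qed.
Let vert0 : vert 0 = vstar. Proof. exact: (vert_vidx vstar). Qed.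
Let vertl : vert l%:Z = vplus. Proof. exact: (vert_vidx vplus). Qed.
Let vertm : vert (0 - 1) = vminus. Proof. exact: (vert_vidx vminus). Qed.
Let vertt : vert (l%:Z - 1) = vstar.
Proof. by rewrite /vert; do 2?case: ifP => //; lia. Qed.
Let vert_step k : k != 0 -> k != l%:Z -> vert (k - 1) = vert k.
Proof. by move=> k0 kl; rewrite /vert; do 4?case: ifP => //; lia. Qed.

Lemma vup_pr k x : vproj (vert (k - 1)) x = x -> vproj (vert k) (vup k x) = vup k x.
Proof.
rewrite /vup; have [->|k0] := eqVneq k 0; first by rewrite vert0 pr_inj.
by have [->|kl] := eqVneq k l%:Z; rewrite ?vertl ?pr_inj // vert_step.
Qed.
Lemma vdn_pr k x : vproj (vert k) x = x -> vproj (vert (k - 1)) (vdn k x) = vdn k x.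
Proof.
rewrite /vdn; have [->|k0] := eqVneq k 0; first by rewrite vertm pr_inj.
have [->|kl] := eqVneq k l%:Z; first by rewrite vertt pr_inj.
rewrite vert_step // => /at_inj[y ->].
by rewrite vloop_inj -(linear_scale (@inj_lin _)) -(linear_add (@inj_lin _)) pr_inj.
Qed.

Let L v w (a : arrow v w) := linear_scale (@phiL v w a).
Lemma vdn_up k x : vproj (vert (k - 1)) x = x ->
  vdn k (vup k x) = vloop x + (k * (l%:Z - k))%:~R *: x.
Proof.
rewrite /vup /vdn; have [->|k0] := eqVneq k 0.
  by rewrite vertm => /at_inj[y ->]; rewrite !injK vloop_inj mul0r scale0r addr0.
have [->|kl] := eqVneq k l%:Z; last by [].
rewrite vertt => /at_inj[y ->]; rewrite !injK vloop_inj subrr mulr0 scale0r addr0.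
by rewrite L scalerA mulVf ?gam_neq0 // scale1r /= rel.
Qed.
Lemma vup_dn k x : vproj (vert k) x = x ->
  vup k (vdn k x) = vloop x + (k * (l%:Z - k))%:~R *: x.
Proof.
rewrite /vup /vdn; have [->|k0] := eqVneq k 0.
  by rewrite vert0 => /at_inj[y ->]; rewrite !injK vloop_inj mul0r scale0r addr0.
have [->|kl] := eqVneq k l%:Z; last by [].
rewrite vertl => /at_inj[y ->]; rewrite !injK vloop_inj subrr mulr0 scale0r addr0.
by rewrite L scalerA mulfV ?gam_neq0 // scale1r.
Qed.

(* Iterated loops are actions of paths, hence eventually zero. *)
Fixpoint loop_path (v : vertex) (n : nat) : qpath v v :=
  match n with
  | 0 => path_nil v
  | n.+1 => let p := loop_path v n in
    match v return qpath v v -> qpath v v with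
    | vminus => fun p => path_cons b_minus (path_cons a_minus p)
    | vstar => fun p => path_cons a_minus (path_cons b_minus p)
    | vplus => fun p => path_cons b_plus (path_cons a_plus p)
    end p
  end.

Lemma vloop_nil : exists m, forall x, iter m vloop x = 0.
Proof.
have [n hn] := rep_nilpotent (repP R); exists n => x.
have len v m : (m <= path_length (loop_path v m))%N.
  by elim: m => [//|m IH]; case: v IH => /= IH; lia.
have actE v m y : path_act (loop_path v m) y = iter m (@loop R v) y.
  by elim: m => [//|m IH]; rewrite iterS -IH; case: v y {IH}.
have pE v : proj v (iter n vloop x) = 0.
  rewrite -[RHS](hn _ _ _ (len v n) (proj v x)) actE.
  by elim: n {hn} => [//|m IH]; rewrite !iterS vloop_proj IH.
have := pE vminus; have := pE vstar; have := pE vplus => /=.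
by case: (iter n vloop x) => [[y z] t] /= -> -> ->.
Qed.

Lemma vup_id k x : 0 < k < l%:Z -> vup k x = x.
Proof. by rewrite /vup => h; do 2?case: eqP => //; lia. Qed.

Let H := @ladH l V pr.
Let X := @ladX V pr vup.
Let Y := @ladY V pr vdn.
Let hcP : hcmod l H X Y.
Proof. exact: lad_hcmod l_gt0 vup_lin vdn_lin vup_pr vdn_pr vdn_up vup_dn vloop_nil. Qed.
Let em v (x : R v) : P := rung pr (vidx l v) (inj x).
Let at_ v (f : P) : R v := proj v (f (vidx l v)).

Let XE (f : P) k : X f k = vup k (f (k - 1)). Proof. exact: ladXE l_gt0 vup_lin vup_pr f k. Qed.
Let YE (f : P) k : Y f k = vdn (k + 1) (f (k + 1)).
Proof. exact: ladYE l_gt0 vdn_lin vdn_pr f k. Qed.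
Let XsE (f : P) : Xs l X f (l%:Z - 1) = (gam l)^-1 *: f 0.
Proof. exact: lad_Xs l_gt0 vup_lin vup_pr vup_id f. Qed.
Let wtE k (f : P) : wt H (widx l k) f -> f = rung pr k (f k).
Proof. exact: lad_wtE. Qed.
Let rung_inj k (x : R (vert k)) : wt H (widx l k) (rung pr k (inj x)).
Proof. by apply: wt_rung; exact: pr_inj. Qed.
Let rung_lin k : linear (fun x : R (vert k) => rung pr k (inj x)).
Proof.
move=> a x y; apply: lad_eq => j; rewrite ladD ladZ !rungE; try exact: pr_inj.
by case: eqP => _; rewrite ?inj_lin // scaler0 addr0.
Qed.
Let pr_vidx v (x : R v) : vproj (vert (vidx l v)) (inj x) = inj x.
Proof. by rewrite vert_vidx pr_inj. Qed.
Let em_at v (x : R v) : em x (vidx l v) = inj x.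
Proof. by apply: rung_at; exact: pr_vidx. Qed.
Let em_wt v (x : R v) : wt H (widx l (vidx l v)) (em x).
Proof. by apply: wt_rung; exact: pr_vidx. Qed.
Let atK v (f : P) : wt H (widx l (vidx l v)) f -> em (at_ v f) = f.
Proof.
move=> hf; rewrite [RHS](wtE hf) /em /at_; congr (rung _ _ _).
by have := lad_pr f (vidx l v); rewrite /= vert_vidx.
Qed.

Let l0 : (l%:Z == 0) = false. Proof. by lia. Qed.

(** A ladder with the space of the vertex - on all rungs below 0, of the middle
    vertex on the l rungs from 0 to l - 1, and of the vertex + from l on; each
    weight space of the module is one of the three given spaces. *)
Lemma quiver_model : exists (P : lmodType Qi) (H X Y : P -> P)
  (em : forall v, R v -> P) (at_ : forall v, P -> R v), is_model l H X Y em at_.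
Proof.
exists P, H, X, Y, em, at_; split.
- exact: hcP.
- move=> v a x y; apply: lad_eq => j; rewrite ladD ladZ !rungE; try exact: pr_vidx.
  by case: eqP => _; rewrite ?inj_lin // scaler0 addr0.
- by move=> v a f g; rewrite /at_ ladD ladZ proj_lin.
- by move=> v x; rewrite /at_ em_at injK.
- exact: atK.
- exact: em_wt.
- by move=> v u; rewrite /at_ (lad_nilop l_gt0 vup_lin vdn_lin vup_pr vdn_pr vup_dn).
- move=> x; have := wk_X hcP (em_wt x); rewrite addNr => h.
  rewrite -(@atK vstar _ h); congr em; apply: etrans (congr1 (proj vstar) (XE (em x) 0)) _.
  by rewrite sub0r (em_at x : em x (-1) = inj x) /vup eqxx !injK.
- move=> x; have := wk_Y hcP (em_wt x); rewrite sub0r => h.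
  rewrite -(@atK vminus _ h); congr em; apply: etrans (congr1 (proj vminus) (YE (em x) (-1))) _.
  by rewrite addNr (em_at x : em x 0 = inj x) /vdn eqxx !injK.
- move=> x; have := wk_X hcP (wk_Xs l_gt0 hcP (em_wt x)); rewrite subrK => h.
  rewrite -(@atK vplus _ h); congr em; apply: etrans (congr1 (proj vplus) (XE (Xs l X (em x)) l)) _.
  rewrite XsE (em_at x : em x 0 = inj x) /vup l0 eqxx !injK.
  rewrite (linear_scale (proj_lin vstar)) injK L scalerA mulfV ?gam_neq0 //; exact: scale1r.
- move=> x; have h1 := wk_Y hcP (em_wt x).
  have h2 := wk_Xs l_gt0 hcP (em_wt (rphi a_plus x)).
  rewrite (wtE h1) (wtE h2); congr (rung _ _ _); rewrite XsE YE subrK.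
  rewrite (em_at x : em x l%:Z = inj x) (em_at (rphi a_plus x) : em (rphi a_plus x) 0 = inj _).
  by rewrite /vdn l0 eqxx !injK (linear_scale (@inj_lin vstar)).
- move=> n; have [[k ->]|hn] := pselect (exists k, n = widx l k).
    exists (vert k), (fun x => rung pr k (inj x)); split; [exact: rung_lin|exact: rung_inj|].
    move=> u /wtE ->; exists (proj (vert k) (u k)); congr (rung _ _ _).
    exact: esym (lad_pr u k).
  exists vminus, (fun _ => 0); split=> [a x y|x|u hu]; first by rewrite scaler0 addr0.
    exact: wt0 (hc_H hcP) n.
  exists 0; have [u0|u0] := pselect (u = 0 :> P); first exact: u0.
  by case: hn; exact: hc_parity hcP _ _ hu u0.
Qed.
End Model.

(** * Conjugation on the model *)

Section ModelConj.
Variables (l : nat) (R : rep_obj) (P : lmodType Qi) (H X Y : P -> P).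
Variables (em : forall v, R v -> P) (at_ : forall v, P -> R v).
Hypotheses (l_gt0 : (0 < l)%N) (hR : is_model l H X Y em at_).
Let hP := mod_hc hR.
Local Notation N := (nilop l H X Y).
Local Notation wk k := (wt H (widx l k)).
Local Notation XS := (Xs l X).

Definition model_var (v : vertex) (u : P) : P := em (rvar R v (at_ v u)).
Local Notation psi := model_var.

Let varD v x y : rvar R v (x + y) = rvar R v x + rvar R v y.
Proof. by have := rep_semilinear (repP R) 1 x y; rewrite rmorph1 !scale1r. Qed.
Let var0 (v : vertex) : rvar R v 0 = 0.
Proof. by have /esym/eqP := varD (0 : R v) 0; rewrite addr0 -subr_eq0 addrK => /eqP. Qed.
Let varZ v a x : rvar R v (a *: x) = conjQ a *: rvar R v x.
Proof. by have := rep_semilinear (repP R) a x 0; rewrite var0 !addr0. Qed.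
Let equi v w (a : arrow v w) x := rep_equivariant (repP R) a x.

Lemma model_em_loop v (x : R v) : N (em x) = em (loop x).
Proof.
rewrite -[LHS](mod_atK hR (v := v)); first by rewrite (mod_N hR) (mod_emK hR).
by apply: (wt_N hP); exact: (mod_wt hR).
Qed.

Let varN v (x : R v) : rvar R v (loop x) = loop (rvar R v x).
Proof.
case: v x => x.
- by rewrite -(equi b_minus) -(equi a_minus).
- rewrite -(equi a_minus) -(equi b_minus); exact: esym (rep_relation (repP R) _).
- by rewrite -(equi b_plus) -(equi a_plus).
Qed.

Let at_vertex v u : wk (vidx l v) u -> exists x : R v, u = em x.
Proof. by move=> /(mod_atK hR) <-; exists (at_ v u). Qed.
Let emK := mod_emK hR.

Lemma model_conj m s : (forall u, iter m N u = 0) -> inv_sqrt m (tau l) s ->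
  exists c : P -> P,
  [/\ {morph c : u v / u + v}, forall a u, c (a *: u) = conjQ a *: c u,
   forall u, c (X u) = Y (c u), forall u, c (Y u) = X (c u) & involutive c] /\
  [/\ forall u, wk (-1) u -> var_minus l H X Y c s u = psi vminus u,
   forall u, wk 0 u -> var_star l H X Y c s u = psi vstar u
   & forall u, wk l%:Z u -> var_plus l H X Y c s u = psi vplus u].
Proof.
move=> Nm hs; apply: (@conj_of_quiver l P H X Y l_gt0 hP psi _ _ _ _ _ _ _ _ _ m s Nm hs).
- move=> v x y; rewrite /psi (linear_add (mod_at hR v)) varD.
  exact: (linear_add (mod_em hR (v := cvertex v))).
- move=> v a x; rewrite /psi (linear_scale (mod_at hR v)) varZ.
  exact: (linear_scale (mod_em hR (v := cvertex v))).
- by move=> v x _; exact: (mod_wt hR).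
- by move=> v x; rewrite /psi (mod_N hR) model_em_loop varN.
- move=> v x hx; rewrite -[RHS](mod_atK hR hx) /psi emK.
  case: v hx => _ /=; congr em.
  + exact: rep_invol_minus (repP R) _.
  + exact: rep_invol_star (repP R) _.
  + exact: rep_invol_plus (repP R) _.
- move=> x /(@at_vertex vminus)[y ->].
  rewrite (mod_a_minus hR) /psi !emK (mod_a_plus hR); do 2!congr (_ _).
  exact: esym (equi a_minus y).
- move=> x /(@at_vertex vstar)[y ->].
  rewrite (mod_b_minus hR) /psi !emK (mod_b_plus hR); congr em.
  exact: esym (equi b_minus y).
- move=> x /(@at_vertex vstar)[y ->].
  rewrite (mod_b_plus hR) /psi !emK (mod_b_minus hR); congr em.
  exact: esym (equi b_plus y).
- move=> x w /(@at_vertex vplus)[y ->] hw e.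
  have -> : w = em (rphi a_plus y).
    apply: (Xs_inj2 l_gt0 hP hw (mod_wt hR (rphi a_plus y))).
    by rewrite e (mod_a_plus hR).
  rewrite /psi !emK (mod_a_minus hR); congr em.
  exact: equi a_plus y.
Qed.
End ModelConj.

(** * Descent from F to Q *)

Lemma conjQ_alg (q : rat) : conjQ q%:A = q%:A.
Proof. exact: etrans (linear_scale conjQ_is_linear _ _) (congr1 _ (rmorph1 conjQ)). Qed.

Record conjugation (P : lmodType Qi) := Conjugation {
  conj_fun :> P -> P;
  conj_D : {morph conj_fun : u v / u + v};
  conj_Z : forall a u, conj_fun (a *: u) = conjQ a *: conj_fun u }.

Section Fixed.
Variables (P : lmodType Qi) (c : conjugation P).
Definition in_fixed : {pred rsc P} := fun u => c u == u.
Record fixed := Fixed { fixed_val : rsc P; fixedP : fixed_val \in in_fixed }.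
Lemma in_fixed_submod : submod_closed in_fixed.
Proof.
split=> [|a u v /eqP hu /eqP hv]; apply/eqP; first exact: morph_add0 (conj_D c).
have h : c (a%:A *: (u : P) + v) = a%:A *: (u : P) + v by rewrite conj_D conj_Z hu hv conjQ_alg.
exact: h.
Qed.
HB.instance Definition _ :=
  GRing.isSubmodClosed.Build rat (rsc P) in_fixed in_fixed_submod.
HB.instance Definition _ := [isSub for fixed_val].
HB.instance Definition _ := [Choice of fixed by <:].
HB.instance Definition _ := [SubChoice_isSubLmodule of fixed by <:].

Definition fixed_in (u : fixed) : P := fixed_val u.
Lemma fixed_eq u v : fixed_in u = fixed_in v -> u = v. Proof. exact: val_inj. Qed.
Lemma fixed_lin q u v : fixed_in (q *: u + v) = q%:A *: fixed_in u + fixed_in v.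
Proof. by []. Qed.
Lemma fixed0 : fixed_in 0 = 0. Proof. by []. Qed.
Lemma fixedB u v : fixed_in (u - v) = fixed_in u - fixed_in v. Proof. by []. Qed.
Lemma fixedE u : c (fixed_in u) = fixed_in u. Proof. exact/eqP/fixedP. Qed.
Definition fix_of (u : P) : fixed := insubd 0 (u : rsc P).
Lemma fix_ofE u : c u = u -> fixed_in (fix_of u) = u.
Proof. by move=> h; rewrite /fixed_in /fix_of (@insubdK _ _ fixed) //; apply/eqP. Qed.
End Fixed.

Section FixedAct.
Variables (P : lmodType Qi) (c : conjugation P) (D E F : P -> P).
Hypotheses (D_lin : linear D) (E_lin : linear E) (F_lin : linear F)
  (DE : forall u, D (E u) = E (D u) + 2 *: E u)
  (DF : forall u, D (F u) = F (D u) - 2 *: F u)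
  (EF : forall u, E (F u) = F (E u) + D u)
  (cD : forall u, c (D u) = D (c u)) (cE : forall u, c (E u) = E (c u))
  (cF : forall u, c (F u) = F (c u)) (cK : involutive c).
Local Notation M := (fixed c).
Local Notation In := (@fixed_in P c).

Let sl2P (x y z : Qi) (u : P) : P := x *: D u + y *: E u + z *: F u.
Let sl2_bracketP x y z x' y' z' u :
  sl2P (y * z' - y' * z) (2 * (x * y' - x' * y)) (2 * (z * x' - z' * x)) u =
  sl2P x y z (sl2P x' y' z' u) - sl2P x' y' z' (sl2P x y z u).
Proof.
have LD := (linear_add D_lin, linear_add E_lin, linear_add F_lin, linear_scale D_lin,
  linear_scale E_lin, linear_scale F_lin).
rewrite /sl2P !LD !DE !DF !EF.
by labstract; lmodule_with Qi ltac:(ring).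
Qed.

Let qa (q : rat) : Qi := q%:A.
Let qaD : {morph qa : p q / p + q}. Proof. by move=> p q; rewrite /qa scalerDl. Qed.
Let qaN : {morph qa : p / - p}. Proof. by move=> p; rewrite /qa scaleNr. Qed.
Let qaM : {morph qa : p q / p * q}.
Proof. by move=> p q; rewrite /qa -!in_algE rmorphM. Qed.
Let qa2 : qa 2 = 2. Proof. by rewrite /qa -in_algE rmorph_nat. Qed.

Definition fixed_act (Z : sl2 rat) (u : M) : M :=
  fix_of c ((Z 0 0)%:A *: D (In u) + (Z 0 1)%:A *: E (In u) + (Z 1 0)%:A *: F (In u)).
Local Notation act := fixed_act.

Let actE Z u : In (act Z u) = sl2P (qa (Z 0 0)) (qa (Z 0 1)) (qa (Z 1 0)) (In u).
Proof. by apply: fix_ofE; rewrite !conj_D !conj_Z cD cE cF fixedE !conjQ_alg. Qed.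

Lemma fixed_act_l m : linear (act^~ m).
Proof.
move=> q Z W; apply: fixed_eq; rewrite fixed_lin !actE !mxE !qaD !qaM /sl2P.
by move: (D _) (E _) (F _) => x y z; lmodule Qi.
Qed.
Lemma fixed_act_r Z : linear (act Z).
Proof.
move=> q u v; apply: fixed_eq; rewrite fixed_lin !actE /sl2P fixed_lin.
by rewrite D_lin E_lin F_lin; lmodule Qi.
Qed.

Lemma fixed_act_b Z W m : act (bracket Z W) m = act Z (act W m) - act W (act Z m).
Proof.
apply: fixed_eq; rewrite fixedB !actE.
have mxB (U V : 'M[rat]_2) i j : (U - V) i j = U i j - V i j by rewrite !mxE.
have e00 : bracket Z W 0 0 = Z 0 1 * W 1 0 - W 0 1 * Z 1 0.
  by rewrite /= mxB !mulmx2E; ring.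
have e01 : bracket Z W 0 1 = 2 * (Z 0 0 * W 0 1 - W 0 0 * Z 0 1).
  by rewrite /= mxB !mulmx2E !sl2_11; ring.
have e10 : bracket Z W 1 0 = 2 * (Z 1 0 * W 0 0 - W 1 0 * Z 0 0).
  by rewrite /= mxB !mulmx2E !sl2_11; ring.
have qB a b a' b' : qa (a * b - a' * b') = qa a * qa b - qa a' * qa b' by rewrite qaD qaN !qaM.
rewrite e00 e01 e10 qaM [qa (2 * (Z 1 0 * _ - _))]qaM !qB qa2.
exact: (sl2_bracketP (qa (Z 0 0)) (qa (Z 0 1)) (qa (Z 1 0))).
Qed.

(** F (x) M is the whole module: a vector is its real part plus i times its
    imaginary part. *)
Lemma fixed_tens : exists j : tens Qi M -> P,
  [/\ linear j, bijective j, forall m, j (pure 1 m) = In m &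
   [/\ forall u, j (exD act u) = D (j u), forall u, j (exE act u) = E (j u),
   forall u, j (exF act u) = F (j u) & forall u, j (tens_map conjQ id u) = c (j u)]].
Proof.
have [//|j [j_lin hj]] := @tens_extend Qi M P In.
have jD := linear_add j_lin; have jZ := linear_scale j_lin.
have cD' : {morph c : u v / u + v} by exact: conj_D.
have jop Z (T : P -> P) : linear T -> (forall m, In (act Z m) = T (In m)) ->
    forall u, j (tens_map id (act Z) u) = T (j u).
  move=> T_lin h; have aL := @tens_map_linear Qi M M _ (fixed_act_r Z).
  apply: tens_ext => [u v|u v|a m]; rewrite ?(linear_add aL) ?jD ?(linear_add T_lin) //.
  rewrite (tens_map_pure _ (fixed_act_r Z)) // pureE [in RHS]pureE !jZ !hj.
  by rewrite (linear_scale T_lin) h.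
have jc u : j (tens_map conjQ id u) = c (j u).
  have eD := tens_mapD conjQ_linear (@linear_id _ M).
  move: u; apply: tens_ext => [u v|u v|a m]; rewrite ?eD ?jD ?cD' //.
  rewrite (tens_map_pure conjQ_linear) // pureE [in RHS]pureE !jZ !hj.
  by rewrite conj_Z fixedE.
exists j; split=> //; last first.
  split=> //.
  - apply: jop => // m; rewrite actE /sl2P !sl2_ofE.
    by rewrite /qa -!in_algE rmorph0 rmorph1; lmodule Qi.
  - apply: jop => // m; rewrite actE /sl2P !sl2_ofE.
    by rewrite /qa -!in_algE rmorph0 rmorph1; lmodule Qi.
  - apply: jop => // m; rewrite actE /sl2P !sl2_ofE.
    by rewrite /qa -!in_algE rmorph0 rmorph1; lmodule Qi.
have cN := morph_addN cD'.
have i2 : imQ * (- 2^-1 * imQ) = 2^-1 by field: imQ_sqr; rewrite natQ_eq0.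
have h2 : 2^-1 + 2^-1 = 1 :> Qi by qfield.
have c2 : conjQ 2^-1 = 2^-1 by rewrite fmorphV rmorph_nat.
have ci : conjQ (- 2^-1 * imQ) = 2^-1 * imQ.
  have n2 : conjQ (- 2^-1) = - 2^-1 by exact: etrans (rmorphN conjQ _) (congr1 _ c2).
  exact: etrans (rmorphM conjQ _ _) (etrans (congr2 *%R n2 conjQ_im) (mulrNN _ _)).
apply: bijective_of => [u v e|w].
  apply/eqP; rewrite -subr_eq0; apply/eqP.
  have {e} : j (u - v) = 0 by rewrite jD (linear_opp j_lin) e subrr.
  move: (u - v) => {u v} w e; have ew := tens_reimE w.
  set x := tens_re w in ew; set y := tens_im w in ew.
  rewrite ew jD jZ !hj in e.
  have e' : In x - imQ *: In y = 0.
    by have := congr1 c e; rewrite cD' conj_Z !fixedE conjQ_im scaleNr (morph_add0 cD').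
  have hx : In x = 0.
    transitivity (2^-1 *: (In x + imQ *: In y) + 2^-1 *: (In x - imQ *: In y)).
      by rewrite -scalerDr addrACA subrr addr0 scalerDr -scalerDl h2 scale1r.
    by rewrite e e' !scaler0 addr0.
  have hy : In y = 0.
    transitivity (- imQ *: (imQ *: In y)); first by rewrite scalerA mulNr imQ_sqr opprK scale1r.
    by move: e; rewrite hx add0r => ->; rewrite scaler0.
  have x0 : x = 0 by apply: fixed_eq; rewrite hx fixed0.
  have y0 : y = 0 by apply: fixed_eq; rewrite hy fixed0.
  by rewrite ew x0 y0 pure0r scaler0 addr0.
pose x := 2^-1 *: (w + c w); pose y := (- 2^-1 * imQ) *: (w - c w).
have cx : c x = x by rewrite /x conj_Z cD' cK c2 addrC.
have cy : c y = y.
  by rewrite /y conj_Z cD' cN cK ci -[c w - w]opprB scalerN -scaleNr mulNr.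
exists (pure 1 (fix_of c x) + imQ *: pure 1 (fix_of c y)).
rewrite jD jZ !hj (fix_ofE cx) (fix_ofE cy) /x /y scalerA i2 -scalerDr addrACA subrr addr0.
by rewrite scalerDr -scalerDl h2 scale1r.
Qed.
End FixedAct.

Section Descent.
Variables (l : nat) (P : lmodType Qi) (H X Y : P -> P) (c : conjugation P).
Hypothesis hP : hcmod l H X Y.
Hypotheses (cX : forall u, c (X u) = Y (c u)) (cY : forall u, c (Y u) = X (c u))
  (cK : involutive c).
Let H_lin := hc_H hP.
Let X_lin := hc_X hP.
Let Y_lin := hc_Y hP.
Let LR := (linear_add X_lin, linear_add Y_lin, linear_add H_lin, linear_scale X_lin,
  linear_scale Y_lin, linear_scale H_lin, linear_opp X_lin, linear_opp Y_lin, linear_opp H_lin).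
Let cH u : c (H u) = - H (c u) := c_H hP (conj_D c) cX cY u.

(* The standard basis of sl_2 in terms of H, X and Y. *)
Let i2 : Qi := 2^-1 * imQ.
Let D u := X u + Y u.
Let E u := - i2 *: X u + i2 *: Y u + i2 *: H u.
Let F u := - i2 *: X u + i2 *: Y u + - i2 *: H u.

Let DE u : D (E u) = E (D u) + 2 *: E u.
Proof.
have hXY v : X (Y v) = Y (X v) + H v by rewrite -(hc_XY hP) addrC subrK.
rewrite /D /E !LR !(hc_HX hP, hc_HY hP) !hXY; rewrite /i2.
by lmodule_with Qi ltac:(field: imQ_sqr; rewrite natQ_eq0 //).
Qed.
Let DF u : D (F u) = F (D u) - 2 *: F u.
Proof.
have hXY v : X (Y v) = Y (X v) + H v by rewrite -(hc_XY hP) addrC subrK.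
rewrite /D /F !LR !(hc_HX hP, hc_HY hP) !hXY; rewrite /i2.
by lmodule_with Qi ltac:(field: imQ_sqr; rewrite natQ_eq0 //).
Qed.
Let EF u : E (F u) = F (E u) + D u.
Proof.
have hXY v : X (Y v) = Y (X v) + H v by rewrite -(hc_XY hP) addrC subrK.
rewrite /D /E /F !LR !(hc_HX hP, hc_HY hP) !hXY; rewrite /i2.
by lmodule_with Qi ltac:(field: imQ_sqr; rewrite natQ_eq0 //).
Qed.

Let c_i2 : conjQ i2 = - i2.
Proof. apply: etrans (rmorphM conjQ _ _) _; rewrite fmorphV rmorph_nat -mulrN; exact: congr1 _ conjQ_im. Qed.
Let c_i2N : conjQ (- i2) = i2.
Proof. exact: etrans (rmorphN conjQ _) (etrans (congr1 _ c_i2) (opprK _)). Qed.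
Let cA u v : c (u + v) = c u + c v. Proof. exact: conj_D. Qed.
Let cS a u : c (a *: u) = conjQ a *: c u. Proof. exact: conj_Z. Qed.
Let cD u : c (D u) = D (c u).
Proof. by rewrite /D cA cX cY addrC. Qed.
Let cE u : c (E u) = E (c u).
Proof. by rewrite /E !cA !cS cX cY cH ?c_i2N c_i2; lmodule Qi. Qed.
Let cF u : c (F u) = F (c u).
Proof. by rewrite /F !cA !cS cX cY cH ?c_i2N c_i2; lmodule Qi. Qed.

(** The real form of sl_2 is fixed by exchanging X and Y and negating H, so that
    its action preserves the vectors fixed by c. *)
Lemma descent_algebra : exists (M : lmodType rat) (act : sl2 rat -> M -> M) (j : tens Qi M -> P),
  [/\ forall m, linear (act^~ m), forall Z, linear (act Z) &
   forall Z W m, act (bracket Z W) m = act Z (act W m) - act W (act Z m)] /\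
  [/\ linear j, bijective j, forall u, j (tens_map conjQ id u) = c (j u) &
   [/\ forall u, j (exH act u) = H (j u), forall u, j (exX act u) = X (j u)
   & forall u, j (exY act u) = Y (j u)]].
Proof.
have D_lin : linear D by move=> a u v; rewrite /D X_lin Y_lin; lmodule Qi.
have E_lin : linear E by move=> a u v; rewrite /E X_lin Y_lin H_lin; lmodule Qi.
have F_lin : linear F by move=> a u v; rewrite /F X_lin Y_lin H_lin; lmodule Qi.
have [j [j_lin jb _ [jD jE jF jc]]] := fixed_tens D_lin E_lin F_lin cD cE cF cK.
have act_r := fixed_act_r D_lin E_lin F_lin cD cE cF.
exists (fixed c), (@fixed_act P c D E F), j; split; first split.
- exact: fixed_act_l cD cE cF.
- exact: act_r.
- exact: fixed_act_b D_lin E_lin F_lin DE DF EF cD cE cF.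
have jA := linear_add j_lin; have jZ := linear_scale j_lin; have jN := linear_opp j_lin.
split; [exact: j_lin|exact: jb|exact: jc|split=> u].
- rewrite exHE jZ jA jN jF jE /E /F.
  by move: (X _) (Y _) (H _) => x y z; lmodule_with Qi ltac:(rewrite /i2; field: imQ_sqr; rewrite natQ_eq0 //).
- rewrite exXE jZ jA jD jZ jA jE jF /D /E /F.
  by move: (X _) (Y _) (H _) => x y z; lmodule_with Qi ltac:(rewrite /i2; field: imQ_sqr; rewrite natQ_eq0 //).
- rewrite exYE jZ jA jN jD jZ jA jE jF /D /E /F.
  by move: (X _) (Y _) (H _) => x y z; lmodule_with Qi ltac:(rewrite /i2; field: imQ_sqr; rewrite natQ_eq0 //).
Qed.
End Descent.

(** * Finite generation over the enveloping algebra *)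

Section Generated.
Variables (M : gkmod) (n : nat) (e : 'I_n -> M).

Definition generated (m : M) : Prop :=
  exists w : 'I_n -> seq (rat * seq (sl2 rat)), m = \sum_i env_act (w i) (e i).

Lemma env_act_cat (v w : seq (rat * seq (sl2 rat))) (m : M) :
  env_act (v ++ w) m = env_act v m + env_act w m.
Proof. by rewrite /env_act big_cat. Qed.

Lemma generated0 : generated 0.
Proof. by exists (fun _ => [::]); rewrite big1 // => i _; rewrite /env_act big_nil. Qed.
Lemma generatedD u v : generated u -> generated v -> generated (u + v).
Proof.
move=> [w ->] [w' ->]; exists (fun i => w i ++ w' i).
by rewrite -big_split; apply: eq_bigr => i _; rewrite env_act_cat.
Qed.
Lemma generatedZ q u : generated u -> generated (q *: u).
Proof.
move=> [w ->]; exists (fun i => [seq (q * p.1, p.2) | p <- w i]).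
rewrite scaler_sumr; apply: eq_bigr => i _; rewrite /env_act big_map scaler_sumr.
by apply: eq_bigr => p _; rewrite scalerA.
Qed.
Lemma generated_act Z u : generated u -> generated (gk_g Z u).
Proof.
have aL : linear (@gk_g M Z) := gk_linr (gkP M) Z.
move=> [w ->]; exists (fun i => [seq (p.1, Z :: p.2) | p <- w i]).
rewrite (morph_sum (linear_add aL)); apply: eq_bigr => i _.
rewrite /env_act big_map (morph_sum (linear_add aL)); apply: eq_bigr => p _.
exact: linear_scale aL _ _.
Qed.
Lemma generated_gen i : generated (e i).
Proof.
exists (fun j => if j == i then [:: (1, [::])] else [::]).
rewrite (bigD1 i) //= eqxx big1 ?addr0 => [|j /negPf ->]; last by rewrite /env_act big_nil.
by rewrite /env_act big_seq1 scale1r.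
Qed.

(** Extending scalars turns the span over the enveloping algebra into a
    subspace over F stable under X and Y. *)
Definition generated_ext (u : ext M) : Prop :=
  exists m m', [/\ generated m, generated m' & u = pure 1 m + imQ *: pure 1 m'].

Lemma generated_ext0 : generated_ext 0.
Proof.
exists 0, 0; split; try exact: generated0.
by rewrite pure0r scaler0 addr0.
Qed.
Lemma generated_extD u v : generated_ext u -> generated_ext v -> generated_ext (u + v).
Proof.
move=> [m [m' [h h' ->]]] [k [k' [g g' ->]]]; exists (m + k), (m' + k').
split; try exact: generatedD.
by rewrite !pureDr scalerDr addrACA.
Qed.
Lemma generated_extZ a u : generated_ext u -> generated_ext (a *: u).
Proof.
move=> [m [m' [h h' ->]]]; exists (reQ a *: m - imagQ a *: m'), (imagQ a *: m + reQ a *: m').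
have gN k : generated k -> generated (- k) by rewrite -scaleN1r; exact: generatedZ.
split; [|by apply: generatedD; exact: generatedZ|].
  by apply: generatedD; [|apply: gN]; exact: generatedZ.
rewrite !pureDr pureNr !pureZr {1}[a]QiE.
by move: (pure 1 m) (pure 1 m') => x y; lmodule_with Qi ltac:(ring: imQ_sqr).
Qed.
Lemma generated_ext_act Z u : generated_ext u -> generated_ext (tens_map id (@gk_g M Z) u).
Proof.
have aL : linear (@gk_g M Z) := gk_linr (gkP M) Z.
have tL := @tens_map_linear Qi M M _ aL.
move=> [m [m' [h h' ->]]]; exists (gk_g Z m), (gk_g Z m').
split; try exact: generated_act.
by rewrite (linear_add tL) (linear_scale tL) !(tens_map_pure _ aL).
Qed.
Lemma generated_ext_X u : generated_ext u -> generated_ext (opX u).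
Proof.
move=> h; have := exXE (@gk_g M) u; rewrite -/(opX u) => e1.
rewrite [opX u]e1; apply: generated_extZ; apply: generated_extD; first exact: generated_ext_act.
by apply: generated_extZ; apply: generated_extD; exact: generated_ext_act.
Qed.
Lemma generated_ext_Y u : generated_ext u -> generated_ext (opY u).
Proof.
move=> h; have e1 := exYE (@gk_g M) u.
rewrite [opY u]e1; apply: generated_extZ; apply: generated_extD; first exact: generated_ext_act.
rewrite -scaleN1r; do 2!apply: generated_extZ.
by apply: generated_extD; exact: generated_ext_act.
Qed.
Lemma generated_ext_pure m : generated_ext (pure 1 m) -> generated m.
Proof.
move=> [k [k' [h _ e1]]]; have := congr1 (@tens_re M) e1.
rewrite tens_reD tens_re1 (_ : imQ *: pure 1 k' = pure imQ k'); last by rewrite -pureE.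
by rewrite tens_re1 tens_re_pure [reQ _]/(0 : rat) scale0r addr0 => ->.
Qed.
End Generated.

(** * Harish-Chandra modules by descent *)

Lemma weighted_pull (P Q : lmodType Qi) (HP : P -> P) (HQ : Q -> Q) (j : P -> Q) :
  linear HP -> linear j -> bijective j -> (forall u, j (HP u) = HQ (j u)) ->
  linear HQ -> weighted HQ -> weighted HP.
Proof.
move=> HP_lin j_lin j_bij jH HQ_lin hw; have j_inj := bij_inj j_bij; have [g jK gK] := j_bij.
have gD : {morph g : u v / u + v}.
  by move=> u v; apply: j_inj; rewrite (linear_add j_lin) !gK.
apply: weighted_gen => // u; exists [seq g (wcomp HQ k (j u)) | k <- wsupp HQ (j u)]; split.
  move=> x /mapP[k _ ->]; exists k; apply: j_inj.
  by rewrite jH (linear_scale j_lin) gK; exact: wt_wcomp hw _ _.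
by rewrite big_map -(morph_sum gD) -wsum_id ?jK.
Qed.

Section DescentHC.
Variables (l : nat) (P : lmodType Qi) (H X Y : P -> P).
Hypotheses (l_gt0 : (0 < l)%N) (hP : hcmod l H X Y).
Variables (n : nat) (e : 'I_n -> P).
Hypotheses (gen : forall Q : P -> Prop, Q 0 ->
    (forall u v, Q u -> Q v -> Q (u + v)) -> (forall a u, Q u -> Q (a *: u)) ->
    (forall u, Q u -> Q (X u)) -> (forall u, Q u -> Q (Y u)) ->
    (forall i, Q (e i)) -> forall u, Q u)
  (fin : forall k, exists (d : nat) (b : 'I_d -> P), (forall i, wt H k (b i)) /\
    forall u, wt H k u -> exists a : 'I_d -> Qi, u = \sum_i a i *: b i).
Variables (M : gkmod) (j : ext M -> P).
Hypotheses (j_lin : linear j) (j_bij : bijective j).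
Hypotheses (jH : forall u, j (opH u) = H (j u)) (jX : forall u, j (opX u) = X (j u))
  (jY : forall u, j (opY u) = Y (j u)).
Let jD := linear_add j_lin.
Let jZ := linear_scale j_lin.
Let jN := linear_opp j_lin.
Let j_inj : injective j := bij_inj j_bij.
Let j_surj v : exists u, j u = v.
Proof. by have [g _ gK] := j_bij; exists (g v). Qed.

Lemma descent_wt k u : wt (@opH M) k u <-> wt H k (j u).
Proof. by rewrite /wt -jH -jZ; split=> [->|/j_inj]. Qed.

Let j_nilop u : j (opN l u) = nilop l H X Y (j u).
Proof.
have c : j (casimir (@opH M) (@opX M) (@opY M) u) = casimir H X Y (j u).
  by rewrite /casimir (jD (_ + _) u) (jD (_ - _)) (jD (opH (opH u))) jN !jZ !jH jX jY.
by rewrite /opN /nilop jZ jD jN jZ c.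
Qed.

(* The generators over F are replaced by their real and imaginary parts. *)
Let fg : exists (n : nat) (e : 'I_n -> M), forall m, exists w : 'I_n -> seq (rat * seq (sl2 rat)),
  m = \sum_i env_act (w i) (e i).
Proof.
have [u hu] := choice (fun i => j_surj (e i)).
pose e' (i : 'I_(n + n)) : M :=
  match fintype.split i with inl i => tens_re (u i) | inr i => tens_im (u i) end.
exists (n + n)%N, e' => m; apply: generated_ext_pure.
pose Q v := forall w, j w = v -> generated_ext e' w.
apply: (gen (Q := Q)) (erefl (j (pure 1 m))) => {m}.
- move=> w ew; have -> : w = 0 by apply: j_inj; rewrite ew (linear_zero j_lin).
  exact: generated_ext0.
- move=> v1 v2 h1 h2 w ew; have [w1 e1] := j_surj v1; have [w2 e2] := j_surj v2.
  have -> : w = w1 + w2 by apply: j_inj; rewrite ew jD e1 e2.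
  by apply: generated_extD; [exact: h1|exact: h2].
- move=> a v h w ew; have [w' e1] := j_surj v.
  have -> : w = a *: w' by apply: j_inj; rewrite ew jZ e1.
  exact/generated_extZ/h.
- move=> v h w ew; have [w' e1] := j_surj v.
  have -> : w = opX w' by apply: j_inj; rewrite ew jX e1.
  exact/generated_ext_X/h.
- move=> v h w ew; have [w' e1] := j_surj v.
  have -> : w = opY w' by apply: j_inj; rewrite ew jY e1.
  exact/generated_ext_Y/h.
- move=> i w; rewrite -hu => /j_inj ->.
  exists (tens_re (u i)), (tens_im (u i)); split; last exact: tens_reimE.
    have := generated_gen e' (unsplit (inl i)); rewrite /e' unsplitK; exact.
  have := generated_gen e' (unsplit (inr i)); rewrite /e' unsplitK; exact.
Qed.

Let finite k : finite_dim (weight M k).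
Proof.
have [d [b [hb hspan]]] := fin k.
have [|w hw] := @choice _ _ (fun i (w : weight M k) => j (weight_val w) = b i).
  move=> i; have [u hu] := j_surj (b i).
  have [|w hw] := @weight_of M k u; first by apply/descent_wt; rewrite hu.
  by exists w; rewrite hw.
exists d, w => v; have [|a ha] := hspan (j (weight_val v)).
  by apply/descent_wt; exact: weight_wt.
exists a; apply: weight_eq; apply: j_inj; rewrite ha.
have L := linear_add (@weight_val_linear M k).
rewrite (morph_sum L) (morph_sum jD); apply: eq_bigr => i _.
by rewrite (linear_scale (@weight_val_linear M k)) jZ hw.
Qed.

Let character : exists k : nat, forall m : M,
  iter k (fun u : ext M => opC u - ratr (l%:R ^+ 2) *: u) (pure 1 m) = 0.
Proof.
have [k hk] := hc_nil hP; exists k => m; apply: j_inj; rewrite (linear_zero j_lin).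
have lam : ratr (l%:R ^+ 2) = l%:R ^+ 2 :> Qi by rewrite -natrX ratr_nat natrX.
have step (u : ext M) : j (opC u - ratr (l%:R ^+ 2) *: u) = 4 *: nilop l H X Y (j u).
  by rewrite (opCE l) lam addrK jZ j_nilop.
suff -> i : j (iter i (fun u : ext M => opC u - ratr (l%:R ^+ 2) *: u) (pure 1 m)) =
    4 ^+ i *: iter i (nilop l H X Y) (j (pure 1 m)) by rewrite hk scaler0.
elim: i => [|i IH]; first by rewrite scale1r.
by rewrite !iterS step IH (linear_scale (nilop_lin hP)) scalerA -exprS.
Qed.

Let opH_weighted : weighted (@opH M).
Proof. exact: weighted_pull (@opH_lin M) j_lin j_bij jH (hc_H hP) (hc_weighted hP). Qed.

(** -1 acts by (-1)^n on weight n, and all weights have the parity of l - 1. *)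
Let parity m : gk_k (so2_neg _) (pure (1 : rat^o) m) = pure (1 : rat^o) ((-1) ^+ l.-1 *: m) :> tens rat^o M.
Proof.
pose iQ : {lrmorphism Qi -> Qi} := idfun.
have idQ (w : ext M) : baseQ iQ w = w by exact: tens_map_id.
have kneg u : gk_k (so2_neg Qi) u = (-1) ^+ l.-1 *: u :> ext M.
  move: u; apply: (wt_ext opH_weighted) => [u v|u v|k u hu].
  - exact: gk_kD.
  - exact: scalerDr.
  have [->|/eqP u0] := eqVneq u 0.
    by rewrite scaler0; exact: morph_add0 (@gk_kD _ _ _).
  rewrite -{1}[u]idQ (gk_k_wt iQ _ hu) idQ; congr (_ *: _).
  have [|i ->] := hc_parity hP ((descent_wt k u).1 hu).
    by move=> ju; apply: u0; apply: j_inj; rewrite ju (linear_zero j_lin).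
  have -> : kpow iQ (so2_neg Qi) (widx l i) = zpow (-1) (-1) (widx l i).
    by rewrite /kpow /kz /kz' [so2y _]/(0) mulr0 ?subr0 ?addr0.
  have -> k' : zpow (-1 : Qi) (-1) k' = (-1) ^+ `|k'|%N by case: k' => m'.
  by rewrite -signr_odd -[in RHS]signr_odd; congr (_ ^+ _); congr nat_of_bool; rewrite /widx; lia.
have [phi [phi_neg p1]] := rat_incl.
have [m' em'] : exists m', gk_k (so2_neg _) (pure (1 : rat^o) m) = pure 1 m' :> tens rat^o M.
  elim/tens_ind: (gk_k _ _) => [|u v [x ->] [y ->]|a x].
  - by exists 0; rewrite pure0r.
  - by exists (x + y); rewrite pureDr.
  - exists ((a : rat) *: x); rewrite pureZr pureE; congr (_ *: _).
    by rewrite [RHS]mulr1.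
rewrite em'; congr pure; apply: pure1_inj; rewrite -p1 -em' (so2_rep_nat (gk_rep (gkP M))) p1.
by rewrite phi_neg kneg pureZr -in_algE rmorphXn rmorphN1.
Qed.

Lemma descent_is_HC : is_HC l (l%:R ^+ 2) M.
Proof. by split; [exact: fg|exact: finite|exact: character|exact: parity]. Qed.
End DescentHC.

(** * Essential surjectivity *)

Lemma cat_family (T : Type) (a b : nat) (f : 'I_a -> T) (g : 'I_b -> T) :
  exists h : 'I_(a + b) -> T, (forall i, exists k, h k = f i) /\ forall i, exists k, h k = g i.
Proof.
exists (fun k => match fintype.split k with inl i => f i | inr i => g i end).
by split=> i; [exists (unsplit (inl i))|exists (unsplit (inr i))]; rewrite unsplitK.
Qed.

Section ModelGenerated.
Variables (l : nat) (R : rep_obj) (P : lmodType Qi) (H X Y : P -> P).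
Variables (em : forall v, R v -> P) (at_ : forall v, P -> R v).
Hypotheses (l_gt0 : (0 < l)%N) (hR : is_model l H X Y em at_).
Let hP := mod_hc hR.

Lemma model_generated : exists (n : nat) (e : 'I_n -> P), forall Q : P -> Prop, Q 0 ->
  (forall u v, Q u -> Q v -> Q (u + v)) -> (forall a u, Q u -> Q (a *: u)) ->
  (forall u, Q u -> Q (X u)) -> (forall u, Q u -> Q (Y u)) ->
  (forall i, Q (e i)) -> forall u, Q u.
Proof.
have [nm [bm hm]] := rep_finite (repP R) vminus.
have [ns [bs hs]] := rep_finite (repP R) vstar.
have [np [bp hp]] := rep_finite (repP R) vplus.
have [e1 [h1 h2]] := cat_family (fun i => em (bm i)) (fun i => em (bs i)).
have [e [h3 h4]] := cat_family e1 (fun i => em (bp i)).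
exists ((nm + ns) + np)%N, e => Q Q0 QD QZ QX QY Qe.
have span v d (b : 'I_d -> R v) : (forall x, exists a : 'I_d -> Qi, x = \sum_i a i *: b i) ->
    (forall i, Q (em (b i))) -> forall u, wt H (widx l (vidx l v)) u -> Q u.
  move=> hb Qb u /(mod_atK hR) <-; have [a ->] := hb (at_ v u).
  rewrite (morph_sum (linear_add (mod_em hR (v := v)))).
  elim/big_ind: _ => // i _; rewrite (linear_scale (mod_em hR (v := v))).
  exact/QZ/Qb.
have Qm : forall u, wt H (widx l (-1)) u -> Q u.
  apply: (span vminus _ _ hm) => i; have [k <-] := h1 i; have [k' <-] := h3 k; exact: Qe.
have Qs : forall u, wt H (widx l 0) u -> Q u.
  apply: (span vstar _ _ hs) => i; have [k <-] := h2 i; have [k' <-] := h3 k; exact: Qe.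
have Qp : forall u, wt H (widx l l%:Z) u -> Q u.
  by apply: (span vplus _ _ hp) => i; have [k <-] := h4 i.
have it (T : P -> P) (QT : forall u, Q u -> Q (T u)) j u : Q u -> Q (iter j T u).
  by move=> hu; elim: j => [//|j IH]; exact: QT.
by apply: (hc_ind l_gt0 hP) => // j u hu; apply: it => //;
  [exact: Qp|exact: Qs|exact: Qm].
Qed.

Lemma model_weight_finite k : exists (d : nat) (b : 'I_d -> P), (forall i, wt H k (b i)) /\
  forall u, wt H k u -> exists a : 'I_d -> Qi, u = \sum_i a i *: b i.
Proof.
have [v [f [f_lin fw fs]]] := mod_finite hR k; have [d [b hb]] := rep_finite (repP R) v.
exists d, (fun i => f (b i)); split=> [i|u /fs[x ->]]; first exact: fw.
have [a ->] := hb x; exists a; rewrite (morph_sum (linear_add f_lin)).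
by apply: eq_bigr => i _; rewrite (linear_scale f_lin).
Qed.
End ModelGenerated.

Section Realization.
Variables (l : nat) (R : rep_obj) (P : lmodType Qi) (H X Y : P -> P) (c : P -> P).
Variables (em : forall v, R v -> P) (at_ : forall v, P -> R v).
Hypotheses (l_gt0 : (0 < l)%N) (hR : is_model l H X Y em at_).
Let hP := mod_hc hR.
Local Notation N := (nilop l H X Y).
Variables (m : nat) (s : {poly rat}).
Hypotheses (m_gt0 : (0 < m)%N) (Nm : forall u, iter m N u = 0) (hs : inv_sqrt m (tau l) s).
Local Notation psi := (model_var em at_).
Hypotheses (cm : forall u, wt H (widx l (-1)) u -> var_minus l H X Y c s u = psi vminus u)
  (cs : forall u, wt H (widx l 0) u -> var_star l H X Y c s u = psi vstar u)
  (cp : forall u, wt H (widx l l%:Z) u -> var_plus l H X Y c s u = psi vplus u).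
Variables (M : gkmod) (j : ext M -> P).
Hypotheses (hM : is_HC l (l%:R ^+ 2) M) (j_lin : linear j) (j_bij : bijective j)
  (jc : forall u, j (opc u) = c (j u)) (jX : forall u, j (opX u) = X (j u))
  (jY : forall u, j (opY u) = Y (j u)).
Let cM := gk_hcmod l_gt0 hM.
Let j_inj : injective j := bij_inj j_bij.
Let jwt := int_wt cM hP j_lin jX jY.
Let jXs u : j (Xs l (@opX M) u) = Xs l X (j u) := int_Xs l j_lin jX u.
Let jact p u : j (pact (nilop l (@opH M) (@opX M) (@opY M)) p u) = pact N p (j u) :=
  int_act cM hP j_lin jX jY p u.
Let NmM (u : ext M) : iter m (nilop l (@opH M) (@opX M) (@opY M)) u = 0.
Proof. by apply: j_inj; rewrite iter_pact ?jact -?iter_pact ?Nm ?(linear_zero j_lin) //; exact: nilop_lin. Qed.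

(** The comparison of the quiver representation of M with R: both are the weight
    spaces of the model at the vertices. *)
Definition realize (v : vertex) (x : E_data l M v) : R v := at_ v (j (weight_val x)).

Let val_wt v (x : E_data l M v) : wt H (widx l (vidx l v)) (j (weight_val x)).
Proof. by rewrite -vweightE; apply: jwt; exact: weight_wt. Qed.
Let val_em v (x : E_data l M v) : j (weight_val x) = em (realize x).
Proof. by rewrite /realize (mod_atK hR). Qed.

Lemma realize_hom : is_rephom realize.
Proof.
split.
- by move=> v a x y; rewrite /realize weight_val_linear j_lin (mod_at hR).
- move=> v w [] x; rewrite {1}/realize.
  + have h := congr1 j (E_a_plus l_gt0 hM x).
    rewrite jXs jY [j (weight_val x)]val_em (mod_a_plus hR) in h.
    have /= hw := val_wt (@rphi (E_data l M) _ _ a_plus x).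
    by rewrite (Xs_inj2 l_gt0 hP hw (mod_wt hR (v := vstar) _) h) (mod_emK hR).
  + by rewrite (congr1 j (E_a_minus x)) jX [j (weight_val x)]val_em (mod_a_minus hR) (mod_emK hR).
  + rewrite (congr1 j (E_b_plus l_gt0 hM x)) jX jXs [j (weight_val x)]val_em.
    by rewrite (mod_b_plus hR) (mod_emK hR).
  + by rewrite (congr1 j (E_b_minus x)) jY [j (weight_val x)]val_em (mod_b_minus hR) (mod_emK hR).
- case=> x; rewrite {1}/realize.
  + rewrite (congr1 j (E_var_minus l_gt0 hM m_gt0 NmM hs x)) /var_minus jc jact.
    exact: etrans (congr1 (at_ vplus) (cm (val_wt x))) (mod_emK hR _).
  + rewrite (congr1 j (E_var_star l_gt0 hM m_gt0 NmM hs x)) /var_star jc jXs jact.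
    exact: etrans (congr1 (at_ vstar) (cs (val_wt x))) (mod_emK hR _).
  + rewrite (congr1 j (E_var_plus l_gt0 hM m_gt0 NmM hs x)) /var_plus jc jact.
    exact: etrans (congr1 (at_ vminus) (cp (val_wt x))) (mod_emK hR _).
Qed.

Lemma realize_bij v : bijective (@realize v).
Proof.
apply: bijective_of => [x y e|z].
  by apply/weight_eq/j_inj; rewrite !val_em e.
have [g _ gK] := j_bij.
have hw : wt (@opH M) (vweight l v) (g (em z)).
  apply: j_inj; rewrite (int_H cM hP j_lin jX jY) gK (linear_scale j_lin) gK vweightE.
  exact: (mod_wt hR).
have [x ex] := weight_of hw; exists x.
by rewrite /realize ex gK (mod_emK hR).
Qed.
End Realization.

Theorem E_essentially_surjective (l : nat) (R : rep_obj) : (0 < l)%N ->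
  exists (M : gkmod) (f : forall v, E_data l M v -> R v),
  [/\ is_HC l (l%:R ^+ 2) M, is_rephom f & forall v, bijective (f v)].
Proof.
move=> l_gt0; have [P [H [X [Y [em [at_ hR]]]]]] := quiver_model R l_gt0.
have hP := mod_hc hR; have [m hm] := hc_nil hP.
have Nm u : iter m.+1 (nilop l H X Y) u = 0 by rewrite iterS hm (linear_zero (nilop_lin hP)).
have [s hs] := inv_sqrt_exists (ltn0Sn m) (tau_at0 l).
have [c [[cD cZ cX cY cK] [cm cs cp]]] := model_conj l_gt0 hR Nm hs.
have [M [act [j [[act_l act_r act_b] [j_lin j_bij jc [jH jX jY]]]]]] :=
  descent_algebra (c := Conjugation cD cZ) hP cX cY cK.
have exH_w : weighted (exH act).
  exact: weighted_pull (exH_lin act_r) j_lin j_bij jH (hc_H hP) (hc_weighted hP).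
have [k hk] := integrable act_l act_r act_b exH_w.
pose Mk := GKMod hk.
have [n [e gen]] := model_generated l_gt0 hR.
have hM : is_HC l (l%:R ^+ 2) Mk.
  exact: (@descent_is_HC l P H X Y l_gt0 hP n e gen (model_weight_finite hR) Mk j
    j_lin j_bij jH jX jY).
exists Mk, (@realize l R P at_ Mk j); split; first exact: hM.
- exact: (@realize_hom l R P H X Y c em at_ l_gt0 hR m.+1 s (ltn0Sn m) Nm hs cm cs cp Mk j
    hM j_lin j_bij jc jX jY).
- exact: (@realize_bij l R P H X Y em at_ l_gt0 hR Mk j hM j_lin j_bij jX jY).
Qed.

(** * The equivalence *)

Lemma equivalence_of (C D : category) (F : functor C D) :
  (forall x y (f g : Defs.hom x y), fmor F f = fmor F g -> f = g) ->
  (forall x y (h : Defs.hom (F x) (F y)), exists f : Defs.hom x y, fmor F f = h) ->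
  (forall d : D, exists (x : C) (t : Defs.hom (F x) d) (s : Defs.hom d (F x)),
    compm s t = idm (F x) /\ compm t s = idm d) ->
  is_equivalence F.
Proof.
move=> faithful full esurj.
pose G d := projT1 (cid (esurj d)).
pose t d : Defs.hom (F (G d)) d := projT1 (cid (projT2 (cid (esurj d)))).
pose s d : Defs.hom d (F (G d)) := projT1 (cid (projT2 (cid (projT2 (cid (esurj d)))))).
have [st ts] : (forall d, compm (s d) (t d) = idm _) /\ (forall d, compm (t d) (s d) = idm d).
  by split=> d; have [] := projT2 (cid (projT2 (cid (projT2 (cid (esurj d)))))).
pose lift x y (h : Defs.hom (F x) (F y)) : Defs.hom x y := projT1 (cid (full x y h)).
have liftK x y (h : Defs.hom (F x) (F y)) : fmor F (lift _ _ h) = h.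
  exact: projT2 (cid (full x y h)).
pose Gm x y (f : Defs.hom x y) : Defs.hom (G x) (G y) := lift _ _ (compm (s y) (compm f (t x))).
have FGm x y (f : Defs.hom x y) : fmor F (Gm x y f) = compm (s y) (compm f (t x)) by exact: liftK.
have G1 x : Gm x x (idm x) = idm (G x).
  by apply: faithful; rewrite FGm comp1m st fmor1.
have GM x y z (g : Defs.hom y z) (f : Defs.hom x y) : Gm x z (compm g f) = compm (Gm y z g) (Gm x y f).
  apply: faithful; rewrite fmorM !FGm -!compmA; congr compm; congr compm.
  by rewrite [in RHS]compmA ts comp1m.
pose GF := @Functor D C G Gm G1 GM; exists GF; split.
  exists (fun x => lift _ _ (t (F x))), (fun x => lift _ _ (s (F x))); split=> [x y f|x|x].
  - apply: faithful; rewrite !fmorM !liftK compmA /= ?FGm.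
    by rewrite -?compmA; rewrite ?compmA ts comp1m.
  - by apply: faithful; rewrite fmorM !liftK st fmor1.
  - by apply: faithful; rewrite fmorM !liftK ts fmor1.
exists t, s; split=> [x y f|x|x] /=.
- by rewrite FGm compmA ts comp1m.
- exact: st.
- exact: ts.
Qed.

Lemma rephom_inverse (R S : rep_data) (f : rephom R S) : (forall v, bijective (f v)) ->
  exists g : rephom S R, (forall v x, g v (f v x) = x) /\ forall v x, f v (g v x) = x.
Proof.
move=> fb; pose g v := projT1 (cid (let: Bijective g h1 h2 := fb v in
  ex_intro (fun g => cancel (f v) g /\ cancel g (f v)) g (conj h1 h2))).
have gP v : cancel (f v) (g v) /\ cancel (g v) (f v).
  by rewrite /g; case: cid.
have fK v := (gP v).1; have gK v := (gP v).2; have fI v := bij_inj (fb v).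
have hf := rephomP f.
have hg : is_rephom g.
  split.
  - by move=> v a x y; apply: fI; rewrite (rephom_linear hf) !gK.
  - by move=> v w a x; apply: fI; rewrite (rephom_phi hf) !gK.
  - by move=> v x; apply: fI; rewrite gK (rephom_var hf) gK.
by exists (RepHom hg); split=> v x /=; rewrite ?fK ?gK.
Qed.

Theorem theorem5p1 (l : nat) (lam : rat) (hl : (1 <= l)%N)
    (hlam : lam = l%:R ^+ 2) :
  exists wd : E_wd l lam, is_equivalence (E_functor wd).
Proof.
subst lam; have wd := E_wd_HC hl; exists wd; apply: equivalence_of.
- move=> M N f g e; apply: (E_faithful hl (HCP M)) => v u.
  pose ev (h : rephom (E_data l M) (E_data l N)) := @rephom_fun _ _ h v u.
  have h := congr1 ev (e : RepHom (E_morP wd f) = RepHom (E_morP wd g)); exact: h.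
- move=> M N h; have [f hf] := E_full hl (HCP M) (HCP N) h; exists f.
  apply: rephom_eq; apply: functional_extensionality_dep => v; apply/funext => u; exact: hf.
- move=> R; have [M [f [hM hf fb]]] := E_essentially_surjective R hl.
  have [g [fK gK]] := rephom_inverse (f := RepHom hf) fb.
  exists (HCObj hM), (RepHom hf), g; split; apply: rephom_eq;
    apply: functional_extensionality_dep => v; apply/funext => u; [exact: fK|exact: gK].
Qed.
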